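(* Let $d\in\{1,2,3\}$ and $\alpha>d/2$. Let $u$ be the solution of $i\partial_tu=-\Delta u+\mu|u|^2u$ on $\mathbb{T}^d$, $u(0)=u_0$, let $T>0$ be smaller than its maximal existence time, and suppose $M_{\alpha+2}<\infty$. Let $u^n$ be computed by the scheme sLRI2: $u^0=u_0$, $$u^1=e^{i\tau\Delta}u_0-i\mu\tau e^{i\tau\Delta}\bigl(u_0^2[\varphi_1(-2i\tau\Delta)-\varphi_2(-2i\tau\Delta)]\overline{u_0}\bigr)-i\mu\tau(e^{i\tau\Delta}u_0)^2\bigl[e^{i\tau\Delta}\varphi_2(-2i\tau\Delta)\overline{u_0}\bigr]-\mu^2\tfrac{\tau^2}{2}e^{i\tau\Delta}\bigl[|u_0|^4u_0\bigr],$$ and for $n\ge1$ $$\begin{aligned}u^{n+1}={}&e^{2i\tau\Delta}u^{n-1}-2i\mu\tau e^{i\tau\Delta}\bigl((u^n)^2[\mathrm{Re}\,\varphi_1(-2i\tau\Delta)-\mathrm{Re}\,\varphi_2(-2i\tau\Delta)]\overline{u^n}\bigr)\\&-i\mu\tau(e^{i\tau\Delta}u^n)^2\bigl[e^{i\tau\Delta}\varphi_2(-2i\tau\Delta)\overline{u^n}\bigr]\\&-i\mu\tau e^{2i\tau\Delta}\bigl((e^{-i\tau\Delta}u^n)^2\bigl[e^{-i\tau\Delta}\varphi_2(2i\tau\Delta)\overline{u^n}\bigr]\bigr).\end{aligned}$$ Then for all $0<\tau\le\tau_0$ with $\tau_0>0$ depending on $M_{\alpha+2}$ and $T$, $$\|u(t_n)-u^n\|_{H^\alpha}\le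 C(M_{\alpha+2})\,\tau^2,\qquad0\le n\le T/\tau,\quad t_n=n\tau.$$
   Context: $\mathbb{T}^d$ is the $2\pi$-periodic torus, $\mu$ a nonzero real constant; $H^\alpha=H^\alpha(\mathbb{T}^d)$ is the periodic Sobolev space with norm $\|u\|_{H^\alpha}^2=\sum_{\mathbf{k}\in\mathbb{Z}^d}(1+|\mathbf{k}|^2)^\alpha|\hat u_{\mathbf{k}}|^2$. $M_\delta:=\sup_{0\le t\le T}\|u(t)\|_{H^\delta}$. $\varphi_1(z)=(e^z-1)/z$ and $\varphi_2(z)=(e^z-\varphi_1(z))/z$, extended continuously by $\varphi_1(0)=1$, $\varphi_2(0)=1/2$. Functions of $\Delta$ are Fourier multipliers: $f(\Delta)$ has symbol $f(-|\mathbf{k}|^2)$; $\mathrm{Re}\,\varphi_j(-2i\tau\Delta)$ has symbol $\mathrm{Re}\,\varphi_j(2i\tau|\mathbf{k}|^2)$. $C(M_\delta)$ denotes a positive constant depending on $M_\delta$ and on the fixed data ($T$, $\mu$, $d$, $\alpha$), but independent of $\tau$ and $n$; likewise $\tau_0$ may depend on the fixed data. *)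

(* Defs.v *)
From HB Require Import structures.
From mathcomp Require Import all_boot all_order all_algebra.
From mathcomp Require Import all_classical all_reals all_analysis.
From mathcomp Require Import complex.

Set Implicit Arguments.
Unset Strict Implicit.
Unset Printing Implicit Defensive.

Import Order.TTheory GRing.Theory Num.Theory.
Import numFieldNormedType.Exports.

Local Open Scope classical_set_scope.
Local Open Scope ring_scope.
Local Open Scope complex_scope.

(** * The torus

    Functions on the torus are 2pi-periodic functions on [d.-tuple R]; those in
    a Sobolev space are considered up to equality almost everywhere. *)

Section torus_measure.
Context {R : realType}.

Lemma two_pi_gt0 : 0 < 2 * pi :> R.
Proof. by rewrite mulr_gt0 ?pi_gt0. Qed.

(* [uniform_prob] is a measure on [measurableTypeR R], whose measurable sets
   are those of [R]. *)
Definition cons_point (d : nat) (p : measurableTypeR R * d.-tuple R) :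
    d.+1.-tuple R :=
  [tuple of p.1 :: p.2].

Lemma measurable_cons_point d : measurable_fun setT (@cons_point d).
Proof.
apply: (@measurable_cons _ _ _ R (fun p => p.1) _ (fun p => p.2)).
- exact: measurable_fst.
- exact: measurable_snd.
Qed.

HB.instance Definition _ (d : nat) :=
  isMeasurableFun.Build _ _ _ _ (@cons_point d) (@measurable_cons_point d).

(* Normalized Lebesgue measure [(2 pi)^-d dx] on the cell [[0, 2 pi]^d],
   as an iterated product measure. *)
Fixpoint torus_measure (d : nat) : probability (d.-tuple R) R :=
  match d with
  | 0 => \d_([tuple] : 0.-tuple R)
  | d'.+1 => distribution (uniform_prob two_pi_gt0 \x torus_measure d')%E
                          (@cons_point d')
  end.

End torus_measure.

Section torus_functions.
Context {R : realType} {d : nat}.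
Implicit Types (x : d.-tuple R) (k : 'rV[int]_d) (u : d.-tuple R -> R[i]).

Definition cexp (z : R[i]) : R[i] :=
  (expR (complex.Re z))%:C * (cos (complex.Im z) +i* sin (complex.Im z)).

Definition periodic u : Prop :=
  forall x (i : 'I_d),
    u [tuple tnth x j + (if j == i then 2 * pi else 0) | j < d] = u x.

Definition torus_L2 u : Prop :=
  [/\ periodic u,
      measurable_fun setT (@complex.Re R \o u),
      measurable_fun setT (@complex.Im R \o u) &
      (\int[torus_measure d]_x (ComplexField.Normc.normc (u x) ^+ 2)%:E < +oo)%E].

(** * Fourier series *)

Definition freq_dot k x : R := \sum_(i < d) (k ord0 i)%:~R * tnth x i.

Definition freq_sqnorm k : R := \sum_(i < d) ((k ord0 i)%:~R) ^+ 2.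

Definition fourier_coef u k : R[i] :=
  let f := fun x => u x * cexp (- ('i * (freq_dot k x)%:C)) in
  Rintegral (torus_measure d) setT (@complex.Re R \o f) +i*
  Rintegral (torus_measure d) setT (@complex.Im R \o f).

(* Unconditional sum over Z^d of an absolutely summable family; the value is
   meaningless if the family is not absolutely summable. *)
Definition rsum_freq (a : 'rV[int]_d -> R) : R :=
  fine (\esum_(k in setT) (EFin \o a)^\+ k - \esum_(k in setT) (EFin \o a)^\- k)%E.

Definition csum_freq (a : 'rV[int]_d -> R[i]) : R[i] :=
  rsum_freq (@complex.Re R \o a) +i* rsum_freq (@complex.Im R \o a).

(* The Fourier multiplier [f(Delta)]: the symbol of [Delta] is [- |k|^2].
   The Fourier series converges absolutely when [u] is in [H^s] with [s > d/2]
   and [f] is bounded on the spectrum of [Delta]. *)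
Definition laplacian_fun (f : R -> R[i]) u : d.-tuple R -> R[i] := fun x =>
  csum_freq (fun k =>
    f (- freq_sqnorm k) * fourier_coef u k * cexp ('i * (freq_dot k x)%:C)).

(* [g(i c Delta) u] *)
Definition ilaplacian_fun (g : R[i] -> R[i]) (c : R) u : d.-tuple R -> R[i] :=
  laplacian_fun (fun lam => g ('i * (c * lam)%:C)) u.

(** * Sobolev spaces

    The norm is defined on families of Fourier coefficients, so that it also
    makes sense for the distributions in [H^s] with [s < 0]. *)

Definition sobolev_norm_coef (s : R) (a : 'rV[int]_d -> R[i]) : \bar R :=
  sqrte (\esum_(k in setT)
    ((1 + freq_sqnorm k) `^ s * ComplexField.Normc.normc (a k) ^+ 2)%:E)%E.

Definition sobolev_norm (s : R) u : \bar R :=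
  sobolev_norm_coef s (fourier_coef u).

(* For [s >= 0]. *)
Definition sobolev (s : R) u : Prop :=
  torus_L2 u /\ (sobolev_norm s u < +oo)%E.

(* [sup_{0 <= t <= T} ||u(t)||_{H^s}] *)
Definition sobolev_sup (s T : R) (u : R -> d.-tuple R -> R[i]) : \bar R :=
  ereal_sup [set sobolev_norm s (u t) | t in `[0, T]%classic].

(** * The cubic nonlinear Schroedinger equation *)

(* [i (u(t+h) - u(t)) / h - (- Delta u(t) + mu |u(t)|^2 u(t))], given by its
   Fourier coefficients: for [u(t)] in [H^alpha] it is only a distribution
   in [H^(alpha-2)]. *)
Definition nls_residual (mu : R) (u : R -> d.-tuple R -> R[i]) (t h : R) :
    'rV[int]_d -> R[i] := fun k =>
  'i * (h^-1)%:C * (fourier_coef (u (t + h)) k - fourier_coef (u t) k)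
  - ((freq_sqnorm k)%:C * fourier_coef (u t) k
     + mu%:C * fourier_coef (fun x => `|u t x| ^+ 2 * u t x) k).

(* [u] is an [H^alpha] solution on [[0, T]] of
   [i du/dt = - Delta u + mu |u|^2 u], [u(0) = u0], that is, [u] is in
   [C([0,T]; H^alpha)] and has the time derivative given by the equation
   in [H^(alpha-2)] (one-sided at the endpoints). *)
Definition nls_solution (alpha mu T : R) (u0 : d.-tuple R -> R[i])
    (u : R -> d.-tuple R -> R[i]) : Prop :=
  [/\ u 0 = u0,
      forall t : R, 0 <= t <= T -> sobolev alpha (u t),
      forall t : R, 0 <= t <= T ->
        sobolev_norm alpha (fun x => u s x - u t x)
          @[s --> within `[0, T]%classic (nbhs t)] --> 0%E &
      forall t : R, 0 <= t <= T ->
        sobolev_norm_coef (alpha - 2) (nls_residual mu u t h)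
          @[h --> within [set h | 0 <= t + h <= T] (0 : R)^'] --> 0%E].

(** * The scheme sLRI2 *)

Definition phi1 (z : R[i]) : R[i] := if z == 0 then 1 else (cexp z - 1) / z.

Definition phi2 (z : R[i]) : R[i] :=
  if z == 0 then 2^-1 else (cexp z - phi1 z) / z.

(* [exp(i t Delta)] *)
Definition schroedinger_group (t : R) u := ilaplacian_fun cexp t u.

Definition cconj u : d.-tuple R -> R[i] := fun x => (u x)^*.

Definition sLRI2_start (mu tau : R) u : d.-tuple R -> R[i] :=
  let S := schroedinger_group in
  let phi12 := ilaplacian_fun (fun z => phi1 z - phi2 z) (- 2 * tau) in
  fun x =>
    S tau u x
    - 'i * (mu * tau)%:C * S tau (fun y => u y ^+ 2 * phi12 (cconj u) y) x
    - 'i * (mu * tau)%:C * (S tau u x ^+ 2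
        * S tau (ilaplacian_fun phi2 (- 2 * tau) (cconj u)) x)
    - (mu ^+ 2 * (tau ^+ 2 / 2))%:C * S tau (fun y => `|u y| ^+ 4 * u y) x.

(* [v] is the iterate before [u]. *)
Definition sLRI2_step (mu tau : R) (v u : d.-tuple R -> R[i]) :
    d.-tuple R -> R[i] :=
  let S := schroedinger_group in
  let re_phi12 := ilaplacian_fun
    (fun z => (complex.Re (phi1 z) - complex.Re (phi2 z))%:C) (- 2 * tau) in
  fun x =>
    S (2 * tau) v x
    - 2 * 'i * (mu * tau)%:C
        * S tau (fun y => u y ^+ 2 * re_phi12 (cconj u) y) x
    - 'i * (mu * tau)%:C * (S tau u x ^+ 2
        * S tau (ilaplacian_fun phi2 (- 2 * tau) (cconj u)) x)
    - 'i * (mu * tau)%:C * S (2 * tau) (fun y => S (- tau) u y ^+ 2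
        * S (- tau) (ilaplacian_fun phi2 (2 * tau) (cconj u)) y) x.

Fixpoint sLRI2 (mu tau : R) (u0 : d.-tuple R -> R[i]) (n : nat) :
    d.-tuple R -> R[i] :=
  match n with
  | 0 => u0
  | m.+1 =>
    match m with
    | 0 => sLRI2_start mu tau u0
    | p.+1 => sLRI2_step mu tau (sLRI2 mu tau u0 p) (sLRI2 mu tau u0 m)
    end
  end.

End torus_functions.

(* Main.v *)
(* On the side of Fourier coefficients, [H^s] with [s > d/2] is an algebra of
   absolutely summable sequences, and both the equation and the scheme act on
   sequences; the uniqueness theorem for Fourier coefficients transfers products
   of functions to convolutions.

   For the exact solution put [w(s) = e^(-i s Delta) u(t + s)], so that
   [w' = -i mu F], where [F] is the cubic term conjugated by the free flow.
   Then [F(s) = Theta_s(u, u, e^(-2 i s Delta) conj(u)) + s D + O(s^2)], with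
   [Theta_s(a, b, c) = e^(-i s Delta) (e^(i s Delta) a e^(i s Delta) b e^(i s Delta) c)].
   The resonance function of [Theta] is [2 (k1.k2 + k1.k3 + k2.k3)], so replacing
   [Theta_s] by its linear interpolation between [s = 0] and [s = tau] costs
   [O(tau^2)] with two derivatives on each of two factors only, hence needs no
   more than [H^(alpha+2)]. Integrating the interpolant over [-tau, tau] yields
   exactly the scheme, the terms [s D] cancelling by symmetry: the local error of
   a step is [O(tau^3)]. The leading coefficient of the two-step recursion is
   unitary and its nonlinear part is Lipschitz with constant [O(tau)], so the
   errors add up to [O(tau^2)]. *)

Require Import Defs.
From mathcomp Require Import all_boot all_order all_algebra.
From mathcomp Require Import all_classical all_reals all_analysis.
From mathcomp Require Import complex finmap measurable_realfun ring lra.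
Import Order.TTheory GRing.Theory Num.Theory.
Import numFieldNormedType.Exports.
Local Open Scope classical_set_scope.
Local Open Scope ring_scope.
Local Open Scope complex_scope.

Set Implicit Arguments.
Unset Strict Implicit.
Unset Printing Implicit Defensive.

(** Everything quantitative is a statement about finite sums: [bd] and [l1] bound every finite
    partial sum by an explicit real number, so no infinite sum has to be known finite beforehand,
    and the constants [C_2] to [C_9] come out as expressions in [K], [mu] and [M] alone. No integral
    of a sequence-valued function is formed either. The exact increment and the nonlinear part of
    the scheme are both read as curves in a step parameter [sg]; their derivatives are compared at
    each [sg] in [[0, tau]], and a mean value inequality on finitely many coefficients at a time
    gives the bound at [sg = tau]. This asks for derivatives one coefficient at a time, which the
    equation in [H^(alpha-2)] provides directly. The starting step is only accurate to order
    [tau^2], which suffices because it is taken once. No bound on the iterates is assumed: the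
    induction that propagates the error also keeps them in the ball of radius [M + 1], and this is
    what the threshold [tau0 M = 1 / C M] secures. *)

Notation nc := ComplexField.Normc.normc.

(** * The real-valued modulus of complex numbers *)

Section complex_modulus.
Context {R : realType}.
Implicit Types z w : R[i].

Lemma nc_norm z : (nc z)%:C = `|z|.
Proof. by case: z. Qed.

Lemma nc_ge0 z : 0 <= nc z.
Proof. by case: z => a b /=; rewrite sqrtr_ge0. Qed.

Lemma ncM z w : nc (z * w) = nc z * nc w.
Proof. exact: ComplexField.Normc.normcM. Qed.

Lemma ncD z w : nc (z + w) <= nc z + nc w.
Proof. exact: le_normcD. Qed.

Lemma ncN z : nc (- z) = nc z.
Proof. exact: normcN. Qed.

Lemma ncB z w : nc (z - w) <= nc z + nc w.
Proof. by rewrite (le_trans (ncD _ _))// ncN. Qed.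

Lemma nc0 : nc (0 : R[i]) = 0.
Proof. exact: ComplexField.Normc.normc0. Qed.

Lemma nc1 : nc (1 : R[i]) = 1.
Proof. exact: ComplexField.Normc.normc1. Qed.

Lemma nci : nc ('i : R[i]) = 1.
Proof. by rewrite /= expr0n expr1n add0r sqrtr1. Qed.

Lemma ncJ z : nc z^* = nc z.
Proof. by case: z => a b /=; rewrite sqrrN. Qed.

Lemma nc_real (x : R) : nc x%:C = `|x|.
Proof. by rewrite /= expr0n addr0 sqrtr_sqr. Qed.

Lemma realC_neq0 (x : R) : x != 0 -> x%:C != 0 :> R[i].
Proof. by move=> x0; apply/eqP => /(congr1 (@complex.Re R)) /= /eqP; rewrite (negbTE x0). Qed.

Lemma nc_sqr z : nc z ^+ 2 = complex.Re z ^+ 2 + complex.Im z ^+ 2.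
Proof. by case: z => a b /=; rewrite sqr_sqrtr// addr_ge0// sqr_ge0. Qed.

Lemma nc_Re z : `|complex.Re z| <= nc z.
Proof.
by rewrite -(ler_pXn2r (n := 2))// ?nnegrE ?nc_ge0// nc_sqr real_normK ?num_real// lerDl sqr_ge0.
Qed.

Lemma nc_Im z : `|complex.Im z| <= nc z.
Proof.
by rewrite -(ler_pXn2r (n := 2))// ?nnegrE ?nc_ge0// nc_sqr real_normK ?num_real// lerDr sqr_ge0.
Qed.

Lemma nc_ReIm z : nc z <= `|complex.Re z| + `|complex.Im z|.
Proof.
by rewrite {1}[z]complexE (le_trans (ncD _ _))// ncM nci mul1r !nc_real.
Qed.

Lemma nc_eq0 z : nc z <= 0 -> z = 0.
Proof.
move=> z0; apply: ComplexField.Normc.eq0_normc.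
by apply/eqP; rewrite eq_le z0 nc_ge0.
Qed.

Lemma nc_sum (I : Type) (s : seq I) (f : I -> R[i]) :
  nc (\sum_(i <- s) f i) <= \sum_(i <- s) nc (f i).
Proof.
elim: s => [|i s IH]; first by rewrite !big_nil nc0.
by rewrite !big_cons (le_trans (ncD _ _))// lerD2l.
Qed.

Lemma nc_distl z w : `|nc z - nc w| <= nc (z - w).
Proof.
rewrite ler_norml; apply/andP; split; last first.
  by rewrite lerBlDr (le_trans _ (ncD _ _))// subrK.
rewrite lerNl opprB lerBlDr -(ncN (z - w)) opprB.
by rewrite (le_trans _ (ncD _ _))// subrK.
Qed.

Lemma Re_sum (I : Type) (s : seq I) (f : I -> R[i]) :
  complex.Re (\sum_(i <- s) f i) = \sum_(i <- s) complex.Re (f i).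
Proof.
elim: s => [|i s IH]; first by rewrite !big_nil.
by rewrite !big_cons -IH; case: (f i); case: (\sum_(_ <- _) _).
Qed.

Lemma Im_sum (I : Type) (s : seq I) (f : I -> R[i]) :
  complex.Im (\sum_(i <- s) f i) = \sum_(i <- s) complex.Im (f i).
Proof.
elim: s => [|i s IH]; first by rewrite !big_nil.
by rewrite !big_cons -IH; case: (f i); case: (\sum_(_ <- _) _).
Qed.

End complex_modulus.

Arguments ComplexField.Normc.normc : simpl never.

(** * Finite sums and the Cauchy-Schwarz inequality *)

Section finite_sums.
Context {R : realType}.

Lemma le_of_eq (x y : R) : x = y -> x <= y.
Proof. by move=> ->. Qed.

Lemma sum_subseq_le (I : eqType) (s t : seq I) (f : I -> R) :
  uniq s -> uniq t -> {subset s <= t} -> (forall i, 0 <= f i) ->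
  \sum_(i <- s) f i <= \sum_(i <- t) f i.
Proof.
move=> us ut st f0.
rewrite [leRHS](bigID (mem s))/= -[leLHS]addr0 lerD ?sumr_ge0//.
rewrite -[leRHS]big_filter; apply: le_of_eq; apply: perm_big.
apply: uniq_perm => //; first exact: filter_uniq.
move=> i; by rewrite mem_filter; case: (boolP (i \in s)) => // /st ->.
Qed.

Lemma sum_diff (I : eqType) (V : zmodType) (s t : seq I) (f : I -> V) :
  uniq s -> uniq t -> {subset s <= t} ->
  \sum_(i <- t) f i - \sum_(i <- s) f i =
  \sum_(i <- [seq i <- t | i \notin s]) f i.
Proof.
move=> us ut st; rewrite (bigID (mem s))/= -[X in X + _ - _]big_filter.
rewrite (perm_big s) ?big_filter/=; first by rewrite addrC addKr.
apply: uniq_perm => //; first exact: filter_uniq.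
by move=> i; rewrite mem_filter; case: (boolP (i \in s)) => // /st ->.
Qed.

Lemma cauchy_schwarz_seq (I : Type) (s : seq I) (f g : I -> R) :
  (\sum_(i <- s) f i * g i) ^+ 2 <=
  (\sum_(i <- s) f i ^+ 2) * (\sum_(i <- s) g i ^+ 2).
Proof.
elim: s => [|i s IH]; first by rewrite !big_nil expr0n mulr0.
rewrite !big_cons.
set S := \sum_(_ <- _) (_ * _) in IH *.
set X := \sum_(_ <- _) (f _ ^+ 2) in IH *; set Y := \sum_(_ <- _) (g _ ^+ 2) in IH *.
have X0 : 0 <= X by rewrite sumr_ge0// => j _; rewrite sqr_ge0.
have Y0 : 0 <= Y by rewrite sumr_ge0// => j _; rewrite sqr_ge0.
set x := f i; set y := g i.
have x0 := sqr_ge0 x; have y0 := sqr_ge0 y.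
(* By the induction hypothesis [S^2 <= X Y], only the cross terms are left. They are compared after
   squaring, where the difference is at least [(X y^2 - Y x^2)^2]. *)
suff : 2 * (x * y * S) <= X * y ^+ 2 + Y * x ^+ 2 by nra.
set L := 2 * _; set P := X * _ + _.
have P0 : 0 <= P by rewrite addr_ge0// mulr_ge0.
have [L0|/ltW L0] := lerP L 0; first exact: le_trans P0.
rewrite -(ler_pXn2r (n := 2))// ?nnegrE//.
have : L ^+ 2 <= 4 * (x ^+ 2 * y ^+ 2) * (X * Y).
  rewrite /L (_ : _ ^+ 2 = 4 * (x ^+ 2 * y ^+ 2) * S ^+ 2); last by ring.
  by rewrite ler_wpM2l// mulr_ge0// mulr_ge0.
move=> /le_trans; apply; rewrite -subr_ge0.
rewrite (_ : _ - _ = (X * y ^+ 2 - Y * x ^+ 2) ^+ 2) ?sqr_ge0// /P; ring.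
Qed.

Lemma cauchy_schwarz_le (I : Type) (s : seq I) (f g : I -> R) (A B : R) :
  0 <= A -> 0 <= B ->
  \sum_(i <- s) f i ^+ 2 <= A ^+ 2 -> \sum_(i <- s) g i ^+ 2 <= B ^+ 2 ->
  \sum_(i <- s) f i * g i <= A * B.
Proof.
move=> A0 B0 fA gB.
have [S0|/ltW S0] := lerP (\sum_(i <- s) f i * g i) 0.
  by rewrite (le_trans S0)// mulr_ge0.
rewrite -(ler_pXn2r (n := 2))// ?nnegrE ?mulr_ge0//.
rewrite (le_trans (cauchy_schwarz_seq _ _ _))// exprMn ler_pM//.
- by rewrite sumr_ge0// => j _; rewrite sqr_ge0.
- by rewrite sumr_ge0// => j _; rewrite sqr_ge0.
Qed.

End finite_sums.

(** * Sums over the frequencies *)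

Section frequency_sums.
Context {R : realType} {d : nat}.
Local Notation Z := 'rV[int]_d.
Implicit Types (a b : Z -> R[i]) (x y : Z -> R) (B e : R).

(** Absolute summability is carried together with a real bound on all finite partial sums, so that
    estimates of sequences remain estimates of finite sums. *)
Definition l1 a B := forall s : seq Z, uniq s -> \sum_(k <- s) nc (a k) <= B.

Definition rl1 x B := forall s : seq Z, uniq s -> \sum_(k <- s) `|x k| <= B.

(** The passage from the extended-real supremum to real numbers: the last clause gives a finite set
    whose sum is within [e] of the value. *)
Lemma esum_approx (x : Z -> \bar R) B :
  (forall k, 0 <= x k)%E ->
  (forall s : seq Z, uniq s -> \sum_(k <- s) x k <= B%:E)%E ->
  exists S : R, [/\ (\esum_(k in setT) x k = S%:E)%E,
    (forall s : seq Z, uniq s -> \sum_(k <- s) x k <= S%:E)%E, S <= B &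
    forall e, 0 < e -> exists s0 : seq Z, uniq s0 /\
      ((S - e)%:E < \sum_(k <- s0) x k)%E].
Proof.
move=> x0 xB.
have uB : (\esum_(k in setT) x k <= B%:E)%E.
  apply: ge_ereal_sup => _ [F [finF _] <-].
  by rewrite fsbig_finite//=; apply: xB; exact: fset_uniq.
have l0 : (0 <= \esum_(k in setT) x k)%E by exact: esum_ge0.
have fS : (\esum_(k in setT) x k)%E \is a fin_num.
  by rewrite fin_numE -ltNye -ltey (lt_le_trans _ l0)// (le_lt_trans uB)// ltry.
exists (fine (\esum_(k in setT) x k)%E); split.
- by rewrite fineK.
- move=> s us; rewrite fineK//; apply: ereal_sup_ubound; exists [set` s].
    by split => //; exact: finite_seq.
  by rewrite -fsbig_seq.
- by rewrite -lee_fin fineK.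
- move=> e e0.
  have : ((fine (\esum_(k in setT) x k)%E - e)%:E < \esum_(k in setT) x k)%E.
    by rewrite -[ltRHS]fineK// lte_fin ltrBlDr ltrDl.
  move=> /ereal_sup_gt[_ [F [finF _] <-]].
  rewrite fsbig_finite//= => ltF.
  by exists (fset_set F); rewrite fset_uniq.
Qed.

(** The positive and the negative part are approximated from below separately; any finite set
    containing both witnesses then controls their difference. *)
Lemma rsum_freq_approx x B : rl1 x B ->
  forall e, 0 < e -> exists s0 : seq Z, forall s, uniq s -> {subset s0 <= s} ->
    `|\sum_(k <- s) x k - rsum_freq x| <= e.
Proof.
move=> xB.
pose p k := Num.max (x k) 0; pose n k := Num.max (- x k) 0.
have p0 k : (0 <= (p k)%:E)%E by rewrite lee_fin le_max lexx orbT.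
have n0 k : (0 <= (n k)%:E)%E by rewrite lee_fin le_max lexx orbT.
have pB : forall s : seq Z, uniq s -> (\sum_(k <- s) (p k)%:E <= B%:E)%E.
  move=> s us; rewrite sumEFin lee_fin (le_trans _ (xB s us))// ler_sum// => k _.
  by rewrite ge_max ler_norm normr_ge0.
have nB : forall s : seq Z, uniq s -> (\sum_(k <- s) (n k)%:E <= B%:E)%E.
  move=> s us; rewrite sumEFin lee_fin (le_trans _ (xB s us))// ler_sum// => k _.
  by rewrite ge_max normr_ge0 -normrN ler_norm.
have [P [eP ubP _ apP]] := esum_approx p0 pB.
have [N [eN ubN _ apN]] := esum_approx n0 nB.
have pn k : x k = p k - n k.
  by rewrite /p /n /Num.max; case: ifP; case: ifP; move: (x k) => y; lra.
have -> : rsum_freq x = P - N.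
  rewrite /rsum_freq (_ : (EFin \o x)^\+ = EFin \o p)%E; last first.
    by apply/funext => k; rewrite funeposE/= -EFin_max.
  rewrite (_ : (EFin \o x)^\- = EFin \o n)%E; last first.
    by apply/funext => k; rewrite funenegE/= -EFin_max.
  by rewrite eP eN.
move=> e e0.
have [s0 [us0 h0]] := apP _ e0.
have [s1 [us1 h1]] := apN _ e0.
exists (s0 ++ s1) => s us s01.
have sub0 : {subset s0 <= s} by move=> k ks; rewrite s01// mem_cat ks.
have sub1 : {subset s1 <= s} by move=> k ks; rewrite s01// mem_cat ks orbT.
have -> : \sum_(k <- s) x k = \sum_(k <- s) p k - \sum_(k <- s) n k.
  by rewrite -sumrB; apply: eq_bigr.
have := ubP _ us; have := ubN _ us; move: h0 h1.
rewrite !sumEFin !lee_fin !lte_fin => h0 h1 h2 h3.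
have h4 := sum_subseq_le us0 us sub0 p0.
have h5 := sum_subseq_le us1 us sub1 n0.
by rewrite ler_norml; apply/andP; split; lra.
Qed.

Lemma l1_Re a B : l1 a B -> rl1 (@complex.Re R \o a) B.
Proof.
by move=> aB s /aB; apply: le_trans; apply: ler_sum => k _; exact: nc_Re.
Qed.

Lemma l1_Im a B : l1 a B -> rl1 (@complex.Im R \o a) B.
Proof.
by move=> aB s /aB; apply: le_trans; apply: ler_sum => k _; exact: nc_Im.
Qed.

Lemma csum_approx a B : l1 a B ->
  forall e, 0 < e -> exists s0 : seq Z, forall s, uniq s -> {subset s0 <= s} ->
    nc (\sum_(k <- s) a k - csum_freq a) <= e.
Proof.
move=> aB e e0; have e2 : 0 < e / 2 by rewrite divr_gt0.
have [s0 h0] := rsum_freq_approx (l1_Re aB) e2.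
have [s1 h1] := rsum_freq_approx (l1_Im aB) e2.
exists (s0 ++ s1) => s us s01.
have /(h0 _ us) : {subset s0 <= s} by move=> k ks; rewrite s01// mem_cat ks.
have /(h1 _ us) : {subset s1 <= s} by move=> k ks; rewrite s01// mem_cat ks orbT.
rewrite -Re_sum -Im_sum => hI hR.
rewrite (le_trans (nc_ReIm _))//.
rewrite (_ : complex.Re (_ - _) = complex.Re (\sum_(i <- s) a i) - rsum_freq (@complex.Re R \o a)).
  rewrite (_ : complex.Im (_ - _) = complex.Im (\sum_(i <- s) a i) - rsum_freq (@complex.Im R \o a)).
    by rewrite [e]splitr lerD.
  by case: (\sum_(i <- s) a i).
by case: (\sum_(i <- s) a i).
Qed.

(** Inequalities pass from partial sums to the limit: one finite set serves both the approximation
    of the sum and the hypothesis. *)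
Lemma csum_near a B z C : l1 a B ->
  (exists s0 : seq Z, forall s, uniq s -> {subset s0 <= s} ->
    nc (\sum_(k <- s) a k - z) <= C) -> nc (csum_freq a - z) <= C.
Proof.
move=> aB [s1 h1]; apply/ler_addgt0Pl => e e0.
have [s0 h0] := csum_approx aB e0.
pose s := undup (s0 ++ s1).
have us : uniq s by exact: undup_uniq.
have /(h0 _ us) k0 : {subset s0 <= s} by move=> k ks; rewrite mem_undup mem_cat ks.
have /(h1 _ us) k1 : {subset s1 <= s} by move=> k ks; rewrite mem_undup mem_cat ks orbT.
rewrite (_ : csum_freq a - z = (\sum_(k <- s) a k - z) - (\sum_(k <- s) a k - csum_freq a)); last by ring.
by rewrite (le_trans (ncB _ _))// addrC lerD.
Qed.

(** The value of a sum is identified as the limit along finite sets; linearity of [csum_freq] is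
    obtained this way. *)
Lemma csum_unique a B z : l1 a B ->
  (forall e, 0 < e -> exists s0 : seq Z, forall s, uniq s -> {subset s0 <= s} ->
    nc (\sum_(k <- s) a k - z) <= e) -> csum_freq a = z.
Proof.
move=> aB az; apply/eqP; rewrite -subr_eq0; apply/eqP/nc_eq0.
by apply/ler_addgt0Pl => e /az; rewrite addr0; exact: csum_near aB.
Qed.

Lemma l1_ge0 a B : l1 a B -> 0 <= B.
Proof. by move=> /(_ [::] isT); rewrite big_nil. Qed.

Lemma csum_le a B : l1 a B -> nc (csum_freq a) <= B.
Proof.
move=> aB; rewrite -[csum_freq a]subr0; apply: (csum_near aB).
by exists [::] => s us _; rewrite subr0 (le_trans (nc_sum _ _))// aB.
Qed.

Lemma l1_le a b B : (forall k, nc (a k) <= nc (b k)) -> l1 b B -> l1 a B.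
Proof. by move=> ab bB s /bB; apply: le_trans; exact: ler_sum. Qed.

Lemma l1D a b A B : l1 a A -> l1 b B -> l1 (fun k => a k + b k) (A + B).
Proof.
move=> aA bB s us; rewrite (le_trans _ (lerD (aA s us) (bB s us)))//.
by rewrite -big_split ler_sum// => k _; exact: ncD.
Qed.

Lemma l1M (c : R[i]) a B : l1 a B -> l1 (fun k => c * a k) (nc c * B).
Proof.
move=> aB s us; under eq_bigr do rewrite ncM.
by rewrite -mulr_sumr ler_wpM2l ?nc_ge0 ?aB.
Qed.

Lemma csumD a b A B : l1 a A -> l1 b B ->
  csum_freq (fun k => a k + b k) = csum_freq a + csum_freq b.
Proof.
move=> aA bB; apply: (csum_unique (l1D aA bB)) => e e0.
have e2 : 0 < e / 2 by rewrite divr_gt0.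
have [s0 h0] := csum_approx aA e2.
have [s1 h1] := csum_approx bB e2.
exists (s0 ++ s1) => s us s01.
have /(h0 _ us) k0 : {subset s0 <= s} by move=> k ks; rewrite s01// mem_cat ks.
have /(h1 _ us) k1 : {subset s1 <= s} by move=> k ks; rewrite s01// mem_cat ks orbT.
rewrite big_split/= opprD addrACA (le_trans (ncD _ _))//.
by rewrite [e]splitr lerD.
Qed.

Lemma csumZ (c : R[i]) a B : l1 a B ->
  csum_freq (fun k => c * a k) = c * csum_freq a.
Proof.
move=> aB; apply: (csum_unique (l1M c aB)) => e e0.
have c0 : 0 < nc c + 1 by rewrite ltr_wpDl ?nc_ge0.
have [s0 h0] := csum_approx aB (divr_gt0 e0 c0).
exists s0 => s us ss; rewrite -mulr_sumr -mulrBr ncM.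
rewrite (le_trans (ler_wpM2l (nc_ge0 _) (h0 s us ss)))//.
by rewrite mulrCA ger_pMr// ler_pdivrMr// mul1r lerDl.
Qed.

Lemma l1_tail a B : l1 a B -> forall e, 0 < e -> exists s0 : seq Z, uniq s0 /\
  forall s, uniq s -> (forall k, k \in s -> k \notin s0) ->
    \sum_(k <- s) nc (a k) <= e.
Proof.
move=> aB e e0.
have x0 : (forall k, 0 <= (nc (a k))%:E)%E by move=> k; rewrite lee_fin nc_ge0.
have xB : (forall s : seq Z, uniq s -> \sum_(k <- s) (nc (a k))%:E <= B%:E)%E.
  by move=> s us; rewrite sumEFin lee_fin aB.
have [S [_ ub _ ap]] := esum_approx x0 xB.
have [s0 [us0 h0]] := ap _ e0.
exists s0; split => // s us dis.
have ucat : uniq (s0 ++ s).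
  rewrite cat_uniq us0 us andbT/=; apply/hasPn => k /dis.
  by [].
have := ub _ ucat; move: h0; rewrite !sumEFin lte_fin lee_fin big_cat/=; lra.
Qed.

(** The finite set depends on the majorant [a] only. With [b k = a k * em k x] this makes the
    convergence of a Fourier series uniform in [x]. *)
Lemma csum_tail a B : l1 a B -> forall e, 0 < e -> exists s0 : seq Z, uniq s0 /\
  forall b, (forall k, nc (b k) <= nc (a k)) ->
  forall s, uniq s -> {subset s0 <= s} ->
    nc (csum_freq b - \sum_(k <- s) b k) <= e.
Proof.
move=> aB e e0; have [s0 [us0 h0]] := l1_tail aB e0.
exists s0; split => // b ba s us s0s.
apply: (csum_near (l1_le ba aB)); exists s => t ut st.
rewrite sum_diff// (le_trans (nc_sum _ _))//.
rewrite (le_trans (ler_sum _ (fun k _ => ba k)))// h0 ?filter_uniq//.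
by move=> k; rewrite mem_filter => /andP[+ _]; apply: contra => /s0s.
Qed.

End frequency_sums.

(** * Summability of the weights [(1 + |k|^2)^-s] for [s > d/2] *)

Section weight.
Context {R : realType}.

(* [x^-p - (x+1)^-p >= p (x+1)^-(p+1)] makes the series telescope. *)
Lemma sum_powR_le (p : R) (N : nat) : 0 < p ->
  \sum_(n < N) n.+2%:R `^ (- (p + 1)) <= p^-1.
Proof.
move=> p0.
have step n : p * n.+2%:R `^ (- (p + 1)) <=
    n.+1%:R `^ (- p) - n.+2%:R `^ (- p) :> R.
  have x0 : 0 < n.+1%:R :> R by rewrite ltr0n.
  have y0 : 0 < n.+2%:R :> R by rewrite ltr0n.
  have y1 : n.+2%:R = n.+1%:R + 1 :> R by rewrite -[in LHS]natr1.
  have P0 : 0 < n.+2%:R `^ (- p) :> R by rewrite powR_gt0.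
  have -> : n.+2%:R `^ (- (p + 1)) = n.+2%:R `^ (- p) / n.+2%:R :> R.
    rewrite opprD powRD ?(gt_eqF y0) ?implybT//; congr (_ * _).
    by rewrite powR_inv1// ltW.
  have -> : n.+1%:R `^ (- p) = n.+2%:R `^ (- p) * (n.+1%:R / n.+2%:R) `^ (- p) :> R.
    by rewrite -powRM ?ltW ?divr_gt0// mulrCA divff ?gt_eqF// mulr1.
  rewrite mulrCA -{3}[n.+2%:R `^ (- p)]mulr1 -mulrBr ler_wpM2l ?(ltW P0)//.
  (* With [x = n + 1] and [y = n + 2]: [(x/y)^-p = exp (- p ln (x/y)) >= 1 - p ln (x/y)], and
     [ln (x/y) = ln (1 - 1/y) <= - 1/y]. *)
  rewrite lerBrDl /powR gt_eqF ?divr_gt0// (le_trans _ (expR_ge1Dx _))// lerD2l.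
  rewrite mulNr -mulrN ler_wpM2l ?(ltW p0)//.
  have -> : n.+1%:R / n.+2%:R = 1 + - n.+2%:R^-1 :> R.
    by rewrite y1; move: x0; set x := (n.+1%:R : R) => x0; field; rewrite gt_eqF//; lra.
  rewrite lerNr le_ln1Dx// ltrN2 invf_lt1//.
  by rewrite ltr1n.
have : p * \sum_(n < N) n.+2%:R `^ (- (p + 1)) <= 1 - N.+1%:R `^ (- p).
  rewrite mulr_sumr; elim: N => [|N IH]; first by rewrite big_ord0 powR1 subrr.
  rewrite big_ord_recr/=; have := step N; lra.
have N0 : 0 <= N.+1%:R `^ (- p) :> R by rewrite powR_ge0.
move=> h; rewrite -[p^-1]mul1r ler_pdivlMr// mulrC; lra.
Qed.

(** Since [1 + m^2 >= (m + 1)^2 / 2], the terms with [m >= 1] are dominated by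
    [2^q (m + 1)^(- 2 q)], and the telescoping bound applies with [p = 2 q - 1 > 0]. *)
Lemma sum_japanese_le (q : R) (N : nat) : 2^-1 < q ->
  \sum_(n < N) (1 + n%:R ^+ 2) `^ (- q) <= 1 + 2 `^ q * (1 + (2 * q - 1)^-1).
Proof.
move=> q2; have q0 : 0 < q by apply: lt_trans q2; rewrite invr_gt0.
have p0 : 0 < 2 * q - 1 by lra.
have S0 : 0 <= (2 * q - 1)^-1 by rewrite invr_ge0 ltW.
case: N => [|N].
  by rewrite big_ord0 addr_ge0// mulr_ge0 ?powR_ge0// addr_ge0.
rewrite big_ord_recl/= expr0n addr0 powR1 lerD2l.
rewrite (@le_trans _ _ (2 `^ q * \sum_(n < N) n.+2%:R `^ (- (2 * q - 1 + 1))))//.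
  rewrite mulr_sumr ler_sum// => n _; rewrite /bump/= add1n.
  have x1 : (n.+2%:R : R) = n.+1%:R + 1 by rewrite -[in LHS]natr1.
  have x0 : 0 < n.+1%:R :> R by rewrite ltr0n.
  have h : n.+2%:R ^+ 2 / 2 <= 1 + n.+1%:R ^+ 2 :> R.
    by rewrite x1; have := sqr_ge0 (n.+1%:R - 1 : R); nra.
  rewrite subrK.
  have -> : 2 `^ q * n.+2%:R `^ (- (2 * q)) = (n.+2%:R ^+ 2 / 2) `^ (- q) :> R.
    rewrite powRM ?exprn_ge0// ?invr_ge0// -powR_mulrn// -powRrM mulrN mulrC.
    congr (_ * _); rewrite -[2^-1]powR_inv1// -powRrM; congr (_ `^ _); ring.
  have A0 : 0 < n.+2%:R ^+ 2 / 2 :> R by rewrite divr_gt0// exprn_gt0.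
  have B0 : 0 < 1 + n.+1%:R ^+ 2 :> R by rewrite ltr_pwDl// sqr_ge0.
  rewrite !powRN lef_pV2 ?posrE ?powR_gt0//.
  by apply: ge0_ler_powR => //; rewrite ?nnegrE ltW.
by rewrite ler_wpM2l ?powR_ge0// (le_trans (sum_powR_le _ p0))// lerDr.
Qed.

Context {d : nat}.
Local Notation Z := 'rV[int]_d.

Definition weight (k : Z) : R := 1 + freq_sqnorm k.

Lemma freq_sqnorm_ge0 (k : Z) : 0 <= freq_sqnorm k :> R.
Proof. by rewrite sumr_ge0// => i _; rewrite sqr_ge0. Qed.

Lemma weight_ge1 k : 1 <= weight k.
Proof. by rewrite lerDl freq_sqnorm_ge0. Qed.

Lemma weight_gt0 k : 0 < weight k.
Proof. exact: lt_le_trans (weight_ge1 k). Qed.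

Lemma freq_sqnormN (k : Z) : freq_sqnorm (- k) = freq_sqnorm k :> R.
Proof. by apply: eq_bigr => i _; rewrite mxE rmorphN sqrrN. Qed.

Lemma weightN k : weight (- k) = weight k.
Proof. by rewrite /weight freq_sqnormN. Qed.

Lemma weightD p q : weight (p + q) <= 2 * (weight p + weight q).
Proof.
rewrite /weight (_ : 2 * _ = 4 + (2 * freq_sqnorm p + 2 * freq_sqnorm q)); last by ring.
rewrite lerD ?ler1n// /freq_sqnorm !mulr_sumr -big_split ler_sum// => i _.
rewrite mxE rmorphD/=; set x := _%:~R; set y := _%:~R.
by have := sqr_ge0 (x - y); nra.
Qed.

Lemma weight_powR_gt0 s k : 0 < weight k `^ s.
Proof. by rewrite powR_gt0// weight_gt0. Qed.

Lemma prod_japanese_le (k : Z) :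
  \prod_(i < d) (1 + ((k ord0 i)%:~R : R) ^+ 2) <= weight k ^+ d.
Proof.
rewrite -[X in _ ^+ X]card_ord -prodr_const; apply: ler_prod => i _.
rewrite addr_ge0 ?sqr_ge0//= lerD2l /freq_sqnorm (bigD1 i)//= lerDl.
by rewrite sumr_ge0// => j _; rewrite sqr_ge0.
Qed.

(** As [prod_i (1 + k_i^2) <= weight k ^ d], the summand is dominated by a product of
    one-dimensional weights with exponent [q = s / d > 1/2]. Over a box, the sum of such products is
    a product of one-dimensional sums. *)
Lemma weight_summable s : (0 < d)%N -> d%:R / 2 < s ->
  exists S : R, forall F : seq Z, uniq F -> \sum_(k <- F) weight k `^ (- s) <= S.
Proof.
move=> d0 ds; have dR : 0 < d%:R :> R by rewrite ltr0n.
pose q := s / d%:R.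
have q2 : 2^-1 < q by rewrite /q ltr_pdivlMr// mulrC.
have q0 : 0 < q by apply: lt_trans q2; rewrite invr_gt0.
pose C := 1 + 2 `^ q * (1 + (2 * q - 1)^-1).
exists ((2 * C) ^+ d) => F uF.
pose g (z : int) : R := (1 + (z%:~R) ^+ 2) `^ (- q).
have g0 z : 0 <= g z by exact: powR_ge0.
have wg k : weight k `^ (- s) <= \prod_(i < d) g (k ord0 i).
  have -> : \prod_(i < d) g (k ord0 i) =
      (\prod_(i < d) (1 + ((k ord0 i)%:~R : R) ^+ 2)) `^ (- q).
    pose K (a b : R) := 0 <= b /\ a = b `^ (- q).
    suff [] : K (\prod_(i < d) g (k ord0 i))
        (\prod_(i < d) (1 + ((k ord0 i)%:~R : R) ^+ 2)) by [].
    apply: (big_rec2 K) => [|i y x _ [x0 ->]].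
      by split; rewrite ?powR1.
    have z0 : 0 <= 1 + ((k ord0 i)%:~R : R) ^+ 2 by rewrite addr_ge0 ?sqr_ge0.
    by split; [rewrite mulr_ge0|rewrite powRM].
  have P0 : 0 < \prod_(i < d) (1 + ((k ord0 i)%:~R : R) ^+ 2).
    by rewrite prodr_gt0// => i _; rewrite ltr_pwDl ?sqr_ge0.
  rewrite (_ : s = d%:R * q); last by rewrite /q mulrC divfK ?gt_eqF.
  rewrite !powRN powRrM powR_mulrn ?(ltW (weight_gt0 _))//.
  rewrite lef_pV2 ?posrE ?powR_gt0 ?exprn_gt0 ?weight_gt0//.
  by rewrite ge0_ler_powR ?nnegrE ?(ltW q0) ?(ltW P0) ?exprn_ge0 ?(ltW (weight_gt0 _)) ?prod_japanese_le.
pose N := (\max_(k <- F) \max_(i < d) `|k ord0 i|%N)%N.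
(* The box [[-N, N]^d] containing [F] is coded by magnitudes and signs. Zero has two codes, which
   only enlarges the sum; the two signs give the factor 2 in [(2 * C) ^+ d]. *)
pose J := ('I_N.+1 * bool)%type.
pose dec (j : J) : int := (-1) ^+ j.2 * (j.1 : nat)%:Z.
pose enc (z : int) : J := (inord `|z|%N, z < 0).
have decK z : (`|z| <= N)%N -> dec (enc z) = z.
  by move=> zN; rewrite /dec/= inordK ?ltnS// -intEsign.
have encK k : k \in F -> \row_i dec ([ffun i => enc (k ord0 i)] i) = k.
  move=> kF; apply/rowP => i; rewrite mxE ffunE decK// /N.
  rewrite (leq_trans _ (leq_bigmax_seq _ kF _))//.
  by rewrite (leq_bigmax (F := fun i => `|k ord0 i|%N)).
pose G (f : {ffun 'I_d -> J}) := \prod_(i < d) g (dec (f i)).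
have G0 f : 0 <= G f by rewrite prodr_ge0.
have -> : (2 * C) ^+ d = \prod_(i < d) (2 * C) by rewrite prodr_const card_ord.
apply: (@le_trans _ _ (\sum_(f : {ffun 'I_d -> J}) G f)); last first.
  rewrite -(bigA_distr_bigA (fun _ j => g (dec j))); apply: ler_prod => i _.
  rewrite sumr_ge0//= -(pair_bigA _ (fun a b => g (dec (a, b))))/=.
  rewrite (eq_bigr (fun n : 'I_N.+1 => 2 * (1 + n%:R ^+ 2) `^ (- q))).
    by rewrite -mulr_sumr ler_wpM2l// sum_japanese_le.
  move=> n _; rewrite big_bool/= /g /dec/= expr1 expr0 mulN1r mul1r rmorphN/= sqrrN.
  by rewrite -pmulrn; ring.
pose e (k : Z) : {ffun 'I_d -> J} := [ffun i => enc (k ord0 i)].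
rewrite (@le_trans _ _ (\sum_(f <- map e F) G f))//.
  rewrite big_map big_seq [leRHS]big_seq ler_sum// => k kF.
  rewrite (le_trans (wg k))// /G ler_prod// => i _; rewrite g0/=.
  by rewrite -{1}(encK k kF) mxE.
rewrite -[leRHS]big_enum/=; apply: sum_subseq_le => //.
- rewrite map_inj_in_uniq// => k l kF lF ekl.
  by rewrite -(encK k kF) -(encK l lF) -/(e k) -/(e l) ekl.
- exact: enum_uniq.
- by move=> f _; rewrite mem_enum.
Qed.

End weight.

(** * Sobolev sequences *)

Section sobolev_sequences.
Context {R : realType} {d : nat}.
Local Notation Z := 'rV[int]_d.
Implicit Types (a b c : Z -> R[i]) (s A B C : R).

(* The [H^s] norm of [a] is at most [B]. *)
Definition bd s a B := 0 <= B /\ forall F : seq Z, uniq F ->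
  \sum_(k <- F) weight k `^ s * nc (a k) ^+ 2 <= B ^+ 2.

Lemma bd_ge0 s a B : bd s a B -> 0 <= B. Proof. by case. Qed.

Lemma bd_le s a A B : A <= B -> bd s a A -> bd s a B.
Proof.
move=> AB [A0 aA]; split; first exact: le_trans AB.
move=> F uF; rewrite (le_trans (aA F uF))//.
by rewrite lerXn2r ?nnegrE// (le_trans A0).
Qed.

Lemma bd_dom s a b B : (forall k, nc (a k) <= nc (b k)) -> bd s b B -> bd s a B.
Proof.
move=> ab [B0 bB]; split=> // F uF; rewrite (le_trans _ (bB F uF))// ler_sum// => k _.
by rewrite ler_wpM2l ?powR_ge0// lerXn2r ?nnegrE ?nc_ge0.
Qed.

Lemma bd_eq s a b B : a =1 b -> bd s b B -> bd s a B.
Proof. by move=> ab; apply: bd_dom => k; rewrite ab. Qed.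

(** The [H^s] seminorm of finitely many coefficients. [bd] bounds all of them at once, so the
    triangle and mean value inequalities need to be proved for finite sets only. *)
Definition wnorm s (F : seq Z) a : R :=
  Num.sqrt (\sum_(k <- F) weight k `^ s * nc (a k) ^+ 2).

Lemma wnorm_ge0 s F a : 0 <= wnorm s F a. Proof. exact: sqrtr_ge0. Qed.

Lemma wnorm_sqr s F a :
  wnorm s F a ^+ 2 = \sum_(k <- F) weight k `^ s * nc (a k) ^+ 2.
Proof.
by rewrite sqr_sqrtr// sumr_ge0// => k _; rewrite mulr_ge0 ?powR_ge0 ?sqr_ge0.
Qed.

Lemma wnorm_le s F a B : 0 <= B ->
  (wnorm s F a <= B) = (\sum_(k <- F) weight k `^ s * nc (a k) ^+ 2 <= B ^+ 2).
Proof. by move=> B0; rewrite -wnorm_sqr ler_pXn2r// nnegrE ?wnorm_ge0. Qed.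

Lemma wnormD s F a b : wnorm s F (fun k => a k + b k) <= wnorm s F a + wnorm s F b.
Proof.
have A0 := wnorm_ge0 s F a; have B0 := wnorm_ge0 s F b.
rewrite wnorm_le ?addr_ge0//.
pose v (k : Z) : R := Num.sqrt (weight k `^ s).
have v2 (k : Z) (x : R) : weight k `^ s * x ^+ 2 = (v k * x) ^+ 2.
  by rewrite exprMn /v sqr_sqrtr// powR_ge0.
have fA : \sum_(k <- F) (v k * nc (a k)) ^+ 2 <= wnorm s F a ^+ 2.
  by rewrite wnorm_sqr ler_sum// => k _; rewrite v2.
have gB : \sum_(k <- F) (v k * nc (b k)) ^+ 2 <= wnorm s F b ^+ 2.
  by rewrite wnorm_sqr ler_sum// => k _; rewrite v2.
have fg := cauchy_schwarz_le A0 B0 fA gB.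
apply: (@le_trans _ _ (\sum_(k <- F) ((v k * nc (a k)) ^+ 2 +
    ((v k * nc (a k)) * (v k * nc (b k))) *+ 2 + (v k * nc (b k)) ^+ 2))).
  rewrite ler_sum// => k _; rewrite v2 -sqrrD lerXn2r// ?nnegrE.
  - by rewrite mulr_ge0 ?sqrtr_ge0 ?nc_ge0.
  - by rewrite addr_ge0// mulr_ge0 ?sqrtr_ge0 ?nc_ge0.
  - by rewrite -mulrDr ler_wpM2l ?sqrtr_ge0// ncD.
rewrite 2!big_split/= sumrMnl sqrrD.
by rewrite !lerD// lerMn2r/= fg.
Qed.

Lemma bd_wnorm s F a B : uniq F -> bd s a B -> wnorm s F a <= B.
Proof. by move=> uF [B0 aB]; rewrite wnorm_le// aB. Qed.

Lemma wnorm_bd s a B : 0 <= B -> (forall F, uniq F -> wnorm s F a <= B) -> bd s a B.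
Proof. by move=> B0 aB; split=> // F /aB; rewrite wnorm_le. Qed.

Lemma bdD s a b A B : bd s a A -> bd s b B -> bd s (fun k => a k + b k) (A + B).
Proof.
move=> aA bB; apply: wnorm_bd => [|F uF].
  by rewrite addr_ge0 ?(bd_ge0 aA) ?(bd_ge0 bB).
by rewrite (le_trans (wnormD _ _ _ _))// lerD// bd_wnorm.
Qed.

Lemma bdM s (m : Z -> R[i]) a C B : 0 <= C -> (forall k, nc (m k) <= C) ->
  bd s a B -> bd s (fun k => m k * a k) (C * B).
Proof.
move=> C0 mC [B0 aB]; split; first exact: mulr_ge0.
move=> F uF; rewrite exprMn.
apply: (@le_trans _ _ (C ^+ 2 * \sum_(k <- F) weight k `^ s * nc (a k) ^+ 2)).
  rewrite mulr_sumr ler_sum// => k _; rewrite ncM exprMn mulrCA.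
  apply: ler_wpM2r; first by apply: mulr_ge0; [exact: powR_ge0|exact: sqr_ge0].
  by rewrite lerXn2r ?nnegrE ?nc_ge0.
by rewrite ler_wpM2l ?sqr_ge0// aB.
Qed.

Lemma bdN s a B : bd s a B -> bd s (fun k => - a k) B.
Proof. by apply: bd_dom => k; rewrite ncN. Qed.

Lemma bdB s a b A B : bd s a A -> bd s b B -> bd s (fun k => a k - b k) (A + B).
Proof. by move=> aA bB; apply: bdD => //; exact: bdN. Qed.

Lemma weight_powR2 s (k : Z) : weight k `^ (s + 2) = weight k `^ s * weight k ^+ 2 :> R.
Proof.
rewrite powRD; last by rewrite (gt_eqF (weight_gt0 k)) implybT.
by rewrite powR_mulrn// ltW// weight_gt0.
Qed.

(* A multiplier of order 2 costs two derivatives. *)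
Lemma bdM2 s (m : Z -> R[i]) a C B : 0 <= C ->
  (forall k, nc (m k) <= C * weight k) ->
  bd (s + 2) a B -> bd s (fun k => m k * a k) (C * B).
Proof.
move=> C0 mC aB; split; first by rewrite mulr_ge0// (bd_ge0 aB).
have [B0 {}aB] := aB.
move=> F uF; rewrite exprMn.
apply: (@le_trans _ _ (C ^+ 2 * \sum_(k <- F) weight k `^ (s + 2) * nc (a k) ^+ 2)).
  rewrite mulr_sumr ler_sum// => k _; rewrite ncM exprMn weight_powR2.
  rewrite [leRHS](_ : _ = weight k `^ s * ((C * weight k) ^+ 2 * nc (a k) ^+ 2)); last by ring.
  apply: ler_wpM2l; first exact: powR_ge0.
  apply: ler_wpM2r; first exact: sqr_ge0.
  by rewrite lerXn2r ?nnegrE ?nc_ge0// mulr_ge0// ltW// weight_gt0.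
by rewrite ler_wpM2l ?sqr_ge0// aB.
Qed.

Lemma bd_weaken s a B : bd (s + 2) a B -> bd s a B.
Proof.
move=> [B0 aB]; split=> // F uF; rewrite (le_trans _ (aB F uF))// ler_sum// => k _.
by rewrite ler_wpM2r ?sqr_ge0// ler_powR ?weight_ge1// lerDl.
Qed.

Lemma bd_pt s a B k : bd s a B -> weight k `^ s * nc (a k) ^+ 2 <= B ^+ 2.
Proof. by move=> [_ /(_ [:: k] isT)]; rewrite big_seq1. Qed.

(** The coefficients of the complex conjugate function: conjugation reflects the frequencies. *)
Definition cjs a : Z -> R[i] := fun k => (a (- k))^*.

Lemma bd_cjs s a B : bd s a B -> bd s (cjs a) B.
Proof.
move=> [B0 aB]; split=> // F uF.
rewrite (le_trans _ (aB (map -%R F) _)) ?(map_inj_uniq oppr_inj)//.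
rewrite big_map ler_sum// => k _; rewrite weightN /cjs.
by rewrite ncJ.
Qed.

(* The coefficients of a product. *)
Definition fconv a b : Z -> R[i] := fun k => csum_freq (fun p => a p * b (k - p)).

Lemma l1_pt a B k : l1 a B -> nc (a k) <= B.
Proof. by move=> /(_ [:: k] isT); rewrite big_seq1. Qed.

Lemma l1_fconv a b A B k : l1 a A -> l1 b B -> l1 (fun p => a p * b (k - p)) (A * B).
Proof.
move=> aA bB F uF; rewrite mulrC (le_trans _ (ler_wpM2l (l1_ge0 bB) (aA F uF)))//.
rewrite mulr_sumr ler_sum// => p _; rewrite ncM mulrC.
by rewrite ler_wpM2r ?nc_ge0// l1_pt.
Qed.

Lemma fconvDl a a' b A A' B : l1 a A -> l1 a' A' -> l1 b B ->
  fconv (fun k => a k + a' k) b = fun k => fconv a b k + fconv a' b k.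
Proof.
move=> aA aA' bB; apply/funext => k; rewrite /fconv.
rewrite -(csumD (l1_fconv k aA bB) (l1_fconv k aA' bB)).
by congr csum_freq; apply/funext => p; rewrite mulrDl.
Qed.

Lemma fconvDr a b b' A B B' : l1 a A -> l1 b B -> l1 b' B' ->
  fconv a (fun k => b k + b' k) = fun k => fconv a b k + fconv a b' k.
Proof.
move=> aA bB bB'; apply/funext => k; rewrite /fconv.
rewrite -(csumD (l1_fconv k aA bB) (l1_fconv k aA bB')).
by congr csum_freq; apply/funext => p; rewrite mulrDr.
Qed.

Lemma fconvZl z a b A B : l1 a A -> l1 b B ->
  fconv (fun k => z * a k) b = fun k => z * fconv a b k.
Proof.
move=> aA bB; apply/funext => k; rewrite /fconv -(csumZ z (l1_fconv k aA bB)).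
by congr csum_freq; apply/funext => p; rewrite mulrA.
Qed.

Lemma fconvZr z a b A B : l1 a A -> l1 b B ->
  fconv a (fun k => z * b k) = fun k => z * fconv a b k.
Proof.
move=> aA bB; apply/funext => k; rewrite /fconv -(csumZ z (l1_fconv k aA bB)).
by congr csum_freq; apply/funext => p; rewrite mulrCA.
Qed.

(** If [x < y], then [y^2 - x^2 = (y - x) (y + x)] with [y + x <= 2 M]. The loss is linear in [e],
    hence still vanishes after summation over a finite set. *)
Lemma sqr_le_of_near (x y M e : R) : 0 <= x -> 0 <= y -> 0 <= e -> y <= M ->
  y <= x + e -> y ^+ 2 <= x ^+ 2 + e * (2 * M + 1).
Proof.
move=> x0 y0 e0 yM yx; have [{}yx|xy] := lerP y x.
  by rewrite ler_wpDr ?mulr_ge0//; [lra|rewrite lerXn2r ?nnegrE].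
have h5 : 0 <= (e - (y - x)) * (2 * M + 1) by rewrite mulr_ge0//; lra.
have h6 : 0 <= (y - x) * (2 * M + 1 - (y + x)) by rewrite mulr_ge0//; lra.
rewrite -subr_ge0 (le_trans (addr_ge0 h5 h6))//; apply: le_of_eq.
by ring.
Qed.

Section algebra.
Variables (s S : R).
Hypotheses (s0 : 0 <= s) (S0 : 0 <= S).
Hypothesis wS : forall F : seq Z, uniq F -> \sum_(k <- F) weight k `^ (- s) <= S.

(** Cauchy-Schwarz against [weight^(-s/2)], which is square summable by [wS]. *)
Lemma bd_l1_weight a A : bd s a A -> l1 a (Num.sqrt S * A).
Proof.
move=> [A0 aA] F uF; pose v (k : Z) : R := Num.sqrt (weight k `^ s).
have vv k : Num.sqrt (weight k `^ (- s)) * v k = 1.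
  rewrite -sqrtrM ?powR_ge0// powRN mulVf ?sqrtr1//.
  by rewrite gt_eqF// weight_powR_gt0.
rewrite (eq_bigr (fun k => Num.sqrt (weight k `^ (- s)) * (v k * nc (a k)))); last first.
  by move=> k _; rewrite mulrA vv mul1r.
apply: cauchy_schwarz_le => //.
- rewrite sqr_sqrtr// (le_trans _ (wS uF))// ler_sum// => k _.
  by rewrite sqr_sqrtr// powR_ge0.
- rewrite (le_trans _ (aA F uF))// ler_sum// => k _.
  by rewrite exprMn /v sqr_sqrtr// powR_ge0.
Qed.

(** From [weight (p + q) <= 4 * max]: taking powers needs monotonicity only, so that every [s >= 0]
    is covered without convexity. *)
Lemma weight_powRD (p q : Z) :
  weight (p + q) `^ s <= 4 `^ s * (weight p `^ s + weight q `^ s).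
Proof.
have P : 0 < weight p :> R by exact: weight_gt0.
have Q : 0 < weight q :> R by exact: weight_gt0.
have PQ := @weightD R d p q.
pose m : R := Num.max (weight p) (weight q).
have m0 : 0 <= m by rewrite le_max ltW.
have : weight (p + q) <= 4 * m.
  have : weight p <= m by rewrite le_max lexx.
  have : weight q <= m by rewrite le_max lexx orbT.
  by move: PQ; lra.
have pq0 : 0 <= weight (p + q) :> R by rewrite ltW// weight_gt0.
move=> /(ge0_ler_powR s0) h.
rewrite (le_trans (h _ _)) ?nnegrE ?mulr_ge0//.
rewrite powRM// ler_wpM2l ?powR_ge0// /m /Num.max.
by case: ifP => _; rewrite ?lerDl ?lerDr powR_ge0.
Qed.

Definition algebra_sq := 4 `^ s * (S + S).

(* Cauchy-Schwarz with the weights [w(p)^-s w(k-p)^-s], whose sum over [p] is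
   [O(w(k)^-s)]. *)
Lemma bd_fconv_sq a b A B : bd s a A -> bd s b B ->
  bd s (fconv a b) (Num.sqrt algebra_sq * (A * B)).
Proof.
move=> aA bB; have lA := bd_l1_weight aA; have lB := bd_l1_weight bB.
have [A0 {}aA] := aA; have [B0 {}bB] := bB.
have K0 : 0 <= algebra_sq by rewrite mulr_ge0 ?powR_ge0// addr_ge0.
have X0 : 0 <= A * B by rewrite mulr_ge0.
split; first by rewrite mulr_ge0 ?sqrtr_ge0.
move=> F uF; rewrite exprMn sqr_sqrtr//.
have fin (G : seq Z) : uniq G -> \sum_(k <- F) weight k `^ s *
    nc (\sum_(p <- G) a p * b (k - p)) ^+ 2 <= algebra_sq * (A * B) ^+ 2.
  move=> uG.
  pose v (p : Z) := Num.sqrt (weight p `^ s) : R.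
  have v0 p : 0 < v p by rewrite sqrtr_gt0 weight_powR_gt0.
  have v2 p : v p ^+ 2 = weight p `^ s by rewrite sqr_sqrtr// powR_ge0.
  have wN p : weight p `^ (- s) = (weight p `^ s)^-1 :> R by rewrite powRN.
  apply: (@le_trans _ _ (\sum_(k <- F) algebra_sq * \sum_(p <- G)
      (v p * nc (a p)) ^+ 2 * (v (k - p) * nc (b (k - p))) ^+ 2)).
    rewrite ler_sum// => k _.
    have h1 : nc (\sum_(p <- G) a p * b (k - p)) ^+ 2 <=
        (\sum_(p <- G) ((v p * v (k - p))^-1) ^+ 2) *
        (\sum_(p <- G) (v p * nc (a p) * (v (k - p) * nc (b (k - p)))) ^+ 2).
      rewrite (le_trans _ (cauchy_schwarz_seq _ _ _))// lerXn2r ?nnegrE ?nc_ge0//.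
        rewrite sumr_ge0// => p _; rewrite mulr_ge0 ?invr_ge0 ?mulr_ge0 ?nc_ge0 ?ltW//.
      rewrite (le_trans (nc_sum _ _))//; apply: le_of_eq.
      apply: eq_bigr => p _; rewrite ncM.
      by have h := v0 p; have h' := v0 (k - p); field; rewrite !gt_eqF.
    have h2 : weight k `^ s * (\sum_(p <- G) ((v p * v (k - p))^-1) ^+ 2) <= algebra_sq.
      apply: (@le_trans _ _ (4 `^ s * \sum_(p <- G) (weight (k - p) `^ (- s) + weight p `^ (- s)))).
        rewrite !mulr_sumr ler_sum// => p _.
        rewrite exprVn exprMn !v2 !wN ler_pdivrMr ?mulr_gt0 ?weight_powR_gt0//.
        have := weight_powRD p (k - p); rewrite addrCA subrr addr0 => /le_trans; apply.
        rewrite -mulrA ler_wpM2l ?powR_ge0//.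
        have h := @weight_powR_gt0 R d s p.
        have h' := @weight_powR_gt0 R d s (k - p).
        apply: le_of_eq; field.
        by rewrite !gt_eqF.
      rewrite ler_wpM2l ?powR_ge0// big_split/= lerD ?wS//.
      rewrite -(big_map (fun p => k - p) predT (fun p => weight p `^ (- s))) wS//.
      by rewrite map_inj_uniq//; exact: subrI.
    rewrite (le_trans (ler_wpM2l (powR_ge0 _ _) h1))// mulrA.
    under [in leRHS]eq_bigr do rewrite -exprMn.
    by rewrite ler_wpM2r// sumr_ge0// => p _; rewrite sqr_ge0.
  rewrite -mulr_sumr ler_wpM2l// exchange_big/=.
  apply: (@le_trans _ _ (\sum_(p <- G) (v p * nc (a p)) ^+ 2 * B ^+ 2)).
    rewrite ler_sum// => p _; rewrite -mulr_sumr ler_wpM2l ?sqr_ge0//.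
    rewrite -(big_map (fun k => k - p) predT (fun k => (v k * nc (b k)) ^+ 2)).
    rewrite (le_trans _ (bB (map (fun k => k - p) F) _))//.
      by rewrite ler_sum// => k _; rewrite exprMn v2.
    by rewrite map_inj_uniq//; exact: addIr.
  rewrite -mulr_suml exprMn ler_wpM2r ?sqr_ge0//.
  rewrite (le_trans _ (aA G uG))//.
  by rewrite ler_sum// => k _; rewrite exprMn v2.
(* [fin] bounds the convolution with its inner sum truncated to [G]. To restore the full inner sum,
   one [G] is chosen that works for all [k] in [F] with error [dl], where [dl * W <= e] absorbs the
   total change of the squares. *)
apply/ler_addgt0Pl => e e0.
pose M := Num.sqrt S * A * (Num.sqrt S * B).
pose W := \sum_(k <- F) weight k `^ s * (2 * M + 1).
have M0 : 0 <= M by rewrite !mulr_ge0 ?sqrtr_ge0.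
have W0 : 0 <= W.
  by rewrite sumr_ge0// => k _; rewrite mulr_ge0 ?powR_ge0// addr_ge0// mulr_ge0.
pose dl : R := Num.min 1 (e / (W + 1)).
have dl0 : 0 < dl by rewrite lt_min ltr01 divr_gt0// ltr_wpDl.
have [G [uG hG]] : exists G : seq Z, uniq G /\ forall k, k \in F ->
    nc (\sum_(p <- G) a p * b (k - p) - fconv a b k) <= dl.
  have [G hG] : exists G : seq Z, forall H, uniq H -> {subset G <= H} -> forall k, k \in F ->
      nc (\sum_(p <- H) a p * b (k - p) - fconv a b k) <= dl.
    elim: (F) => [|k F' [G IH]]; first by exists [::].
    have [G' hG'] := csum_approx (l1_fconv k lA lB) dl0.
    exists (G ++ G') => H uH sH l; rewrite in_cons => /orP[/eqP ->|].
      by apply: hG' => // q qG; rewrite sH// mem_cat qG orbT.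
    by apply: IH => // q qG; rewrite sH// mem_cat qG.
  exists (undup G); split; first exact: undup_uniq.
  by move=> k kF; apply: hG => //; [exact: undup_uniq|move=> q; rewrite mem_undup].
rewrite addrC (le_trans _ (lerD (fin G uG) (lexx e)))//.
have -> : e = e / (W + 1) * (W + 1) by rewrite divfK// gt_eqF// ltr_wpDl.
apply: (@le_trans _ _ (\sum_(k <- F) weight k `^ s *
    nc (\sum_(p <- G) a p * b (k - p)) ^+ 2 + dl * W)); last first.
  rewrite lerD2l ler_pM ?(ltW dl0)//; first by rewrite ge_min lexx orbT.
  by rewrite lerDl.
rewrite /W mulr_sumr -big_split big_seq [leRHS]big_seq ler_sum// => k kF/=.
rewrite [dl * _]mulrCA -mulrDr ler_wpM2l ?powR_ge0//.
have := hG k kF; set x := \sum_(_ <- _) _; set y := fconv a b k => xy.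
have yM : nc y <= M by exact: csum_le (l1_fconv k lA lB).
have := nc_distl x y; rewrite ler_norml => /andP[h1 h2].
have x0 := nc_ge0 x; have y0 := nc_ge0 y.
apply: sqr_le_of_near => //; first exact: ltW.
by rewrite -lerBlDl (le_trans _ xy)//; move: h1; rewrite lerNl opprB.
Qed.

End algebra.

Lemma bd_algebra s : (0 < d)%N -> d%:R / 2 < s -> exists K : R, [/\ 0 < K,
  forall a A, bd s a A -> l1 a (K * A) &
  forall a b A B, bd s a A -> bd s b B -> bd s (fconv a b) (K * (A * B))].
Proof.
move=> d0 ds; have [S hS] := @weight_summable R d s d0 ds.
have S0 : 0 <= S by have := hS [::] isT; rewrite big_nil.
have s0 : 0 <= s by rewrite ltW// (le_lt_trans _ ds)// divr_ge0.
pose K := Num.sqrt S + Num.sqrt (algebra_sq s S) + 1.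
have h1 := sqrtr_ge0 S; have h2 := sqrtr_ge0 (algebra_sq s S).
exists K; split; first by rewrite /K; lra.
- move=> a A aA; have A0 := bd_ge0 aA => F uF.
  by rewrite (le_trans (bd_l1_weight S0 hS aA uF))// ler_wpM2r// /K; lra.
- move=> a b A B aA bB; apply: bd_le (bd_fconv_sq s0 S0 hS aA bB).
  rewrite ler_wpM2r ?mulr_ge0 ?(bd_ge0 aA) ?(bd_ge0 bB)// /K; lra.
Qed.

End sobolev_sequences.

(** * Integration on the torus *)

Section complex_integral.
Context {dd : measure_display} {T : measurableType dd} {R : realType}.
Variable P : probability T R.
Implicit Types (f g : T -> R[i]) (C : R).

Definition cmeasurable f :=
  measurable_fun setT (@complex.Re R \o f) /\ measurable_fun setT (@complex.Im R \o f).

Definition cintegrable f := P.-integrable setT (EFin \o (@complex.Re R \o f)) /\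
  P.-integrable setT (EFin \o (@complex.Im R \o f)).

Definition cint f : R[i] :=
  Rintegral P setT (@complex.Re R \o f) +i* Rintegral P setT (@complex.Im R \o f).

Lemma le_Rintegrable (f g : T -> R) : measurable_fun setT f ->
  P.-integrable setT (EFin \o g) -> (forall x, `|f x| <= g x) ->
  P.-integrable setT (EFin \o f).
Proof.
move=> mf ig fg; apply: (le_integrable _ _ _ ig) => //.
  exact/measurable_EFinP.
by move=> x _ /=; rewrite lee_fin (le_trans (fg x))// ler_norm.
Qed.

Lemma bounded_Rintegrable (f : T -> R) C : measurable_fun setT f ->
  (forall x, `|f x| <= C) -> P.-integrable setT (EFin \o f).
Proof.
move=> mf fC; apply: (le_Rintegrable mf _ fC).
exact: finite_measure_integrable_cst.
Qed.

Lemma RintegrableM (f g : T -> R) C : P.-integrable setT (EFin \o f) ->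
  measurable_fun setT g -> (forall x, `|g x| <= C) ->
  P.-integrable setT (EFin \o (fun x => f x * g x)).
Proof.
move=> intf mg gC.
have mf : measurable_fun setT f by apply/measurable_EFinP; exact: (measurable_int P).
apply: (@le_Rintegrable _ (fun x => C * `|f x|)).
- exact: measurable_funM.
- have /(integrableZl measurableT C) := integrable_norm intf.
  by apply: eq_integrable.
- by move=> x; rewrite normrM mulrC ler_wpM2r.
Qed.

Lemma RintegrableD (f g : T -> R) : P.-integrable setT (EFin \o f) ->
  P.-integrable setT (EFin \o g) -> P.-integrable setT (EFin \o (fun x => f x + g x)).
Proof. by move=> intf intg; have := integrableD measurableT intf intg. Qed.

Lemma RintegrableB (f g : T -> R) : P.-integrable setT (EFin \o f) ->
  P.-integrable setT (EFin \o g) -> P.-integrable setT (EFin \o (fun x => f x - g x)).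
Proof. by move=> intf intg; have := integrableB measurableT intf intg. Qed.

Lemma ReD (z w : R[i]) : complex.Re (z + w) = complex.Re z + complex.Re w.
Proof. by case: z; case: w. Qed.

Lemma ImD (z w : R[i]) : complex.Im (z + w) = complex.Im z + complex.Im w.
Proof. by case: z; case: w. Qed.

Lemma ReM (z w : R[i]) : complex.Re (z * w) =
  complex.Re z * complex.Re w - complex.Im z * complex.Im w.
Proof. by case: z; case: w. Qed.

Lemma ImM (z w : R[i]) : complex.Im (z * w) =
  complex.Re z * complex.Im w + complex.Im z * complex.Re w.
Proof. by case: z; case: w. Qed.

Lemma complex_eq (z w : R[i]) : complex.Re z = complex.Re w ->
  complex.Im z = complex.Im w -> z = w.
Proof. by case: z => a b; case: w => ? ? /= -> ->. Qed.

Lemma cmeasurableD f g : cmeasurable f -> cmeasurable g ->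
  cmeasurable (fun x => f x + g x).
Proof.
move=> [fR fI] [gR gI]; split.
- rewrite (_ : _ \o _ = (fun x => complex.Re (f x) + complex.Re (g x))).
    exact: measurable_funD.
  by apply/funext => x /=; rewrite ReD.
- rewrite (_ : _ \o _ = (fun x => complex.Im (f x) + complex.Im (g x))).
    exact: measurable_funD.
  by apply/funext => x /=; rewrite ImD.
Qed.

Lemma cmeasurableM f g : cmeasurable f -> cmeasurable g ->
  cmeasurable (fun x => f x * g x).
Proof.
move=> [fR fI] [gR gI]; split.
- rewrite (_ : _ \o _ = (fun x => complex.Re (f x) * complex.Re (g x) -
      complex.Im (f x) * complex.Im (g x))).
    by apply: measurable_funB; apply: measurable_funM.
  by apply/funext => x /=; rewrite ReM.
- rewrite (_ : _ \o _ = (fun x => complex.Re (f x) * complex.Im (g x) +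
      complex.Im (f x) * complex.Re (g x))).
    by apply: measurable_funD; apply: measurable_funM.
  by apply/funext => x /=; rewrite ImM.
Qed.

Lemma cmeasurable_cst (z : R[i]) : cmeasurable (fun=> z).
Proof. by split; exact: measurable_cst. Qed.

Lemma cmeasurableZ z f : cmeasurable f -> cmeasurable (fun x => z * f x).
Proof. by apply: cmeasurableM; exact: cmeasurable_cst. Qed.

Lemma cmeasurable_conj f : cmeasurable f -> cmeasurable (fun x => (f x)^*).
Proof.
move=> [fR fI]; split.
- rewrite (_ : _ \o _ = @complex.Re R \o f)//.
  by apply/funext => x /=; case: (f x).
- rewrite (_ : _ \o _ = (fun x => - complex.Im (f x))).
    exact: measurableT_comp.
  by apply/funext => x /=; case: (f x).
Qed.

Lemma cmeasurable_nc f : cmeasurable f -> measurable_fun setT (fun x => nc (f x)).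
Proof.
move=> [fR fI].
rewrite (_ : (fun _ => _) = Num.sqrt \o (fun x => complex.Re (f x) * complex.Re (f x)
  + complex.Im (f x) * complex.Im (f x))).
  apply: measurableT_comp.
    by apply: continuous_measurable_fun; exact: sqrt_continuous.
  by apply: measurable_funD; apply: measurable_funM.
by apply/funext => x; rewrite /ComplexField.Normc.normc/=; case: (f x).
Qed.

Lemma cmeasurable_sum (I : Type) (s : seq I) (f : I -> T -> R[i]) :
  (forall i, cmeasurable (f i)) -> cmeasurable (fun x => \sum_(i <- s) f i x).
Proof.
move=> mf; elim: s => [|i s IH].
  rewrite (_ : (fun _ => _) = fun=> 0); last by apply/funext => x; rewrite big_nil.
  exact: cmeasurable_cst.
rewrite (_ : (fun _ => _) = fun x => f i x + \sum_(j <- s) f j x).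
  exact: cmeasurableD.
by apply/funext => x; rewrite big_cons.
Qed.

Lemma cintegrable_meas f : cintegrable f -> cmeasurable f.
Proof. by move=> [h1 h2]; split; apply/measurable_EFinP; exact: (measurable_int P). Qed.

Lemma cintegrable_dom f (g : T -> R) : cmeasurable f ->
  P.-integrable setT (EFin \o g) -> (forall x, nc (f x) <= g x) -> cintegrable f.
Proof.
move=> [fR fI] ig fg; split; apply: (le_Rintegrable _ ig) => // x.
- exact: le_trans (nc_Re _) (fg x).
- exact: le_trans (nc_Im _) (fg x).
Qed.

Lemma cintegrable_bounded f C : cmeasurable f -> (forall x, nc (f x) <= C) ->
  cintegrable f.
Proof.
move=> mf fC; apply: (cintegrable_dom mf _ fC).
exact: finite_measure_integrable_cst.
Qed.

Lemma cintegrableD f g : cintegrable f -> cintegrable g ->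
  cintegrable (fun x => f x + g x).
Proof.
move=> [fR fI] [gR gI]; split.
- rewrite (_ : _ \o _ = EFin \o (fun x => complex.Re (f x) + complex.Re (g x))).
    exact: RintegrableD.
  by apply/funext => x /=; rewrite ReD.
- rewrite (_ : _ \o _ = EFin \o (fun x => complex.Im (f x) + complex.Im (g x))).
    exact: RintegrableD.
  by apply/funext => x /=; rewrite ImD.
Qed.

Lemma cintegrableM f g C : cintegrable f -> cmeasurable g ->
  (forall x, nc (g x) <= C) -> cintegrable (fun x => f x * g x).
Proof.
move=> [fR fI] [gR gI] gC.
have gRC x : `|complex.Re (g x)| <= C by exact: le_trans (nc_Re _) (gC x).
have gIC x : `|complex.Im (g x)| <= C by exact: le_trans (nc_Im _) (gC x).
split.
- rewrite (_ : _ \o _ = EFin \o (fun x => complex.Re (f x) * complex.Re (g x) -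
      complex.Im (f x) * complex.Im (g x))).
    by apply: RintegrableB; apply: RintegrableM => //.
  by apply/funext => x /=; rewrite ReM.
- rewrite (_ : _ \o _ = EFin \o (fun x => complex.Re (f x) * complex.Im (g x) +
      complex.Im (f x) * complex.Re (g x))).
    by apply: RintegrableD; apply: RintegrableM => //.
  by apply/funext => x /=; rewrite ImM.
Qed.

Lemma cintD f g : cintegrable f -> cintegrable g ->
  cint (fun x => f x + g x) = cint f + cint g.
Proof.
move=> [fR fI] [gR gI]; apply: complex_eq.
- rewrite /= -RintegralD//.
  by apply: eq_Rintegral => x _ /=; rewrite ReD.
- rewrite /= -RintegralD//.
  by apply: eq_Rintegral => x _ /=; rewrite ImD.
Qed.

Lemma cintZ z f : cintegrable f -> cint (fun x => z * f x) = z * cint f.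
Proof.
move=> [fR fI]; case: z => a b.
have iZ (c : R) (h : T -> R) : P.-integrable setT (EFin \o h) ->
    P.-integrable setT (EFin \o (fun x => c * h x)).
  by move=> /(integrableZl measurableT c).
apply: complex_eq; rewrite /= -!RintegralZl//.
- rewrite -RintegralB//; try exact: iZ.
  by apply: eq_Rintegral => x _ /=; case: (f x).
- rewrite -RintegralD//; try exact: iZ.
  by apply: eq_Rintegral => x _ /=; case: (f x).
Qed.

Lemma cint_ext f g : f =1 g -> cint f = cint g.
Proof. by move=> /funext ->. Qed.

Lemma cintegrable_nc f : cintegrable f -> P.-integrable setT (EFin \o (fun x => nc (f x))).
Proof.
move=> intf; have mf := cintegrable_meas intf.
have [/integrable_norm fR /integrable_norm fI] := intf.
apply: (le_Rintegrable (cmeasurable_nc mf) (RintegrableD fR fI)) => x /=.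
by rewrite ger0_norm ?nc_ge0// nc_ReIm.
Qed.

Lemma cintegrableZ z f : cintegrable f -> cintegrable (fun x => z * f x).
Proof.
move=> intf; have mz := cmeasurableZ z (cintegrable_meas intf).
apply: (cintegrable_dom mz (integrableZl measurableT (nc z) (cintegrable_nc intf))) => x.
by rewrite ncM.
Qed.

Lemma cint_cst z : cint (fun=> z) = z.
Proof.
have P1 : fine (P [set: T]) = 1 by rewrite probability_setT.
case: z => a b; apply: complex_eq; by rewrite /= Rintegral_cst//= P1 mulr1.
Qed.

Lemma cintegrable_sum (I : Type) (s : seq I) (f : I -> T -> R[i]) :
  (forall i, cintegrable (f i)) -> cintegrable (fun x => \sum_(i <- s) f i x).
Proof.
move=> mf; elim: s => [|i s IH].
  rewrite (_ : (fun _ => _) = fun=> 0); last by apply/funext => x; rewrite big_nil.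
  by apply: (@cintegrable_bounded _ 0); [exact: cmeasurable_cst|move=> x; rewrite nc0].
rewrite (_ : (fun _ => _) = fun x => f i x + \sum_(j <- s) f j x).
  exact: cintegrableD.
by apply/funext => x; rewrite big_cons.
Qed.

Lemma cint_sum (I : Type) (s : seq I) (f : I -> T -> R[i]) :
  (forall i, cintegrable (f i)) ->
  cint (fun x => \sum_(i <- s) f i x) = \sum_(i <- s) cint (f i).
Proof.
move=> mf; elim: s => [|i s IH].
  by rewrite big_nil -[RHS](cint_cst 0); apply: cint_ext => x; rewrite big_nil.
rewrite big_cons -IH -cintD//; last exact: cintegrable_sum.
by apply: cint_ext => x; rewrite big_cons.
Qed.

(** The factor 2 comes from treating real and imaginary part separately. It is harmless in
    [cint_synthM], where the bound only has to be finite or arbitrarily small. *)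
Lemma cint_le f (g : T -> R) : cintegrable f -> P.-integrable setT (EFin \o g) ->
  (forall x, nc (f x) <= g x) -> nc (cint f) <= 2 * Rintegral P setT g.
Proof.
move=> [fR fI] ig fg; rewrite (le_trans (nc_ReIm _))// mulr_natl mulr2n lerD//=.
- rewrite (le_trans (le_normr_Rintegral _ _))//= le_Rintegral//.
    exact: integrable_norm fR.
  by move=> x _; exact: le_trans (nc_Re _) (fg x).
- rewrite (le_trans (le_normr_Rintegral _ _))//= le_Rintegral//.
    exact: integrable_norm fI.
  by move=> x _; exact: le_trans (nc_Im _) (fg x).
Qed.

Lemma cint_ae f g : cintegrable f -> cintegrable g -> {ae P, forall x, f x = g x} ->
  cint f = cint g.
Proof.
move=> [fR fI] [gR gI] fg; apply: complex_eq; rewrite /=; congr fine.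
- apply: ae_eq_integral => //; [exact: measurable_int fR|exact: measurable_int gR|].
  by apply: filterS fg => x /= -> _.
- apply: ae_eq_integral => //; [exact: measurable_int fI|exact: measurable_int gI|].
  by apply: filterS fg => x /= -> _.
Qed.

Lemma cint_conj f : cintegrable f -> cint (fun x => (f x)^*) = (cint f)^*.
Proof.
move=> [fR fI]; apply: complex_eq => /=.
- by apply: eq_Rintegral => x _ /=; case: (f x).
- rewrite -mulN1r -RintegralZl//.
  by apply: eq_Rintegral => x _ /=; rewrite mulN1r; case: (f x).
Qed.

Lemma cintegrable_conj f : cintegrable f -> cintegrable (fun x => (f x)^*).
Proof.
move=> intf; apply: (cintegrable_dom (cmeasurable_conj (cintegrable_meas intf))
  (cintegrable_nc intf)) => x.
by rewrite ncJ.
Qed.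

End complex_integral.

(** * The exponential on the unit circle and orthogonality in one variable *)

Section unit_circle.
Context {R : realType}.

Definition ei (y : R) : R[i] := cos y +i* sin y.

Lemma cexp_i y : cexp ('i * y%:C) = ei y.
Proof.
have -> : 'i * y%:C = 0 +i* y by apply: complex_eq; rewrite /=; ring.
by rewrite /cexp/= expR0 -/(1%:C) mul1r.
Qed.

Lemma eiD x y : ei (x + y) = ei x * ei y.
Proof. by apply: complex_eq; rewrite /= ?cosD ?sinD; ring. Qed.

Lemma ei0 : ei 0 = 1.
Proof. by rewrite /ei cos0 sin0. Qed.

Lemma eiJ y : (ei y)^* = ei (- y).
Proof. by rewrite /ei cosN sinN. Qed.

Lemma nc_ei y : nc (ei y) = 1.
Proof. by rewrite /ComplexField.Normc.normc/= cos2Dsin2 sqrtr1. Qed.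

Lemma cexp_Ni y : cexp (- ('i * y%:C)) = ei (- y).
Proof. by rewrite -cexp_i rmorphN mulrN. Qed.

Lemma ei_periodic x (n : int) : ei (x + n%:~R * (2 * pi)) = ei x.
Proof.
have e1 y : ei (y + 2 * pi) = ei y.
  by rewrite eiD {2}/ei mulr_natl cos2pi sin2pi -/(1%:C) mulr1.
have en (m : nat) y : ei (y + m%:R * (2 * pi)) = ei y.
  elim: m y => [|m IH] y; first by rewrite mul0r addr0.
  by rewrite -[m.+1]addn1 natrD mulrDl mul1r addrA e1 IH.
case: n => m; first exact: en.
by rewrite NegzE rmorphN mulNr -{2}(subrK (m.+1%:R * (2 * pi)) x) en.
Qed.

Lemma cmeasurable_ei : cmeasurable ei.
Proof.
split; apply: continuous_measurable_fun.
- exact: continuous_cos.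
- exact: continuous_sin.
Qed.

Local Notation unif := (uniform_prob (@two_pi_gt0 R)).

Lemma cos_intmul_2pi (n : int) : cos (n%:~R * (2 * pi)) = 1 :> R.
Proof.
have := ei_periodic 0 n; by rewrite add0r ei0 => /(congr1 (@complex.Re R)).
Qed.

Lemma sin_intmul_2pi (n : int) : sin (n%:~R * (2 * pi)) = 0 :> R.
Proof.
have := ei_periodic 0 n; by rewrite add0r ei0 => /(congr1 (@complex.Im R)).
Qed.

(** The formula for integrals against the uniform law is applied to a nonnegative function, hence
    the detour through [1 + f], with primitive [x + F x] and integral 1. *)
Lemma Rintegral_unif_FTC (f F : R -> R) : (forall x, `|f x| <= 1) ->
  continuous f -> (forall x : R, is_derive x 1 F (f x)) -> F 0 = F (2 * pi) ->
  Rintegral unif setT f = 0.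
Proof.
move=> f1 cf dF FF.
have p0 := @two_pi_gt0 R.
have mf : measurable_fun setT f by exact: continuous_measurable_fun.
have intf : unif.-integrable setT (EFin \o f) by apply: (bounded_Rintegrable unif mf f1).
have int1 : unif.-integrable setT (EFin \o cst 1).
  exact: finite_measure_integrable_cst.
have : Rintegral unif setT (fun x => 1 + f x) = 1.
  rewrite /Rintegral integral_uniform//; last 2 first.
  - apply/measurable_EFinP; apply: measurable_funD => //.
  - by move=> x; rewrite lee_fin; have := f1 x; rewrite ler_norml => /andP[]; lra.
  rewrite (@continuous_FTC2 _ (fun x => 1 + f x) (fun x => x + F x) 0 (2 * pi))//.
  - by rewrite -EFinB -EFinM/= FF subr0 add0r addrK mulVf// gt_eqF.
  - by apply: continuous_subspaceT => x; apply: cvgD; [exact: cvg_cst|exact: cf].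
  - have dxF (x : R) : derivable (fun x => x + F x) x 1 by apply: derivableD; [exact: derivable_id|case: (dF x)].
    have cxF : continuous (fun x => x + F x).
      by move=> x; apply: differentiable_continuous; apply/derivable1_diffP.
    split.
    + by move=> x _.
    + by apply: cvg_at_right_filter; exact: cxF.
    + by apply: cvg_at_left_filter; exact: cxF.
  - move=> x _; rewrite derive1E.
    have h : is_derive x 1 (id + F) (1 + f x) by apply: is_deriveD.
    by rewrite (@derive_val _ _ _ _ _ _ _ h).
rewrite RintegralD//.
rewrite (_ : Rintegral _ _ _ = 1) ?Rintegral_cst//.
  by move/eqP; rewrite -subr_eq0 addrAC subrr add0r => /eqP.
by rewrite /= probability_setT mulr1.
Qed.

Lemma cint_unif_ei (n : int) :
  cint unif (fun x => ei (n%:~R * x)) = (n == 0)%:R.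
Proof.
have [->|n0] := eqVneq n 0.
  rewrite -[RHS](cint_cst unif 1); apply: cint_ext => x.
  by rewrite mul0r ei0.
have nR : n%:~R != 0 :> R by rewrite intr_eq0.
apply: complex_eq => /=.
- apply: (@Rintegral_unif_FTC _ (fun x => n%:~R^-1 * sin (n%:~R * x))).
  + by move=> x /=; rewrite ler_norml cos_geN1 cos_le1.
  + move=> x; apply: continuous_comp; last exact: continuous_cos.
    by apply: cvgM; [exact: cvg_cst|exact: cvg_id].
  + move=> x; apply: is_derive_eq.
    rewrite /GRing.scale/=.
    by field.
  + by rewrite mulr0 sin0 sin_intmul_2pi.
- apply: (@Rintegral_unif_FTC _ (fun x => - n%:~R^-1 * cos (n%:~R * x))).
  + by move=> x /=; rewrite ler_norml sin_geN1 sin_le1.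
  + move=> x; apply: continuous_comp; last exact: continuous_sin.
    by apply: cvgM; [exact: cvg_cst|exact: cvg_id].
  + move=> x; apply: is_derive_eq.
    rewrite /GRing.scale/=.
    by field.
  + by rewrite mulr0 cos0 cos_intmul_2pi.
Qed.

End unit_circle.

(** * Fubini and orthogonality of the characters on the torus *)

Section torus_integral.
Context {R : realType}.
Local Notation unif := (uniform_prob (@two_pi_gt0 R)).

(** Fubini after undoing the pushforward by [cons_point]. Boundedness gives integrability on the
    product and on every slice at once. *)
Lemma Rintegral_torusS (n : nat) (f : n.+1.-tuple R -> R) (C : R) :
  measurable_fun setT f -> (forall x, `|f x| <= C) ->
  Rintegral (torus_measure n.+1) setT f =
  Rintegral unif setT (fun a =>
    Rintegral (torus_measure n) setT (fun x => f [tuple of a :: x])).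
Proof.
move=> mf fC; rewrite /Rintegral; congr fine.
have mc := @measurable_cons_point R n.
pose g (z : measurableTypeR R * n.-tuple R) := f (cons_point z).
have mg : measurable_fun setT g by exact: (measurableT_comp mf mc).
have ig : (unif \x torus_measure n)%E.-integrable setT (EFin \o g).
  apply: (@bounded_Rintegrable _ _ _ (unif \x torus_measure n)%E g C mg).
  by move=> z; exact: fC.
rewrite [LHS](_ : _ = \int[(unif \x torus_measure n)%E]_z (g z)%:E)%E; last first.
  rewrite /= /distribution integral_pushforward//.
  exact/measurable_EFinP.
rewrite -(integral12_prod_meas1 ig); apply: eq_integral => a _.
rewrite /fubini_F fineK//.
apply: integrable_fin_num => //.
apply: (@bounded_Rintegrable _ _ _ (torus_measure n) (fun x => f [tuple of a :: x]) C) => //.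
apply: (measurableT_comp mf).
apply: measurable_cons; [exact: measurable_cst|exact: measurable_id].
Qed.

Lemma cint_torusS (n : nat) (f : n.+1.-tuple R -> R[i]) (C : R) :
  cmeasurable f -> (forall x, nc (f x) <= C) ->
  cint (torus_measure n.+1) f =
  cint unif (fun a => cint (torus_measure n) (fun x => f [tuple of a :: x])).
Proof.
move=> [fR fI] fC; apply: complex_eq => /=.
- rewrite (Rintegral_torusS fR (C := C))// => x.
  exact: le_trans (nc_Re _) (fC x).
- rewrite (Rintegral_torusS fI (C := C))// => x.
  exact: le_trans (nc_Im _) (fC x).
Qed.

Lemma measurable_freq_dot n (k : 'rV[int]_n) :
  measurable_fun setT (freq_dot k : n.-tuple R -> R).
Proof.
rewrite (_ : freq_dot k = fun x : n.-tuple R => \sum_(i < n) (k ord0 i)%:~R * tnth x i)//.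
apply: measurable_sum => i; apply: measurable_funM; first exact: measurable_cst.
exact: measurable_tnth.
Qed.

Definition em n (k : 'rV[int]_n) (x : n.-tuple R) : R[i] := ei (freq_dot k x).

Lemma nc_em n (k : 'rV[int]_n) x : nc (em k x) = 1.
Proof. exact: nc_ei. Qed.

Lemma cmeasurable_ei_comp dd (T : measurableType dd) (f : T -> R) :
  measurable_fun setT f -> cmeasurable (fun x => ei (f x)).
Proof.
have [cR cI] := @cmeasurable_ei R.
by move=> mf; split; [exact: (measurableT_comp cR mf)|exact: (measurableT_comp cI mf)].
Qed.

Lemma cmeasurable_em n (k : 'rV[int]_n) : cmeasurable (em k).
Proof. exact: cmeasurable_ei_comp (measurable_freq_dot k). Qed.

Lemma cintegrable_em n (u : n.-tuple R -> R[i]) (k : 'rV[int]_n) :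
  cintegrable (torus_measure n) u -> cintegrable (torus_measure n) (fun x => u x * em k x).
Proof.
move=> iu; apply: (cintegrableM (C := 1)) => //; first exact: cmeasurable_em.
by move=> x; rewrite nc_em.
Qed.

Lemma freq_dotD n (k l : 'rV[int]_n) (x : n.-tuple R) :
  freq_dot (k + l) x = freq_dot k x + freq_dot l x.
Proof.
rewrite /freq_dot -big_split; apply: eq_bigr => i _.
by rewrite mxE rmorphD/= mulrDl.
Qed.

Lemma freq_dotN n (k : 'rV[int]_n) (x : n.-tuple R) :
  freq_dot (- k) x = - freq_dot k x.
Proof.
rewrite /freq_dot -sumrN; apply: eq_bigr => i _.
by rewrite mxE rmorphN/= mulNr.
Qed.

Lemma emD n (k l : 'rV[int]_n) x : em (k + l) x = em k x * em l x.
Proof. by rewrite /em freq_dotD eiD. Qed.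

Lemma em0 n (x : n.-tuple R) : em (0 : 'rV[int]_n) x = 1.
Proof.
rewrite /em (_ : freq_dot 0 x = 0) ?ei0// /freq_dot big1// => i _.
by rewrite mxE mul0r.
Qed.

Lemma em_J n (k : 'rV[int]_n) x : (em k x)^* = em (- k) x.
Proof. by rewrite /em freq_dotN eiJ. Qed.

Lemma freq_dotS n (k : 'rV[int]_n.+1) (a : R) (x : n.-tuple R) :
  freq_dot k [tuple of a :: x] =
  (k ord0 ord0)%:~R * a + freq_dot (\row_i k ord0 (lift ord0 i)) x.
Proof.
rewrite /freq_dot big_ord_recl/= tnth0; congr (_ + _).
by apply: eq_bigr => i _; rewrite tnthS mxE.
Qed.

Lemma cint_em n (k : 'rV[int]_n) : cint (torus_measure n) (@em n k) = (k == 0)%:R.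
Proof.
elim: n => [|n IH] in k *.
  have -> : k = 0 by apply/rowP => -[].
  rewrite eqxx -[RHS](cint_cst (@torus_measure R 0) 1).
  by apply: cint_ext => x; rewrite em0.
rewrite (cint_torusS (C := 1)); last 2 first.
  - exact: cmeasurable_em.
  - by move=> x; rewrite nc_em.
pose k' := \row_i k ord0 (lift ord0 i).
have -> : (fun a => cint (torus_measure n) (fun x : n.-tuple R => em k [tuple of a :: x])) =
    fun a => (k' == 0)%:R * ei ((k ord0 ord0)%:~R * a).
  apply/funext => a; rewrite -IH mulrC -cintZ; last first.
    apply: (@cintegrable_bounded _ _ _ _ _ 1); first exact: cmeasurable_em.
    by move=> x; rewrite nc_em.
  by apply: cint_ext => x; rewrite /em freq_dotS eiD.
rewrite cintZ; last first.
  apply: (@cintegrable_bounded _ _ _ _ _ 1); last by move=> x; rewrite nc_ei.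
  apply: cmeasurable_ei_comp; apply: measurable_funM; first exact: measurable_cst.
  exact: measurable_id.
rewrite cint_unif_ei -natrM mulnb; congr (_%:R); congr nat_of_bool.
apply/andP/eqP => [[/eqP k'0 /eqP k0]|k0].
  apply/rowP => i; rewrite [RHS]mxE; have [j ->|->] := unliftP ord0 i.
    by move/rowP: k'0 => /(_ j); rewrite !mxE.
  exact: k0.
by split; apply/eqP; [apply/rowP => i; rewrite !mxE k0 mxE|rewrite k0 mxE].
Qed.

(** The boundary of the cell is negligible. This matters because the trigonometric cuts of
    [trig_cut] describe half-spaces only inside the open cell. *)
Lemma torus_cell_ae n : {ae torus_measure n, forall x : n.-tuple R,
  forall i, 0 < tnth x i < 2 * pi}.
Proof.
pose A n := [set x : n.-tuple R | forall i, 0 < tnth x i < 2 * pi].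
have mA m : measurable (A m).
  rewrite (_ : A m = \bigcap_(i in [set: 'I_m]) ((fun x => tnth x i) @^-1` `]0, 2 * pi[%classic)).
    apply: fin_bigcap_measurable => // i _.
    by rewrite -[X in measurable X]setTI; apply: measurable_tnth.
  apply/seteqP; split => x /= h i.
    by move=> _; rewrite /= in_itv/= h.
  by have := h i I; rewrite /= in_itv.
suff PA : forall m, torus_measure m (A m) = 1%E.
  apply/negligibleP.
    by apply: measurableC; exact: mA.
  by have := probability_setC (torus_measure n) (mA n); rewrite PA subee.
elim=> [|m IH].
  rewrite /= diracE mem_set// => -[].
  by case.
rewrite /= /distribution /pushforward.
rewrite (_ : _ @^-1` _ = `]0, 2 * pi[%classic `*` A m).
  rewrite product_measure1E; last 2 first.
  - exact: measurable_itv.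
  - exact: mA.
  rewrite [X in (_ * X)%E](_ : _ = 1%E) ?mule1; last exact: IH.
  rewrite [LHS](_ : _ = \int[lebesgue_measure]_(x in `]0%R, (2 * pi)%R[%classic)
    (uniform_pdf 0 (2 * pi) x)%:E)%E//.
  rewrite integral_uniform_pdf setIidl; last first.
    by move=> a /=; rewrite !in_itv/= => /andP[/ltW -> /ltW ->].
  rewrite (eq_integral (fun=> (2 * pi - 0)^-1%:E)); last first.
    move=> a /set_mem/=; rewrite in_itv/= /uniform_pdf => /andP[/ltW -> /ltW ->].
    by [].
  rewrite integral_cst//= lebesgue_measure_itv/= lte_fin two_pi_gt0.
  by rewrite -EFinD -EFinM mulVf// subr0 gt_eqF// two_pi_gt0.
apply/seteqP; split => -[a x] /=.
  move=> h; split.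
    by have := h ord0; rewrite in_itv.
  by move=> i; have := h (lift ord0 i); rewrite tnthS.
rewrite in_itv/= => -[a0 h] i; have [j ->|->] := unliftP ord0 i.
  by rewrite tnthS; exact: h.
by rewrite tnth0.
Qed.

End torus_integral.

(** * Uniqueness of the Fourier coefficients *)

Section step_approximation.
Context {R : realType}.

(* [kuhn m] converges to the indicator function of [y < 1/2] on [0, 1]. *)
Definition kuhn (m : nat) (y : R) := (1 - y ^+ m) ^+ (m * 2 ^ m).

Lemma bernoulli (t : R) (N : nat) : t <= 1 -> 1 - N%:R * t <= (1 - t) ^+ N.
Proof.
move=> t1; elim: N => [|N IH]; first by rewrite mul0r subr0 expr0.
rewrite exprSr (@le_trans _ _ ((1 - N%:R * t) * (1 - t)))//.
  rewrite -subr_ge0 -natr1 (_ : _ - _ = N%:R * t ^+ 2); last by ring.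
  by rewrite mulr_ge0 ?sqr_ge0.
by rewrite ler_wpM2r// subr_ge0.
Qed.

Lemma kuhn_itv m y : 0 <= y <= 1 -> 0 <= kuhn m y <= 1.
Proof.
move=> /andP[y0 y1]; have ym : 0 <= y ^+ m <= 1.
  by rewrite exprn_ge0//= exprn_ile1.
by rewrite exprn_ge0 ?exprn_ile1//; lra.
Qed.

(** Write [r^m = s^m s^m] with [s = sqrt r]. Bernoulli's inequality for [(1/s)^m] keeps [m s^m]
    bounded by [K], and the other [s^m] tends to 0. *)
Lemma cvg_natmul_expr (r : R) : 0 <= r < 1 -> (fun m => m%:R * r ^+ m) @ \oo --> (0 : R).
Proof.
move=> /andP[r0 r1].
have [->|rn0] := eqVneq r 0.
  apply: cvg_near_cst; exists 1%N => // m /= m0.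
  by rewrite expr0n gtn_eqF// mulr0.
have rp : 0 < r by rewrite lt_def rn0.
pose s := Num.sqrt r.
have s0 : 0 < s by rewrite sqrtr_gt0.
have ss : r = s ^+ 2 by rewrite sqr_sqrtr// ltW.
have s1 : s < 1.
  by rewrite -(ltr_pXn2r (n := 2)) ?nnegrE ?(ltW s0)// -ss expr1n.
pose K := (s^-1 - 1)^-1.
have q0 : 0 < s^-1 - 1 by rewrite subr_gt0 invf_gt1.
apply: (@squeeze_cvgr _ _ _ _ (fun=> 0) (fun m => K * s ^+ m)).
- apply: nearW => m; rewrite mulr_ge0 ?exprn_ge0//=.
  rewrite ss -exprM mulnC exprM expr2 mulrA ler_wpM2r ?exprn_ge0 ?(ltW s0)//.
  rewrite /K -[leRHS]mul1r ler_pdivlMr// mulrAC.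
  have sm : 0 < s ^+ m by rewrite exprn_gt0.
  rewrite -ler_pdivlMr// mul1r.
  have si : 0 < s^-1 by rewrite invr_gt0.
  have h : - (s^-1 - 1) <= 1 by lra.
  have := bernoulli m h; rewrite mulrN !opprK [X in X ^+ _]addrC subrK exprVn.
  lra.
- exact: cvg_cst.
- rewrite -[X in _ --> X](mulr0 K); apply: cvgM; first exact: cvg_cst.
  by apply: cvg_expr; rewrite ger0_norm// ltW.
Qed.

(** Bernoulli's inequality gives [kuhn m y >= 1 - m 2^m y^m = 1 - m (2 y)^m], with [2 y < 1]. *)
Lemma kuhn_cvg1 y : 0 <= y < 1 / 2 -> (fun m => kuhn m y) @ \oo --> (1 : R).
Proof.
move=> /andP[y0 y2].
apply: (@squeeze_cvgr _ _ _ _ (fun m => 1 - m%:R * (2 * y) ^+ m) (fun=> 1)).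
- apply: nearW => m.
  have y1 : 0 <= y <= 1 by lra.
  have /andP[_ ->] := kuhn_itv m y1; rewrite andbT.
  have ym : y ^+ m <= 1 by rewrite exprn_ile1//; lra.
  rewrite (le_trans _ (bernoulli _ ym))// natrM natrX exprMn.
  by rewrite mulrA.
- rewrite -[X in _ --> X]subr0; apply: cvgB; first exact: cvg_cst.
  by apply: cvg_natmul_expr; lra.
- exact: cvg_cst.
Qed.

(** With [t = y^m] and [N = m 2^m]: [(1 - t)^N (1 + t)^N <= 1], while
    [(1 + t)^N >= 1 + N t >= m + 1] because [N t = m (2 y)^m] and [2 y >= 1]. *)
Lemma kuhn_cvg0 y : 1 / 2 <= y <= 1 -> (fun m => kuhn m y) @ \oo --> (0 : R).
Proof.
move=> /andP[y2 y1].
apply: (@squeeze_cvgr _ _ _ _ (fun=> 0) (fun m => m.+1%:R^-1)).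
- apply: nearW => m.
  have y01 : 0 <= y <= 1 by lra.
  have /andP[k0 _] := kuhn_itv m y01; rewrite k0/=.
  set t := y ^+ m.
  have t1 : 0 <= t <= 1 by rewrite /t exprn_ge0 ?exprn_ile1//; lra.
  rewrite -[leRHS]mul1r ler_pdivlMr//.
  apply: (@le_trans _ _ (kuhn m y * (1 + t) ^+ (m * 2 ^ m))).
    rewrite ler_wpM2l//.
    have ht : - t <= 1 by lra.
    have := bernoulli (m * 2 ^ m) ht; rewrite opprK mulrN opprK.
    apply: le_trans; rewrite -natr1 addrC lerD2l natrM natrX -mulrA -exprMn.
    by rewrite ler_peMr// exprn_ege1//; lra.
  rewrite /kuhn -/t -exprMn exprn_ile1//; nra.
- exact: cvg_cst.
- exact: cvg_harmonic.
Qed.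

End step_approximation.

(** * Real trigonometric polynomials and cuts of the cell *)

Section trigonometric_polynomials.
Context {R : realType} {n : nat}.
Implicit Types (g q : n.-tuple R -> R).
Local Notation P := (torus_measure n).

Definition trig g := exists s : seq (R[i] * 'rV[int]_n),
  forall x, (g x)%:C = \sum_(c <- s) c.1 * em c.2 x.

Lemma trig_cst c : trig (fun=> c).
Proof. by exists [:: (c%:C, 0)] => x; rewrite big_seq1 em0 mulr1. Qed.

Lemma trigD g q : trig g -> trig q -> trig (fun x => g x + q x).
Proof.
by move=> [s gs] [t qt]; exists (s ++ t) => x; rewrite rmorphD/= gs qt big_cat.
Qed.

Lemma trigM g q : trig g -> trig q -> trig (fun x => g x * q x).
Proof.
move=> [s gs] [t qt].
exists [seq (c.1 * e.1, c.2 + e.2) | c <- s, e <- t] => x.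
rewrite rmorphM/= gs qt big_allpairs_dep/= big_distrlr/=.
by apply: eq_bigr => c _; apply: eq_bigr => e _; rewrite /= emD; ring.
Qed.

Lemma trigX g m : trig g -> trig (fun x => g x ^+ m).
Proof.
move=> tg; elim: m => [|m IH]; first exact: trig_cst.
under eq_fun do rewrite exprS.
exact: trigM.
Qed.

Lemma trigB g q : trig g -> trig q -> trig (fun x => g x - q x).
Proof.
move=> tg tq; under eq_fun do rewrite -[- _]mulN1r.
by apply: trigD => //; apply: trigM => //; exact: trig_cst.
Qed.

Lemma freq_dot_delta (i : 'I_n) (x : n.-tuple R) :
  freq_dot (\row_j (j == i)%:R) x = tnth x i.
Proof.
rewrite /freq_dot (bigD1 i)//= mxE eqxx mul1r big1 ?addr0// => j /negbTE ji.
by rewrite mxE ji mul0r.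
Qed.

Lemma trig_cos (i : 'I_n) : trig (fun x => cos (tnth x i)).
Proof.
pose k : 'rV[int]_n := \row_j (j == i)%:R.
exists [:: (2^-1, k); (2^-1, - k)] => x.
rewrite big_cons big_seq1/= -em_J -mulrDr /em freq_dot_delta.
by apply: complex_eq; rewrite ?ReM ?ImM ?ReD ?ImD/=; field.
Qed.

Lemma trig_sin (i : 'I_n) : trig (fun x => sin (tnth x i)).
Proof.
pose k : 'rV[int]_n := \row_j (j == i)%:R.
exists [:: (- 'i / 2, k); ('i / 2, - k)] => x.
rewrite big_cons big_seq1/= -em_J /em freq_dot_delta.
by apply: complex_eq; rewrite ?ReM ?ImM ?ReD ?ImD/=; field.
Qed.

Lemma trig_measurable g : trig g -> measurable_fun setT g.
Proof.
move=> [s gs].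
have [m _] : cmeasurable (fun x => (g x)%:C).
  under eq_fun do rewrite gs.
  apply: cmeasurable_sum => c; apply: cmeasurableZ; exact: cmeasurable_em.
exact: m.
Qed.

Lemma trig_bounded g : trig g -> exists2 C, 0 < C & forall x, `|g x| <= C.
Proof.
move=> [s gs]; exists (\sum_(c <- s) nc c.1 + 1).
  by rewrite ltr_wpDl// sumr_ge0// => c _; exact: nc_ge0.
move=> x; rewrite -nc_real gs (le_trans (nc_sum _ _))//.
rewrite (@le_trans _ _ (\sum_(c <- s) nc c.1))// ?lerDl//.
by apply: ler_sum => c _; rewrite ncM nc_em mulr1.
Qed.

(* The cell is cut at a coordinate value [c] by the sign of
   [cos (x_i - c/2) - cos (c/2) = 2 sin (x_i/2) sin ((c - x_i)/2)]. *)
Lemma trig_cut (i : 'I_n) (c : R) : exists2 q, trig q &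
  forall x, 0 < tnth x i < 2 * pi -> (0 < q x) = (tnth x i < c).
Proof.
have [c0|c0] := lerP c 0.
  exists (fun=> -1); first exact: trig_cst.
  move=> x /andP[x0 _]; rewrite ltr0N1; apply/esym/negbTE; rewrite -leNgt.
  by rewrite (le_trans c0)// ltW.
have [c1|c1] := lerP (2 * pi) c.
  exists (fun=> 1); first exact: trig_cst.
  by move=> x /andP[_ x1]; rewrite ltr01 (lt_le_trans x1 c1).
exists (fun x => cos (tnth x i) * cos (c / 2) + sin (tnth x i) * sin (c / 2) - cos (c / 2)).
  apply: trigB; last exact: trig_cst.
  by apply: trigD; apply: trigM; first [exact: trig_cst|exact: trig_cos|exact: trig_sin].
move=> x; move: (tnth x i) => y /andP[y0 y1].
have -> : cos y * cos (c / 2) + sin y * sin (c / 2) - cos (c / 2) =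
    2 * sin (y / 2) * sin ((c - y) / 2).
  have -> : (c - y) / 2 = c / 2 - y / 2 by field.
  rewrite sinB; set a := y / 2; set b := c / 2.
  have -> : y = a + a by rewrite /a; field.
  rewrite cosD sinD.
  have := cos2Dsin2 a; set C := cos a; set S := sin a => h.
  have -> : C * C = 1 - S * S by rewrite -!expr2 -h; ring.
  by ring.
have sy : 0 < sin (y / 2) by apply: sin_gt0_pi; rewrite divr_gt0//= ltr_pdivrMr// mulrC.
rewrite pmulr_rgt0 ?mulr_gt0//.
have [yc|cy] := ltP y c.
  rewrite sin_gt0_pi// divr_gt0 ?subr_gt0//= ltr_pdivrMr// mulrC; lra.
apply/negbTE; rewrite -leNgt.
rewrite (_ : (c - y) / 2 = - ((y - c) / 2)); last by field.
rewrite sinN oppr_le0 sin_ge0_pi// divr_ge0 ?subr_ge0//= ler_pdivrMr// mulrC; lra.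
Qed.

End trigonometric_polynomials.

(** * Functions orthogonal to all trigonometric polynomials *)

Section fourier_uniqueness.
Context {R : realType} {n : nat}.
Local Notation P := (torus_measure n).
Implicit Types (g q phi h : n.-tuple R -> R).

Definition cutset (s : seq ('I_n * R)) : set (n.-tuple R) :=
  [set x | all (fun p => tnth x p.1 < p.2) s].

(** A pi-system that generates the measurable sets: intersections of half-spaces are concatenations
    of lists. *)
Definition cutsets : set (set (n.-tuple R)) := [set A | exists s, A = cutset s].

Lemma cutset_cons p s : cutset (p :: s) = [set x | tnth x p.1 < p.2] `&` cutset s.
Proof. by apply/seteqP; split=> x /=; [move=> /andP|move=> [? ?]; apply/andP]. Qed.

Lemma measurable_cutset s : measurable (cutset s).
Proof.
elim: s => [|p s IH].
  by rewrite (_ : cutset _ = setT)//; apply/seteqP; split.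
rewrite cutset_cons; apply: measurableI => //.
rewrite (_ : [set x | _] = (fun x => tnth x p.1) @^-1` `]-oo, p.2[%classic).
  by rewrite -[X in measurable X]setTI; apply: measurable_tnth.
by apply/seteqP; split=> x /=; rewrite in_itv.
Qed.

Lemma cutsets_setI : setI_closed cutsets.
Proof.
move=> _ _ [s ->] [t ->]; exists (s ++ t); rewrite /cutset.
by apply/seteqP; split=> x /=; rewrite all_cat; [move=> [-> ->]|move=> /andP].
Qed.

(** The nontrivial inclusion says that the identity is measurable from the generated sigma-algebra;
    this is tested on one coordinate and one half-line at a time. *)
Lemma cutsets_measurableE : @measurable _ (n.-tuple R) = <<s cutsets >>.
Proof.
apply/seteqP; split; last first.
  apply: smallest_sub; first exact: sigma_algebra_measurable.
  by move=> _ [s ->]; exact: measurable_cutset.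
have : measurable_fun setT (id : g_sigma_algebraType cutsets -> n.-tuple R).
  apply/measurable_fun_tnthP => i.
  apply: (measurability _ (RGenInftyO.measurableE R)).
  move=> _ [_ [c ->] <-]; rewrite setTI.
  apply: sub_sigma_algebra; exists [:: (i, c)].
  by apply/seteqP; split=> x; rewrite /cutset/= in_itv/= andbT.
move=> mid A mA; have := mid measurableT A mA.
by rewrite setTI.
Qed.

Section annihilator.
Variable h : n.-tuple R -> R.
Hypothesis ih : P.-integrable setT (EFin \o h).
Hypothesis h0 : forall g, trig g -> (\int[P]_x (h x * g x)%:E = 0)%E.

(** The invariant of the induction on cuts: [h * phi] is orthogonal to every trigonometric
    polynomial, not just to constants, so that a further cut can be applied. Boundedness of [phi]
    serves dominated convergence. *)
Definition annih phi := [/\ measurable_fun setT phi,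
  exists C, forall x, `|phi x| <= C &
  forall g, trig g -> (\int[P]_x (h x * (phi x * g x))%:E = 0)%E].

Let mh : measurable_fun setT h.
Proof. by apply/measurable_EFinP; exact: (measurable_int P). Qed.

(** [y] rescales [q] into [[0, 1]] with [0 < q] exactly when [y < 1/2]. The functions [kuhn m] of
    [y] are trigonometric polynomials that converge boundedly to the indicator, so dominated
    convergence passes the orthogonality to the limit. *)
Lemma annih_step phi q : annih phi -> trig q ->
  annih (fun x => phi x * (if 0 < q x then 1 else 0)).
Proof.
move=> [mphi [C phiC] phi0] tq.
have [B B0 qB] := trig_bounded tq.
pose y x := 1 / 2 - (2 * B)^-1 * q x.
have ty : trig y by apply: trigB; [exact: trig_cst|apply: trigM => //; exact: trig_cst].
have B2 : 0 < 2 * B by rewrite mulr_gt0.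
have yI x : 0 <= y x <= 1.
  have : `|(2 * B)^-1 * q x| <= 1 / 2.
    rewrite normrM ger0_norm ?invr_ge0 ?(ltW B2)// mulrC ler_pdivrMr//.
    by rewrite (le_trans (qB x))//; lra.
  by rewrite /y ler_norml => /andP[]; move: (_ * q x) => z; lra.
pose k m x := kuhn m (y x).
have tk m : trig (k m) by apply: trigX; apply: trigB; [exact: trig_cst|exact: trigX].
have k1 m x : `|k m x| <= 1.
  by have /andP[a b] := kuhn_itv m (yI x); rewrite ger0_norm.
pose I x : R := if 0 < q x then 1 else 0.
have kI x : (fun m => k m x) @ \oo --> I x.
  rewrite /I; have yx : (y x < 1 / 2) = (0 < q x).
    by rewrite /y gtrBl pmulr_rgt0// invr_gt0.
  have /andP[y0 y1] := yI x.
  case: ifP; rewrite -yx => hy.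
    by apply: kuhn_cvg1; rewrite y0.
  by apply: kuhn_cvg0; rewrite y1 leNgt hy.
have I1 x : `|I x| <= 1 by rewrite /I; case: ifP; rewrite ?normr1 ?normr0.
have mI : measurable_fun setT I.
  apply: measurable_fun_ifT => //.
  exact: measurable_fun_ltr (measurable_cst _) (trig_measurable tq).
have C0 : 0 <= C by apply: le_trans (phiC [tuple 0 | i < n]).
split.
- exact: measurable_funM.
- by exists C => x; rewrite normrM -[leRHS]mulr1 ler_pM//; exact: I1.
move=> g tg; have [G G0 gG] := trig_bounded tg.
have mg := trig_measurable tg.
pose F m x := (h x * (phi x * (k m x * g x)))%:E.
pose Fl x := (h x * (phi x * I x * g x))%:E.
pose D x := (C * G * `|h x|)%:E.
have iD : P.-integrable setT D.
  have := integrableZl measurableT (C * G) (integrable_norm ih).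
  by apply: eq_integrable.
have [|||||_ _] := @dominated_convergence _ _ _ P setT measurableT F Fl D.
- move=> m; apply/measurable_EFinP; apply: measurable_funM => //.
  apply: measurable_funM => //; apply: measurable_funM => //.
  exact: trig_measurable.
- apply/measurable_EFinP; apply: measurable_funM => //.
  by apply: measurable_funM => //; exact: measurable_funM.
- apply/nearW => x _; apply/cvg_EFin; first exact: nearW.
  apply: cvgM; first exact: cvg_cst.
  under eq_fun do rewrite mulrA.
  apply: cvgM; last exact: cvg_cst.
  by apply: cvgM; [exact: cvg_cst|exact: kI].
- exact: iD.
- apply/nearW => x m _; rewrite /F /D abse_EFin lee_fin.
  rewrite normrM mulrC ler_wpM2r// normrM ler_pM// normrM -[leRHS]mul1r ler_pM//.
rewrite (_ : [sequence _]_m = fun=> 0%E) => [c0|].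
  have := cvg_unique _ c0 (cvg_cst _).
  by apply.
apply/funext => m /=; rewrite /F; apply: phi0.
exact: trigM.
Qed.

Lemma annih_cutset (s : seq ('I_n * R)) : exists2 phi, annih phi &
  forall x, (forall i, 0 < tnth x i < 2 * pi) ->
    phi x = if all (fun p => tnth x p.1 < p.2) s then 1 else 0.
Proof.
elim: s => [|p s [phi aphi phiE]].
  exists (fun=> 1) => //; split; [exact: measurable_cst|by exists 1 => x; rewrite normr1|].
  by move=> g tg; under eq_integral do rewrite mul1r; exact: h0.
have [q tq qE] := trig_cut p.1 p.2.
exists (fun x => phi x * (if 0 < q x then 1 else 0)); first exact: annih_step.
move=> x xc /=; rewrite phiE// qE//.
by case: (_ < _); rewrite /= ?mulr1 ?mulr0//; case: ifP.
Qed.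

Lemma integral_cutset s : (\int[P]_(x in cutset s) (h x)%:E = 0)%E.
Proof.
have [phi [mphi [C phiC] phi0] phiE] := annih_cutset s.
rewrite -(phi0 (fun=> 1) (trig_cst 1)) integral_mkcond.
apply: ae_eq_integral => //.
- apply/(measurable_restrictT _ (measurable_cutset s)).
  by apply: measurable_funTS; exact/measurable_EFinP.
- apply/measurable_EFinP; apply: measurable_funM => //.
  by apply: measurable_funM => //; exact: measurable_cst.
apply: filterS (torus_cell_ae n) => x xc _.
rewrite patchE phiE//= mulr1.
case: ifP => xs; first by rewrite ifT ?mulr1//; exact: (set_mem xs).
rewrite ifF ?mulr0//; apply/negbTE/negP => hx.
by move/negP: (negbT xs); apply; apply/mem_set.
Qed.

(** The sets over which [h] integrates to 0 form a Dynkin system that contains the pi-system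
    [cutsets], hence all measurable sets. *)
Lemma annihilator_ae0 : {ae P, forall x, h x = 0}.
Proof.
have D A : measurable A -> (\int[P]_(x in A) (h x)%:E = 0)%E.
  rewrite cutsets_measurableE; move: A.
  have setT0 : (\int[P]_(x in setT) (h x)%:E = 0)%E.
    have := integral_cutset [::]; rewrite (_ : cutset _ = setT)//.
    by apply/seteqP; split.
  apply: (dynkin_induction cutsets_measurableE cutsets_setI) => //.
  - by move=> _ [s ->]; exact: integral_cutset.
  - move=> S mS S0.
    have := setT0; rewrite -(setUv S) integral_setU//; last 3 first.
    - exact: measurableC.
    - by rewrite setUv; exact/measurable_EFinP.
    - by apply/disj_setPS; rewrite setICr.
    by rewrite S0 add0e.
  - move=> F mF tF F0; rewrite integral_bigcup//; last first.
      apply: integrableS ih => //; exact: bigcup_measurable.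
    by apply: eseries0 => i _ _; exact: F0.
have := @integral_ae_eq _ _ _ P setT measurableT (cst 0%E) (EFin \o h) ih.
move=> H; have {H} := H (measurable_cst _).
have HH E : E `<=` setT -> measurable E ->
    (\int[P]_(x in E) (EFin \o h) x = \int[P]_(x in E) cst 0 x)%E.
  by move=> _ mE; rewrite [LHS]D// integral0.
move=> /(_ HH); apply: filterS => x /= /(_ I).
by move=> [].
Qed.

End annihilator.

(** The coefficients of the conjugate are the conjugates of those of [f] at the opposite
    frequencies, so they vanish too. Real and imaginary part are combinations of [f] and its
    conjugate, which reduces the claim to real functions. *)
Theorem fourier_uniqueness (f : n.-tuple R -> R[i]) : cintegrable P f ->
  (forall k, cint P (fun x => f x * em k x) = 0) -> {ae P, forall x, f x = 0}.
Proof.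
move=> intf f0.
have real (h : n.-tuple R -> R) : P.-integrable setT (EFin \o h) ->
    (forall k, cint P (fun x => (h x)%:C * em k x) = 0) -> {ae P, forall x, h x = 0}.
  move=> ih hk; apply: annihilator_ae0 => // g tg.
  have ihC : cintegrable P (fun x => (h x)%:C).
    split => //; exact: finite_measure_integrable_cst.
  have [s gs] := tg.
  have [C C0 gC] := trig_bounded tg.
  have hg0 : cint P (fun x => (h x)%:C * (g x)%:C) = 0.
    under cint_ext do rewrite gs mulr_sumr.
    rewrite (cint_ext _ (g := fun x => \sum_(c <- s) c.1 * ((h x)%:C * em c.2 x))); last first.
      by move=> x; apply: eq_bigr => c _; rewrite mulrCA.
    have ie k := cintegrable_em k ihC.
    rewrite cint_sum => [|c]; last exact: cintegrableZ.
    by rewrite big1// => c _; rewrite cintZ// hk mulr0.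
  have /= hg := congr1 (@complex.Re R) hg0.
  have ihg : P.-integrable setT (EFin \o (fun x => h x * g x)).
    exact: RintegrableM (trig_measurable tg) gC.
  have := hg; rewrite (_ : _ \o _ = fun x => h x * g x); last first.
    by apply/funext => x /=; rewrite mul0r subr0.
  rewrite /Rintegral => fh.
  by rewrite -[LHS]fineK ?fh//; exact: integrable_fin_num.
have fJ k : cint P (fun x => conjc (f x) * em k x) = 0.
  have -> : (fun x => conjc (f x) * em k x) = (fun x => (f x * em (- k) x)^*).
    by apply/funext => x; rewrite rmorphM; congr (_ * _); rewrite -[RHS]/(conjc (em (- k) x)) em_J opprK.
  by rewrite cint_conj ?f0 ?conjc0//; exact: cintegrable_em.
have [fR fI] := intf.
have aR : {ae P, forall x, complex.Re (f x) = 0}.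
  apply: (real _ fR) => k.
  rewrite (cint_ext _ (g := fun x => 2^-1 * (f x * em k x + conjc (f x) * em k x))); last first.
    by move=> x; rewrite ReJ_add; ring.
  have i1 := cintegrable_em k intf; have i2 := cintegrable_em k (cintegrable_conj intf).
  by rewrite cintZ ?cintD ?f0 ?fJ ?addr0 ?mulr0//; exact: cintegrableD.
have aI : {ae P, forall x, complex.Im (f x) = 0}.
  apply: (real _ fI) => k.
  rewrite (cint_ext _ (g := fun x => ('i%C / 2) * (conjc (f x) * em k x + (- 1) * (f x * em k x)))); last first.
    by move=> x; rewrite ImJ_sub; ring.
  have i1 := cintegrable_em k intf; have i2 := cintegrable_em k (cintegrable_conj intf).
  have i3 := cintegrableZ (-1) i1.
  rewrite cintZ ?cintD ?(cintZ _ i1) ?f0 ?fJ ?mulr0 ?addr0 ?mulr0//.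
  exact: cintegrableD.
apply: filterS2 aR aI => x; case: (f x) => a b /= -> ->.
by [].
Qed.

End fourier_uniqueness.

(** * Fourier series of functions *)

Section fourier_series.
Context {R : realType} {d : nat}.
Local Notation Z := 'rV[int]_d.
Local Notation T := (d.-tuple R).
Local Notation P := (@torus_measure R d).
Implicit Types (u v : T -> R[i]) (a b : Z -> R[i]).

Lemma fourier_coefE u k : fourier_coef u k = cint P (fun x => u x * em (- k) x).
Proof.
by apply: complex_eq; apply: eq_Rintegral => x _; rewrite /= cexp_Ni /em freq_dotN.
Qed.

Lemma fourier_coefD u v : cintegrable P u -> cintegrable P v ->
  fourier_coef (fun x => u x + v x) = fun k => fourier_coef u k + fourier_coef v k.
Proof.
move=> iu iv; apply/funext => k; rewrite !fourier_coefE -cintD; try exact: cintegrable_em.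
by apply: cint_ext => x; rewrite mulrDl.
Qed.

Lemma fourier_coefZ z u : cintegrable P u ->
  fourier_coef (fun x => z * u x) = fun k => z * fourier_coef u k.
Proof.
move=> iu; apply/funext => k; rewrite !fourier_coefE -cintZ; try exact: cintegrable_em.
by apply: cint_ext => x; rewrite mulrA.
Qed.

Lemma fourier_coef_conj u : cintegrable P u ->
  fourier_coef (cconj u) = cjs (fourier_coef u).
Proof.
move=> iu; apply/funext => k; rewrite /cjs !fourier_coefE opprK -cint_conj; try exact: cintegrable_em.
by apply: cint_ext => x; rewrite /cconj rmorphM -[X in _ = _ * X]/(conjc (em k x)) em_J.
Qed.

Lemma fourier_coef_ae u v : cintegrable P u -> cintegrable P v ->
  {ae P, forall x, u x = v x} -> fourier_coef u = fourier_coef v.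
Proof.
move=> iu iv uv; apply/funext => k; rewrite !fourier_coefE.
apply: cint_ae; [exact: cintegrable_em|exact: cintegrable_em|].
by apply: filterS uv => x ->.
Qed.

Definition synth a : T -> R[i] := fun x => csum_freq (fun k => a k * em k x).

Lemma nc_term a (x : T) k : nc (a k * em k x) = nc (a k).
Proof. by rewrite ncM nc_em mulr1. Qed.

Lemma l1_term a A (x : T) : l1 a A -> l1 (fun k => a k * em k x) A.
Proof. by apply: l1_le => k; rewrite nc_term. Qed.

Lemma synth_le a A x : l1 a A -> nc (synth a x) <= A.
Proof. by move=> aA; exact: csum_le (l1_term x aA). Qed.

Lemma synth_tail a A : l1 a A -> forall e, 0 < e -> exists s0 : seq Z, uniq s0 /\
  forall s, uniq s -> {subset s0 <= s} -> forall x,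
    nc (synth a x - \sum_(k <- s) a k * em k x) <= e.
Proof.
move=> aA e e0; have [s0 [us0 h0]] := csum_tail aA e0.
exists s0; split=> // s us ss x; apply: h0 => // k.
by rewrite nc_term.
Qed.

(** The series converges along finite sets rather than along a sequence. Choosing finite sets with
    uniform error [1 / (m + 1)] exhibits it as a limit of a sequence of measurable functions. *)
Lemma cmeasurable_synth a A : l1 a A -> cmeasurable (synth a).
Proof.
move=> aA.
have /choice[s hs] : forall m : nat, exists s : seq Z, forall x,
    nc (synth a x - \sum_(k <- s) a k * em k x) <= m.+1%:R^-1.
  move=> m; have m0 : 0 < m.+1%:R^-1 :> R by [].
  by have [s0 [us0 h0]] := synth_tail aA m0; exists s0; exact: h0.
pose F m x := \sum_(k <- s m) a k * em k x.
have mF m : cmeasurable (F m).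
  apply: cmeasurable_sum => k; apply: cmeasurableZ; exact: cmeasurable_em.
have cvgF (g : nat -> R) (l : R) : (forall m, `|g m - l| <= m.+1%:R^-1) -> g @ \oo --> l.
  move=> gl; apply/cvgrPdist_le => e e0.
  have /cvgrPdist_le/(_ e e0) : (fun m => m.+1%:R^-1) @ \oo --> (0 : R) by exact: cvg_harmonic.
  apply: filterS => m; rewrite sub0r normrN ger0_norm// distrC.
  exact: le_trans.
have mp (p : R[i] -> R) : (forall z w, p (z - w) = p z - p w) ->
    (forall z, `|p z| <= nc z) -> (forall m, measurable_fun setT (p \o F m)) ->
    measurable_fun setT (p \o synth a).
  move=> pB pn pF; apply: (measurable_fun_cvg pF) => x _; apply: cvgF => m.
  by rewrite distrC (le_trans _ (hs m x))//= -pB.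
split; apply: mp => [[? ?] [? ?]|z|m]//; try by have [] := mF m.
- exact: nc_Re.
- exact: nc_Im.
Qed.

Lemma synth_periodic a : Defs.periodic (synth a).
Proof.
move=> x i; congr csum_freq; apply/funext => k; congr (_ * _).
rewrite /em -(ei_periodic (freq_dot k x) (k ord0 i)); congr ei.
rewrite /freq_dot (bigD1 i)//= [in RHS](bigD1 i)//= tnth_mktuple eqxx mulrDr.
rewrite addrAC; congr (_ + _ + _); apply: eq_bigr => j /negbTE ji.
by rewrite tnth_mktuple ji addr0.
Qed.

(** The partial sums converge uniformly and [v] is integrable, so sum and integral commute. In
    [e / (2 * V + 1)] the 2 is that of [cint_le], and the 1 covers [V = 0]. *)
Lemma cint_synthM a A v : l1 a A -> cintegrable P v ->
  cint P (fun x => synth a x * v x) = csum_freq (fun k => a k * cint P (fun x => em k x * v x)).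
Proof.
move=> aA iv.
have iev k : cintegrable P (fun x => em k x * v x).
  by under eq_fun do rewrite mulrC; exact: cintegrable_em.
have inv := cintegrable_nc iv.
set V := Rintegral P setT (fun x => nc (v x)).
have V0 : 0 <= V by apply: Rintegral_ge0 => x _; exact: nc_ge0.
have ms := cmeasurable_synth aA.
have lV : l1 (fun k => a k * cint P (fun x => em k x * v x)) (2 * V * A).
  move=> s us; rewrite (@le_trans _ _ (\sum_(k <- s) 2 * V * nc (a k)))//.
    apply: ler_sum => k _; rewrite ncM mulrC ler_wpM2r ?nc_ge0//.
    by apply: cint_le => // x; rewrite ncM nc_em mul1r.
  by rewrite -mulr_sumr ler_wpM2l ?mulr_ge0 ?aA.
apply/esym; apply: (csum_unique lV) => e e0.
have e1 : 0 < e / (2 * V + 1) by rewrite divr_gt0// ltr_wpDl// mulr_ge0.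
have [s0 [us0 h0]] := synth_tail aA e1.
exists s0 => s us ss.
have iterm k := cintegrableZ (a k) (iev k).
have isv : cintegrable P (fun x => synth a x * v x).
  under eq_fun do rewrite mulrC.
  by apply: (cintegrableM iv ms (C := A)) => x; exact: synth_le.
have -> : \sum_(k <- s) a k * cint P (fun x => em k x * v x) =
    cint P (fun x => \sum_(k <- s) a k * (em k x * v x)).
  by rewrite cint_sum//; apply: eq_bigr => k _; rewrite cintZ.
rewrite -(ncN (_ - _)) opprB -[X in nc (_ + X)]mulN1r -cintZ; last exact: cintegrable_sum.
rewrite -cintD//; last by apply: cintegrableZ; exact: cintegrable_sum.
rewrite (cint_ext _ (g := fun x => (synth a x - \sum_(k <- s) a k * em k x) * v x)); last first.
  move=> x; rewrite mulN1r mulrBl mulr_suml; congr (_ - _).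
  by apply: eq_bigr => k _; rewrite mulrA.
have mm : cmeasurable (fun x => (synth a x - \sum_(k <- s) a k * em k x) * v x).
  apply: cmeasurableM; last exact: cintegrable_meas iv.
  apply: cmeasurableD => //; under eq_fun do rewrite -mulN1r.
  apply: cmeasurableM; first exact: cmeasurable_cst.
  apply: cmeasurable_sum => k; apply: cmeasurableZ; exact: cmeasurable_em.
have iE := integrableZl measurableT (e / (2 * V + 1)) inv.
rewrite (le_trans (cint_le _ iE _))//.
- by apply: (cintegrable_dom mm iE) => x; rewrite ncM ler_wpM2r ?nc_ge0// h0.
- by move=> x; rewrite ncM ler_wpM2r ?nc_ge0// h0.
- rewrite RintegralZl// -/V mulrCA -mulrA ger_pMr// mulrC ler_pdivrMr ?mul1r ?lerDl//.
  by rewrite ltr_wpDl// mulr_ge0.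
Qed.

(** Only one factor is an absolutely convergent series, the other is merely integrable. In [repM] it
    is therefore enough to replace one factor by its series. *)
Lemma fourier_coef_synthM a A v : l1 a A -> cintegrable P v ->
  fourier_coef (fun x => synth a x * v x) = fconv a (fourier_coef v).
Proof.
move=> aA iv; apply/funext => k; rewrite fourier_coefE.
rewrite (cint_ext _ (g := fun x => synth a x * (v x * em (- k) x))); last first.
  by move=> x; rewrite mulrA.
rewrite (cint_synthM aA (cintegrable_em _ iv)); congr csum_freq.
apply/funext => p; rewrite fourier_coefE; congr (_ * _); apply: cint_ext => x.
by rewrite mulrCA -emD opprB.
Qed.

Lemma fourier_coef_synth a A : l1 a A -> fourier_coef (synth a) = a.
Proof.
move=> aA; apply/funext => k.
have i1 : cintegrable P (fun=> 1).
  by apply: (@cintegrable_bounded _ _ _ _ _ 1); [exact: cmeasurable_cst|move=> x; rewrite nc1].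
have := fourier_coef_synthM aA i1.
under [X in fourier_coef X]eq_fun do rewrite mulr1.
move=> ->; rewrite /fconv.
have E (q : Z) : fourier_coef (fun _ : T => 1 : R[i]) q = (q == 0)%:R.
  rewrite fourier_coefE -oppr_eq0 -cint_em; apply: cint_ext => x.
  by rewrite mul1r.
have l1a : l1 (fun p => a p * fourier_coef (fun _ : T => 1 : R[i]) (k - p)) A.
  apply: (l1_le _ aA) => p; rewrite E ncM; case: eqP => _.
    by rewrite nc1 mulr1.
  by rewrite nc0 mulr0 nc_ge0.
apply: (csum_unique l1a) => e e0; exists [:: k] => s us ks.
rewrite (bigD1_seq k) ?ks ?mem_seq1//= E subrr eqxx mulr1 big1 ?addr0 ?subrr ?nc0 ?ltW//.
by move=> p pk; rewrite E subr_eq0 eq_sym (negbTE pk) mulr0.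
Qed.

Lemma torus_L2_cintegrable u : torus_L2 u -> cintegrable P u.
Proof.
move=> [_ mR mI u2].
have mu2 : measurable_fun setT (fun x => nc (u x) ^+ 2).
  exact: measurable_funX (cmeasurable_nc (conj mR mI)).
have i2 : P.-integrable setT (EFin \o (fun x => 1 + nc (u x) ^+ 2)).
  apply: RintegrableD; first exact: finite_measure_integrable_cst.
  apply/integrableP; split; first exact/measurable_EFinP.
  by under eq_integral do rewrite /= ger0_norm ?sqr_ge0//.
apply: (cintegrable_dom (conj mR mI) i2) => x.
by have := sqr_ge0 (nc (u x) - 1); have := nc_ge0 (u x); nra.
Qed.

Lemma torus_L2_bounded u C : Defs.periodic u -> cmeasurable u -> (forall x, nc (u x) <= C) ->
  torus_L2 u.
Proof.
move=> pu [mR mI] uC; split=> //.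
have C0 : 0 <= C by apply: le_trans (nc_ge0 _) (uC [tuple 0 | i < d]).
apply: (@le_lt_trans _ _ (\int[P]_x (C ^+ 2)%:E)%E).
  apply: ge0_le_integral => //.
  - by move=> x _; rewrite lee_fin sqr_ge0.
  - apply/measurable_EFinP.
    exact: measurable_funX (cmeasurable_nc (conj mR mI)).
  - by move=> x _; rewrite lee_fin lerXn2r ?nnegrE ?nc_ge0.
rewrite integral_cst// [X in (_ * X)%E](_ : _ = 1%E); first by rewrite mule1 ltry.
exact: probability_setT.
Qed.

Lemma torus_L2_dom u v C : Defs.periodic u -> cmeasurable u -> torus_L2 v -> 0 <= C ->
  {ae P, forall x, nc (u x) <= C * nc (v x)} -> torus_L2 u.
Proof.
move=> pu [mR mI] [_ vR vI v2] C0 uv; split=> //.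
have mu := measurable_funX 2 (cmeasurable_nc (conj mR mI)).
have mv := measurable_funX 2 (cmeasurable_nc (conj vR vI)).
apply: (@le_lt_trans _ _ (\int[P]_x ((C ^+ 2)%:E * (nc (v x) ^+ 2)%:E))%E).
  apply: ae_ge0_le_integral => //.
  - by move=> x _; rewrite lee_fin sqr_ge0.
  - exact/measurable_EFinP.
  - by move=> x _; rewrite -EFinM lee_fin mulr_ge0// sqr_ge0.
  - by apply/measurable_EFinP; apply: measurable_funM.
  - apply: filterS uv => x ux _; rewrite -EFinM lee_fin -exprMn.
    by rewrite lerXn2r ?nnegrE ?mulr_ge0 ?nc_ge0.
rewrite ge0_integralZl//; [|exact/measurable_EFinP|by move=> x _; rewrite lee_fin sqr_ge0|].
- by rewrite lte_mul_pinfty// lee_fin sqr_ge0.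
- by rewrite lee_fin sqr_ge0.
Qed.

Lemma torus_L2D u v : torus_L2 u -> torus_L2 v -> torus_L2 (fun x => u x + v x).
Proof.
move=> [pu uR uI u2] [pv vR vI v2].
have mu := measurable_funX 2 (cmeasurable_nc (conj uR uI)).
have mv := measurable_funX 2 (cmeasurable_nc (conj vR vI)).
have [wR wI] := cmeasurableD (conj uR uI) (conj vR vI).
have mw := measurable_funX 2 (cmeasurable_nc (conj wR wI)).
split=> //; first by move=> x i; rewrite pu pv.
apply: (@le_lt_trans _ _ (\int[P]_x (2%:E * ((nc (u x) ^+ 2)%:E + (nc (v x) ^+ 2)%:E)))%E).
  apply: ge0_le_integral => //.
  - by move=> x _; rewrite lee_fin sqr_ge0.
  - exact/measurable_EFinP.
  - apply/measurable_EFinP; apply: measurable_funM; first exact: measurable_cst.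
    exact: measurable_funD.
  - move=> x _; rewrite -EFinD -EFinM lee_fin.
    apply: (@le_trans _ _ ((nc (u x) + nc (v x)) ^+ 2)).
      by rewrite lerXn2r ?nnegrE ?addr_ge0 ?nc_ge0 ?ncD.
    by have := sqr_ge0 (nc (u x) - nc (v x)); nra.
have nn (f : T -> R[i]) x : (0 <= (nc (f x) ^+ 2)%:E)%E by rewrite lee_fin sqr_ge0.
rewrite ge0_integralZl//; last 2 first.
- by apply: emeasurable_funD; exact/measurable_EFinP.
- by move=> x _; rewrite adde_ge0.
rewrite ge0_integralD//; try exact/measurable_EFinP.
by rewrite lte_mul_pinfty// lte_add_pinfty.
Qed.

(** The uniqueness theorem enters here: [u] and its Fourier series are integrable with the same
    coefficients. *)
Lemma synth_ae u A : torus_L2 u -> l1 (fourier_coef u) A ->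
  {ae P, forall x, u x = synth (fourier_coef u) x}.
Proof.
move=> u2 uA; have iu := torus_L2_cintegrable u2.
have is_ : cintegrable P (synth (fourier_coef u)).
  by apply: (cintegrable_bounded _ (cmeasurable_synth uA)) => x; exact: synth_le uA.
have is' := cintegrableZ (-1) is_.
have id := cintegrableD iu is'.
have := fourier_uniqueness id.
have h k : cint P (fun x => (u x + -1 * synth (fourier_coef u) x) * em k x) = 0.
  rewrite -(opprK k) -fourier_coefE fourier_coefD// fourier_coefZ//.
  by rewrite (fourier_coef_synth uA) mulN1r subrr.
move=> /(_ h); apply: filterS => x; rewrite mulN1r => /eqP.
by rewrite subr_eq0 => /eqP.
Qed.

Section sobolev_functions.
Variables (alpha K : R).
Hypothesis bdl1 : forall a A, bd alpha a A -> l1 a (K * A).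
Hypothesis bdfconv : forall a b A B, bd alpha a A -> bd alpha b B ->
  bd alpha (fconv a b) (K * (A * B)).

(** A function and its coefficients side by side. Each operation of the scheme preserves this
    relation, so the scheme on functions is shadowed by the one on sequences; [torus_L2] also
    records the periodicity that [sobolev] asks for. *)
Definition rep u a := [/\ torus_L2 u, fourier_coef u = a & exists B, bd alpha a B].

Lemma repD u v a b : rep u a -> rep v b ->
  rep (fun x => u x + v x) (fun k => a k + b k).
Proof.
move=> [u2 ua [A aA]] [v2 vb [B bB]]; split; first exact: torus_L2D.
- by rewrite fourier_coefD ?ua ?vb//; exact: torus_L2_cintegrable.
- by exists (A + B); exact: bdD.
Qed.

Lemma repZ z u a : rep u a -> rep (fun x => z * u x) (fun k => z * a k).
Proof.
move=> [u2 ua [A aA]]; have iu := torus_L2_cintegrable u2; split.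
- apply: (torus_L2_dom (C := nc z) _ _ u2).
  + by have [pu _ _ _] := u2; move=> x i; rewrite pu.
  + by apply: cmeasurableM; [exact: cmeasurable_cst|exact: (cintegrable_meas iu)].
  + exact: nc_ge0.
  + by apply: nearW => x; rewrite ncM.
- by rewrite fourier_coefZ ?ua.
- by exists (nc z * A); apply: bdM; rewrite ?nc_ge0.
Qed.

Lemma repB u v a b : rep u a -> rep v b ->
  rep (fun x => u x - v x) (fun k => a k - b k).
Proof.
move=> ra rb; have := repD ra (repZ (-1) rb).
under eq_fun do rewrite mulN1r.
by under [X in rep _ X]eq_fun do rewrite mulN1r.
Qed.

Lemma rep_conj u a : rep u a -> rep (cconj u) (cjs a).
Proof.
move=> [u2 ua [A aA]]; have iu := torus_L2_cintegrable u2; split.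
- apply: (torus_L2_dom (C := 1) _ _ u2) => //.
  + by have [pu _ _ _] := u2; move=> x i; rewrite /cconj pu.
  + exact: cmeasurable_conj (cintegrable_meas iu).
  + by apply: nearW => x; rewrite /cconj ncJ mul1r.
- by rewrite fourier_coef_conj ?ua.
- by exists A; exact: bd_cjs.
Qed.

(** Almost everywhere [u] equals its series, which is bounded by [K * A]: hence the product is
    square integrable and its coefficients are a convolution. *)
Lemma repM u v a b : rep u a -> rep v b -> rep (fun x => u x * v x) (fconv a b).
Proof.
move=> [u2 ua [A aA]] [v2 vb [B bB]].
have iu := torus_L2_cintegrable u2; have iv := torus_L2_cintegrable v2.
have lA := bdl1 aA.
have uE : {ae P, forall x, u x = synth a x} by rewrite -ua in lA *; exact: synth_ae lA.
have w2 : torus_L2 (fun x => u x * v x).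
  apply: (torus_L2_dom (C := K * A) _ _ v2).
  + by have [pu _ _ _] := u2; have [pv _ _ _] := v2; move=> x i; rewrite pu pv.
  + by apply: cmeasurableM; [exact: (cintegrable_meas iu)|exact: (cintegrable_meas iv)].
  + exact: l1_ge0 lA.
  + apply: filterS uE => x ->; rewrite ncM ler_wpM2r ?nc_ge0//.
    exact: synth_le.
split=> //; last by exists (K * (A * B)); exact: bdfconv.
rewrite (fourier_coef_ae (v := fun x => synth a x * v x) (torus_L2_cintegrable w2)).
- by rewrite (fourier_coef_synthM lA iv) vb.
- under eq_fun do rewrite mulrC.
  by apply: (cintegrableM iv (cmeasurable_synth lA) (C := K * A)) => x; exact: synth_le.
- by apply: filterS uE => x ->.
Qed.

Lemma rep_laplacian (f : R -> R[i]) C u a : (forall k : Z, nc (f (- freq_sqnorm k)) <= C) ->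
  rep u a -> rep (laplacian_fun f u) (fun k => f (- freq_sqnorm k) * a k).
Proof.
move=> fC [u2 ua [A aA]].
have C0 : 0 <= C by apply: le_trans (nc_ge0 _) (fC 0).
have fa := bdM C0 fC aA.
have lf := bdl1 fa.
have -> : laplacian_fun f u = synth (fun k => f (- freq_sqnorm k) * a k).
  apply/funext => x; congr csum_freq; apply/funext => k.
  by rewrite ua cexp_i.
split; last by exists (C * A).
- apply: (torus_L2_bounded (synth_periodic _) (cmeasurable_synth lf)) => x.
  exact: synth_le lf.
- exact: fourier_coef_synth lf.
Qed.

End sobolev_functions.

Lemma sobolev_norm_coef_le s a B : 0 <= B ->
  (sobolev_norm_coef s a <= B%:E)%E <-> bd s a B.
Proof.
move=> B0.
have n0 k : (0 <= (weight k `^ s * nc (a k) ^+ 2)%:E)%E.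
  by rewrite lee_fin mulr_ge0 ?powR_ge0 ?sqr_ge0.
rewrite /sobolev_norm_coef -/weight.
set S := (\esum_(k in setT) _)%E.
have S0 : (0 <= S)%E by apply: esum_ge0 => k _; exact: n0.
have -> : (sqrte S <= B%:E)%E = (S <= (B ^+ 2)%:E)%E.
  have BE : (B%:E = sqrte (B ^+ 2)%:E)%E.
    by rewrite EFin_expe sqrte_sqr gee0_abs// lee_fin.
  by rewrite BE lee_sqrt// lee_fin sqr_ge0.
split.
  move=> SB; split=> // F uF; rewrite -lee_fin -sumEFin (le_trans _ SB)//.
  by apply: ereal_sup_ubound; exists [set` F]; [split=> //; exact: finite_seq|rewrite -fsbig_seq].
move=> [_ aB]; have h : forall F : seq Z, uniq F ->
    (\sum_(k <- F) (weight k `^ s * nc (a k) ^+ 2)%:E <= (B ^+ 2)%:E)%E.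
  by move=> F uF; rewrite sumEFin lee_fin aB.
have [S' [SS _ SB _]] := esum_approx n0 h.
by rewrite /S SS lee_fin.
Qed.

End fourier_series.

(** * Mean value inequality and oscillatory integrals *)

Section mean_value.
Context {R : realType}.
Implicit Types (a b e x y B : R) (D : R -> Prop).

(** Continuous induction: the supremum of the points up to which the bound with slope [B + e] holds
    is itself such a point, and it cannot lie before [b]. As [f] need not be differentiable, the
    statement applies to norms along a curve. *)
Lemma lipschitz_of_local (f : R -> R) a b B : a <= b ->
  (forall x, a <= x <= b -> forall e, 0 < e -> exists2 dl, 0 < dl &
    forall y, a <= y <= b -> `|y - x| < dl -> `|f y - f x| <= (B + e) * `|y - x|) ->
  `|f b - f a| <= B * (b - a).
Proof.
move=> ab loc; apply/ler_addgt0Pl => e0 e0p.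
pose e := e0 / (b - a + 1).
have ba1 : 0 < b - a + 1 by rewrite ltr_wpDl// subr_ge0.
have ep : 0 < e by rewrite divr_gt0.
pose A := [set x | a <= x <= b /\ `|f x - f a| <= (B + e) * (x - a)]%classic.
have Aa : A a by split; [rewrite lexx|rewrite !subrr normr0 mulr0].
have ubA : ubound A b by move=> x [/andP[]].
have supA : has_sup A by split; [exists a|exists b].
pose s := sup A.
have sb : s <= b by apply: ge_sup ubA; exists a.
have as_ : a <= s by apply: ub_le_sup => //; exists b.
have asb : a <= s <= b by rewrite as_.
have [dl dl0 hdl] := loc s asb e ep.
have As : A s.
  split=> //; have [x Ax sx] := sup_adherent dl0 supA.
  have [xab hx] := Ax; have xs : x <= s by apply: ub_le_sup => //; exists b.
  have hd : `|x - s| < dl by rewrite distrC ger0_norm ?subr_ge0// ltrBlDr -ltrBlDl.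
  have := hdl x xab hd; rewrite distrC [X in _ * X]distrC [X in _ * X]ger0_norm ?subr_ge0// => h.
  rewrite (_ : f s - f a = (f s - f x) + (f x - f a)); last by ring.
  by rewrite (le_trans (ler_normD _ _))// (le_trans (lerD h hx))// -mulrDr addrA subrK.
have sbE : s = b.
  apply/eqP; rewrite eq_le sb leNgt; apply/negP => sltb.
  pose y := Num.min b (s + dl / 2).
  have dl2 : 0 < dl / 2 by rewrite divr_gt0.
  have sy : s < y by rewrite lt_min sltb ltrDl.
  have yb : y <= b by rewrite ge_min lexx.
  have yab : a <= y <= b by rewrite yb (le_trans as_ (ltW sy)).
  have ysd : y - s <= dl / 2 by rewrite lerBlDl ge_min lexx orbT.
  have hd : `|y - s| < dl.
    by rewrite ger0_norm ?subr_ge0 ?(ltW sy)// (le_lt_trans ysd)// ltr_pdivrMr// ltr_pMr// ltr1n.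
  have Ay : A y.
    split=> //; have := hdl y yab hd; rewrite [X in _ * X]ger0_norm ?subr_ge0 ?(ltW sy)// => h.
    have [_ hs] := As.
    rewrite (_ : f y - f a = (f y - f s) + (f s - f a)); last by ring.
    by rewrite (le_trans (ler_normD _ _))// (le_trans (lerD h hs))// -mulrDr addrA subrK.
  have : y <= s by apply: ub_le_sup => //; exists b.
  by rewrite leNgt sy.
have [_] := As; rewrite sbE => /le_trans; apply.
rewrite mulrDl addrC lerD2r /e mulrAC ler_pdivrMr// ler_wpM2l ?(ltW e0p)//.
by rewrite lerDl.
Qed.

(* The derivative at the points of [D], along [D]. *)
Definition cder D (f g : R -> R[i]) := forall x, D x -> forall e, 0 < e ->
  exists2 dl, 0 < dl & forall y, D y -> `|y - x| < dl ->
    nc (f y - f x - (y - x)%:C * g x) <= e * `|y - x|.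

Lemma cder_cst D z : cder D (fun=> z) (fun=> 0).
Proof.
move=> x _ e e0; exists 1 => // y _ _.
by rewrite subrr mulr0 subrr nc0 mulr_ge0 ?(ltW e0).
Qed.

Lemma cder_id D : cder D (fun x => x%:C) (fun=> 1).
Proof.
move=> x _ e e0; exists 1 => // y _ _.
by rewrite mulr1 rmorphB/= subrr nc0 mulr_ge0 ?(ltW e0).
Qed.

Lemma cderD D f g f' g' : cder D f f' -> cder D g g' ->
  cder D (fun x => f x + g x) (fun x => f' x + g' x).
Proof.
move=> df dg x Dx e e0; have e2 : 0 < e / 2 by rewrite divr_gt0.
have [d1 d10 h1] := df x Dx _ e2; have [d2 d20 h2] := dg x Dx _ e2.
exists (Num.min d1 d2); first by rewrite lt_min d10.
move=> y Dy; rewrite lt_min => /andP[y1 y2].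
rewrite (_ : _ - _ = (f y - f x - (y - x)%:C * f' x) + (g y - g x - (y - x)%:C * g' x)); last by ring.
rewrite (le_trans (ncD _ _))// (le_trans (lerD (h1 y Dy y1) (h2 y Dy y2)))//.
by rewrite -mulrDl -splitr.
Qed.

Lemma cder_continuous D f f' : cder D f f' -> forall x, D x -> forall e, 0 < e ->
  exists2 dl, 0 < dl & forall y, D y -> `|y - x| < dl -> nc (f y - f x) <= e.
Proof.
move=> df x Dx e e0; have [d1 d10 h1] := df x Dx 1 ltr01.
pose c := 1 + nc (f' x); have c0 : 0 < c by rewrite ltr_pwDl// nc_ge0.
exists (Num.min d1 (e / c)); first by rewrite lt_min d10 divr_gt0.
move=> y Dy; rewrite lt_min => /andP[y1 y2].
rewrite (_ : f y - f x = (f y - f x - (y - x)%:C * f' x) + (y - x)%:C * f' x); last by ring.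
rewrite (le_trans (ncD _ _))// (le_trans (lerD (h1 y Dy y1) (lexx _)))//.
rewrite ncM nc_real [_ * nc _]mulrC -mulrDl -/c mulrC -ler_pdivlMr//.
exact: ltW.
Qed.

Lemma cderM D f g f' g' : cder D f f' -> cder D g g' ->
  cder D (fun x => f x * g x) (fun x => f' x * g x + f x * g' x).
Proof.
move=> df dg x Dx e e0.
pose c := nc (g x) + nc (f x) + 1 + nc (f' x).
have c0 : 0 < c by rewrite /c -addrA addrCA -addrA ltr_pwDl// !addr_ge0// nc_ge0.
pose e1 := Num.min 1 (e / (2 * c)).
have e10 : 0 < e1 by rewrite lt_min ltr01 divr_gt0// mulr_gt0.
have [d1 d10 h1] := df x Dx _ e10; have [d2 d20 h2] := dg x Dx _ e10.
have [d3 d30 h3] := cder_continuous dg Dx e10.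
exists (Num.min d1 (Num.min d2 d3)); first by rewrite !lt_min d10 d20.
move=> y Dy; rewrite !lt_min => /andP[y1 /andP[y2 y3]].
have {h1} := h1 y Dy y1; have {h2} := h2 y Dy y2; have {h3} := h3 y Dy y3.
set t := `|y - x|; have t0 : 0 <= t by exact: normr_ge0.
set p := g y - g x; set q := _ - _ - _ => hp hq.
set r := _ - _ - _ => hr.
(* The remainder of the product rule splits into four terms, each at most [e1 * t] times one summand
   of [c]. *)
rewrite (_ : _ - _ = r * g x + f x * q + r * p + (y - x)%:C * f' x * p); last first.
  by rewrite /r /q /p; ring.
rewrite (le_trans (ncD _ _))// (le_trans (lerD (ncD _ _) (lexx _)))//.
rewrite (le_trans (lerD (lerD (ncD _ _) (lexx _)) (lexx _)))//.
rewrite !ncM nc_real -/t.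
have e1c : e1 * c <= e.
  have : e1 <= e / (2 * c) by rewrite ge_min lexx orbT.
  move=> /(ler_wpM2r (ltW c0)) /le_trans; apply.
  have -> : e / (2 * c) * c = e / 2 by field; rewrite gt_eqF.
  lra.
have e11 : e1 <= 1 by rewrite ge_min lexx.
have G := nc_ge0 (g x); have Fx := nc_ge0 (f x); have F' := nc_ge0 (f' x).
have ra := nc_ge0 r; have qa := nc_ge0 q; have pa := nc_ge0 p.
have hq' : nc q <= e1 * t := hq.
have b1 : nc r * nc (g x) <= e1 * t * nc (g x) by rewrite ler_wpM2r.
have b2 : nc (f x) * nc q <= e1 * t * nc (f x) by rewrite mulrC ler_wpM2r.
have b3 : nc r * nc p <= e1 * t * 1.
  by rewrite ler_pM// (le_trans hp).
have b4 : t * nc (f' x) * nc p <= e1 * t * nc (f' x).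
  by rewrite mulrC mulrA ler_wpM2r// ler_wpM2r.
rewrite (le_trans (lerD (lerD (lerD b1 b2) b3) b4))//.
rewrite -!mulrDr -/c mulrAC ler_wpM2r//.
Qed.

Lemma cderZ D z f f' : cder D f f' -> cder D (fun x => z * f x) (fun x => z * f' x).
Proof.
move=> df; have := cderM (@cder_cst D z) df.
by under [X in cder _ _ X]eq_fun do rewrite mul0r add0r.
Qed.

Lemma cder_sub D D' f f' : (forall x, D' x -> D x) -> cder D f f' -> cder D' f f'.
Proof.
move=> DD df x Dx e e0; have [dl dl0 h] := df x (DD x Dx) e e0.
by exists dl => // y Dy; exact: h (DD y Dy).
Qed.

Lemma cder_ext D f g f' g' : f =1 g -> (forall x, D x -> f' x = g' x) ->
  cder D f f' -> cder D g g'.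
Proof.
move=> fg fg' df x Dx e e0; have [dl dl0 h] := df x Dx e e0.
by exists dl => // y Dy yx; rewrite -!fg -fg'// h.
Qed.

(** The condition [|z| = 1] leaves [dl] unchanged; the cases used are translation, [z = 1], and time
    reversal, [z = -1]. *)
Lemma cder_comp D (c : R) (z : R) f f' : `|z| = 1 -> cder D f f' ->
  cder (fun x => D (c + z * x)) (fun x => f (c + z * x)) (fun x => z%:C * f' (c + z * x)).
Proof.
move=> z1 df x Dx e e0; have [dl dl0 h] := df _ Dx e e0.
exists dl => // y Dy yx; have E : (c + z * y) - (c + z * x) = z * (y - x) by ring.
have := h _ Dy; rewrite E normrM z1 mul1r => /(_ yx).
by rewrite rmorphM/= mulrA [(y - x)%:C * _]mulrC.
Qed.

Lemma nc_mean_value (f f' : R -> R[i]) a b B : a <= b ->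
  cder (fun x => a <= x <= b) f f' -> (forall x, a <= x <= b -> nc (f' x) <= B) ->
  nc (f b - f a) <= B * (b - a).
Proof.
move=> ab df fB.
have := @lipschitz_of_local (fun x => nc (f x - f a)) a b B ab.
rewrite /= subrr nc0 subr0 ger0_norm ?nc_ge0//; apply=> x xab e e0.
have [dl dl0 h] := df x xab e e0; exists dl => // y yab yx.
rewrite (le_trans (nc_distl _ _))//.
rewrite (_ : _ - _ = (f y - f x - (y - x)%:C * f' x) + (y - x)%:C * f' x); last by ring.
rewrite (le_trans (ncD _ _))// mulrDl addrC lerD// ?h//.
by rewrite ncM nc_real mulrC ler_wpM2r// fB.
Qed.

Lemma nc_mean_value_sym (D : R -> Prop) (f f' : R -> R[i]) x y B :
  (forall z, Num.min x y <= z <= Num.max x y -> D z) ->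
  cder D f f' -> (forall z, Num.min x y <= z <= Num.max x y -> nc (f' z) <= B) ->
  nc (f y - f x) <= B * `|y - x|.
Proof.
have [xy|/ltW yx] := lerP x y => DD df fB.
  by apply: nc_mean_value fB => //; exact: cder_sub df.
rewrite -ncN opprB; apply: nc_mean_value fB => //.
exact: cder_sub df.
Qed.

Context {d : nat}.
Local Notation Z := 'rV[int]_d.

Lemma wnorm_le_sup s (F : seq Z) (u : Z -> R[i]) e : 0 <= e ->
  (forall k, k \in F -> nc (u k) <= e) ->
  wnorm s F u <= (\sum_(k <- F) weight k `^ s + 1) * e.
Proof.
move=> e0 ue; set W := \sum_(_ <- _) _.
have W0 : 0 <= W by rewrite sumr_ge0// => k _; exact: powR_ge0.
rewrite wnorm_le ?mulr_ge0 ?addr_ge0//.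
rewrite (@le_trans _ _ (W * e ^+ 2))//.
  rewrite mulr_suml big_seq [leRHS]big_seq ler_sum// => k kF.
  by rewrite ler_wpM2l ?powR_ge0// lerXn2r ?nnegrE ?nc_ge0// ue.
by rewrite exprMn ler_wpM2r ?sqr_ge0//; nra.
Qed.

Lemma wnormN s F (u : Z -> R[i]) : wnorm s F (fun k => - u k) = wnorm s F u.
Proof. by congr Num.sqrt; apply: eq_bigr => k _; rewrite ncN. Qed.

Lemma wnorm_distl s F (u v : Z -> R[i]) :
  `|wnorm s F u - wnorm s F v| <= wnorm s F (fun k => u k - v k).
Proof.
rewrite ler_norml; apply/andP; split.
  rewrite lerNl opprB lerBlDr -(wnormN _ _ (fun k => u k - v k)) .
  rewrite (le_trans _ (wnormD _ _ _ _))//; apply: le_of_eq.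
  by congr (wnorm _ _ _); apply/funext => k; ring.
rewrite lerBlDr (le_trans _ (wnormD _ _ _ _))//; apply: le_of_eq.
by congr (wnorm _ _ _); apply/funext => k; rewrite subrK.
Qed.

(* Coefficientwise differentiability suffices: test against finitely many
   coefficients. *)
Lemma bd_mean_value s (E G : R -> Z -> R[i]) a b B : a <= b ->
  (forall k, cder (fun x => a <= x <= b) (fun x => E x k) (fun x => G x k)) ->
  (forall x, a <= x <= b -> bd s (G x) B) ->
  bd s (fun k => E b k - E a k) (B * (b - a)).
Proof.
move=> ab dE GB.
have B0 : 0 <= B by apply: bd_ge0 (GB a _); rewrite lexx.
apply: wnorm_bd => [|F uF]; first by rewrite mulr_ge0// subr_ge0.
have := @lipschitz_of_local (fun x => wnorm s F (fun k => E x k - E a k)) a b B ab.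
have wa : wnorm s F (fun k => E a k - E a k) = 0.
  apply/eqP; rewrite sqrtr_eq0 big1// => k _.
  by rewrite subrr nc0 expr0n mulr0.
rewrite /= wa subr0 ger0_norm ?wnorm_ge0//; apply=> x xab e e0.
pose W : R := \sum_(k <- F) weight k `^ s + 1.
have W0 : 0 < W by rewrite ltr_wpDl// sumr_ge0// => k _; exact: powR_ge0.
have eW : 0 < e / W by rewrite divr_gt0.
have [dl dl0 h] : exists2 dl, 0 < dl & forall y, a <= y <= b -> `|y - x| < dl ->
    forall k, k \in F -> nc (E y k - E x k - (y - x)%:C * G x k) <= e / W * `|y - x|.
  elim: (F) => [|k F' [dl dl0 IH]]; first by exists 1.
  have [dl' dl'0 h'] := dE k x xab _ eW.
  exists (Num.min dl dl'); first by rewrite lt_min dl0.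
  move=> y yab; rewrite lt_min => /andP[y1 y2] l; rewrite in_cons => /orP[/eqP ->|lF].
    exact: h'.
  exact: IH.
exists dl => // y yab yx.
rewrite (le_trans (wnorm_distl _ _ _ _))//.
have -> : (fun k => E y k - E a k - (E x k - E a k)) =
    fun k => (y - x)%:C * G x k + (E y k - E x k - (y - x)%:C * G x k).
  by apply/funext => k; ring.
rewrite (le_trans (wnormD _ _ _ _))// mulrDl lerD//.
  apply: bd_wnorm => //; rewrite mulrC; apply: bdM => //.
    by move=> k; rewrite nc_real.
  exact: GB.
rewrite (le_trans (wnorm_le_sup s _ (h y yab yx)))//.
  by rewrite mulr_ge0 ?(ltW eW).
by rewrite -/W mulrA [W * _]mulrC divfK// gt_eqF.
Qed.

End mean_value.

(** * Taylor bounds for [e^(i y)] and its primitives [phi1], [phi2] *)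

Section oscillatory_scalars.
Context {R : realType}.
Implicit Types (x y s lam th : R) (D : R -> Prop).

Lemma abs_sin_le y : `|sin y| <= `|y|.
Proof.
wlog y0 : y / 0 <= y.
  move=> H; have [/H//|/ltW y0] := lerP 0 y.
  by have := H (- y); rewrite oppr_ge0 sinN !normrN; apply.
have [|c _] := @MVT_segment R sin cos 0 y y0 (fun x _ => is_derive_sin x).
  by apply: continuous_subspaceT; exact: continuous_sin.
rewrite sin0 !subr0 => ->; rewrite normrM ler_piMl//.
by rewrite ler_norml cos_geN1 cos_le1.
Qed.

Lemma cosB1 y : 1 - cos y = 2 * sin (y / 2) ^+ 2.
Proof.
rewrite {1}(_ : y = y / 2 + y / 2); last by field.
by rewrite cosD; have := cos2Dsin2 (y / 2); rewrite !expr2; lra.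
Qed.

Lemma cosB1_ge0 y : 0 <= 1 - cos y.
Proof. by rewrite subr_ge0 cos_le1. Qed.

Lemma abs_cosB1 y : `|1 - cos y| <= y ^+ 2 / 2.
Proof.
rewrite ger0_norm ?cosB1_ge0// cosB1.
have : `|sin (y / 2)| ^+ 2 <= `|y / 2| ^+ 2 by rewrite lerXn2r ?nnegrE ?abs_sin_le.
by rewrite !real_normK ?num_real// expr_div_n; lra.
Qed.

Lemma abs_cosB1_lin y : `|1 - cos y| <= `|y|.
Proof.
rewrite ger0_norm ?cosB1_ge0// cosB1.
have h := abs_sin_le (y / 2); have h1 := normr_ge0 (sin (y / 2)).
have h2 : `|sin (y / 2)| <= 1 by rewrite ler_norml sin_geN1 sin_le1.
rewrite -(real_normK (num_real (sin (y / 2)))).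
rewrite normrM [ `|2^-1|]ger0_norm// in h.
nra.
Qed.

Lemma abs_sinB y : `|sin y - y| <= y ^+ 2.
Proof.
wlog y0 : y / 0 <= y.
  move=> H; have [/H//|/ltW y0] := lerP 0 y.
  by have := H (- y); rewrite oppr_ge0 sinN sqrrN -opprD normrN; apply.
have [|c] := @MVT_segment R sin cos 0 y y0 (fun x _ => is_derive_sin x).
  by apply: continuous_subspaceT; exact: continuous_sin.
rewrite inE/= => /andP[c0 cy]; rewrite sin0 !subr0 => ->.
rewrite -{2}[y]mul1r -mulrBl normrM expr2 distrC ler_pM//.
  by rewrite (le_trans (abs_cosB1_lin c))// ger0_norm.
by rewrite ger0_norm.
Qed.

Lemma nc_eiB1 y : nc (ei y - 1) <= `|y|.
Proof.
rewrite -(ler_pXn2r (n := 2)) ?nnegrE ?nc_ge0// nc_sqr/= real_normK ?num_real//.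
have := abs_cosB1 y; rewrite ler_norml => /andP[_]; have := cos2Dsin2 y.
by move: (cos y) (sin y) => a b; nra.
Qed.

Lemma nc_eiB_taylor y : nc (ei y - 1 - 'i * y%:C) <= 2 * y ^+ 2.
Proof.
rewrite -complexiE.
have -> : ei y - 1 - 'i%C * y%:C = (cos y - 1) +i* (sin y - y).
  by apply: complex_eq; rewrite /=; ring.
rewrite (le_trans (nc_ReIm _))//= distrC mulr_natl mulr2n lerD ?abs_sinB//.
by rewrite (le_trans (abs_cosB1 y))// ler_pdivrMr// ler_peMr ?sqr_ge0// ler1n.
Qed.

(** The chord and the exponential have the same first order Taylor polynomial at 0, so only two
    second order remainders of size at most [2 y^2] survive. *)
Lemma nc_ei_interp th y : 0 <= th <= 1 ->
  nc (ei (th * y) - (1 - th)%:C - th%:C * ei y) <= 4 * y ^+ 2.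
Proof.
move=> /andP[t0 t1].
rewrite (_ : _ - _ = (ei (th * y) - 1 - 'i * (th * y)%:C) -
   th%:C * (ei y - 1 - 'i * y%:C)); last by rewrite rmorphB rmorphM/=; ring.
rewrite (le_trans (ncB _ _))// ncM nc_real ger0_norm//.
have h1 := nc_eiB_taylor (th * y); have h2 := nc_eiB_taylor y.
have y2 := sqr_ge0 y.
have h3 : th * nc (ei y - 1 - 'i * y%:C) <= 1 * (2 * y ^+ 2).
  by rewrite ler_pM// nc_ge0.
have h4 : (th * y) ^+ 2 <= y ^+ 2 by rewrite exprMn ler_piMl// expr_le1.
lra.
Qed.

Lemma nc_eiB x y : nc (ei y - ei x) <= `|y - x|.
Proof.
rewrite (_ : ei y - ei x = ei x * (ei (y - x) - 1)); last first.
  by rewrite mulrBr mulr1 -eiD [x + _]addrC subrK.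
by rewrite ncM nc_ei mul1r nc_eiB1.
Qed.

Lemma cder_ei D th : cder D (fun s => ei (s * th)) (fun s => 'i * th%:C * ei (s * th)).
Proof.
move=> x _ e e0; pose c := 2 * th ^+ 2 + 1.
have c0 : 0 < c by rewrite ltr_wpDl// mulr_ge0 ?sqr_ge0.
exists (e / c); first exact: divr_gt0.
move=> y _ yx.
rewrite (_ : _ - _ = ei (x * th) * (ei ((y - x) * th) - 1 - 'i * ((y - x) * th)%:C)); last first.
  rewrite (_ : y * th = x * th + (y - x) * th); last by ring.
  by rewrite eiD rmorphM/=; ring.
rewrite ncM nc_ei mul1r (le_trans (nc_eiB_taylor _))//.
rewrite exprMn -[(y - x) ^+ 2]real_normK ?num_real//.
have t0 := normr_ge0 (y - x); move: yx; set t := `|y - x| => yx.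
have : t * c <= e by rewrite -ler_pdivlMr// ltW.
move=> /(ler_wpM2r t0); apply: le_trans.
rewrite (_ : t * c * t = 2 * (t ^+ 2 * th ^+ 2) + t ^+ 2); last by rewrite /c; ring.
by rewrite lerDl sqr_ge0.
Qed.

(* [int_0^s e^(i r lam) dr] and [int_0^s r e^(i r lam) dr]. *)
Definition osc0 lam s : R[i] := s%:C * phi1 ('i * (s * lam)%:C).
Definition osc1 lam s : R[i] := (s%:C) ^+ 2 * phi2 ('i * (s * lam)%:C).

Lemma i_neq0 : 'i%R != 0 :> R[i].
Proof. by rewrite -complexiE; apply/eqP => /(congr1 (@complex.Im R)) /= /eqP; rewrite oner_eq0. Qed.

Lemma iR_neq0 y : y != 0 -> 'i * y%:C != 0.
Proof.
move=> y0; by rewrite mulf_neq0 ?i_neq0 ?realC_neq0.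
Qed.

Lemma osc0_0 lam : osc0 lam 0 = 0. Proof. by rewrite /osc0 mul0r. Qed.
Lemma osc1_0 lam : osc1 lam 0 = 0. Proof. by rewrite /osc1 expr0n mul0r. Qed.

Lemma osc0E lam s : lam != 0 -> osc0 lam s = ('i * lam%:C)^-1 * (ei (s * lam) - 1).
Proof.
move=> l0; have [->|s0] := eqVneq s 0.
  by rewrite osc0_0 mul0r ei0 subrr mulr0.
have sl : s * lam != 0 by rewrite mulf_neq0.
rewrite /osc0 /phi1 (negbTE (iR_neq0 sl)) cexp_i rmorphM/=.
by field; rewrite !realC_neq0// i_neq0.
Qed.

Lemma osc1E lam s : lam != 0 ->
  osc1 lam s = ('i * lam%:C)^-1 * (s%:C * ei (s * lam) - osc0 lam s).
Proof.
move=> l0; have [->|s0] := eqVneq s 0.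
  by rewrite osc1_0 osc0_0 mul0r subrr mulr0.
have sl : s * lam != 0 by rewrite mulf_neq0.
rewrite /osc1 /osc0 /phi2 (negbTE (iR_neq0 sl)) cexp_i; set p := phi1 _.
rewrite rmorphM/=.
by field; rewrite !realC_neq0// i_neq0.
Qed.

(** At [lam = 0] the value [phi1 0 = 1] makes the primitive equal to [s]; in the next lemma
    [phi2 0 = 1/2] makes it [s^2 / 2]. Elsewhere the closed forms are differentiated. *)
Lemma cder_osc0 D lam : cder D (osc0 lam) (fun s => ei (s * lam)).
Proof.
have [->|l0] := eqVneq lam 0.
  apply: cder_ext _ _ (@cder_id R D) => s; last by rewrite mulr0 ei0.
  by rewrite /osc0 mulr0 mulr0 /phi1 eqxx mulr1.
apply: cder_ext _ _ (cderZ ('i * lam%:C)^-1 (cderD (@cder_ei D lam) (@cder_cst R D (-1)))) => s.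
  by rewrite osc0E.
by move=> _; rewrite addr0 mulrA mulVf ?mul1r// iR_neq0.
Qed.

Lemma cder_osc1 D lam : cder D (osc1 lam) (fun s => s%:C * ei (s * lam)).
Proof.
have [->|l0] := eqVneq lam 0.
  apply: cder_ext _ _ (cderZ 2^-1 (cderM (@cder_id R D) (@cder_id R D))) => s.
    by rewrite /osc1 mulr0 mulr0 /phi2 eqxx mulrC expr2.
  by move=> _; rewrite mulr0 ei0; field.
have h := cderZ ('i * lam%:C)^-1 (cderD (cderM (@cder_id R D) (@cder_ei D lam))
   (cderZ (-1) (@cder_osc0 D lam))).
apply: (cder_ext _ _ h) => s.
  by rewrite osc1E// mulN1r.
by move=> _; have := iR_neq0 l0; set z := 'i * lam%:C => z0; field.
Qed.

(** [phi1 (i y)] is the value at 1 of the primitive [osc0 y], which vanishes at 0 and has a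
    derivative of modulus 1. *)
Lemma nc_phi1_le y : nc (phi1 ('i * y%:C)) <= 1.
Proof.
have := nc_mean_value (f := osc0 y) (B := 1) ler01 (cder_osc0 y).
rewrite osc0_0 !subr0 mulr1 /osc0 !mul1r; apply => s _.
by rewrite nc_ei.
Qed.

Lemma nc_phi2_le y : nc (phi2 ('i * y%:C)) <= 1.
Proof.
have := nc_mean_value (f := osc1 y) (B := 1) ler01 (cder_osc1 y).
rewrite osc1_0 !subr0 mulr1 /osc1 expr1n !mul1r; apply => s /andP[s0 s1].
by rewrite ncM nc_ei mulr1 nc_real ger0_norm.
Qed.

Lemma nc_phi1B1 y : nc (phi1 ('i * y%:C) - 1) <= `|y|.
Proof.
pose D s := 0 <= s <= 1.
have := nc_mean_value (B := `|y|) ler01 (cderD (cder_osc0 (D := D) y) (cderZ (-1) (@cder_id R D))).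
rewrite /= osc0_0 /osc0 !mul1r rmorph0 rmorph1 !mulN1r oppr0 addr0 !subr0 mulr1; apply => s /andP[s0 s1].
by rewrite ?mulN1r (le_trans (nc_eiB1 _))// normrM ger0_norm// ler_piMl.
Qed.

Lemma cder_taylor (f g : R -> R[i]) (a b L x y : R) :
  cder (fun s => a <= s <= b) f g -> a <= x <= b -> a <= y <= b ->
  (forall s, a <= s <= b -> nc (g s - g x) <= L * `|s - x|) -> 0 <= L ->
  nc (f y - f x - (y - x)%:C * g x) <= L * `|y - x| ^+ 2.
Proof.
move=> df xab yab gL L0.
have dh := cderD df (cderZ (- g x) (@cder_id R (fun s => a <= s <= b))).
have sub : forall z, Num.min x y <= z <= Num.max x y -> a <= z <= b.
  move=> z /andP[z1 z2]; case/andP: xab => ax xb; case/andP: yab => ay yb.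
  rewrite (le_trans _ z1) ?le_min ?ax//= (le_trans z2)// ge_max xb.
  by [].
have := nc_mean_value_sym (B := L * `|y - x|) sub dh.
rewrite expr2 mulrA.
rewrite (_ : f y + - g x * y%:C - _ = f y - f x - (y - x)%:C * g x); last first.
  by rewrite rmorphB/=; ring.
apply=> z zxy; rewrite mulr1 (le_trans (gL z (sub z zxy)))// ler_wpM2l//.
move: zxy; have [xy|yx] := lerP x y => /andP[z1 z2]; rewrite ler_norml; apply/andP; split; lra.
Qed.

End oscillatory_scalars.

(** * The trilinear interaction *)

Section trilinear.
Context {R : realType} {d : nat}.
Local Notation Z := 'rV[int]_d.
Implicit Types (a b c : Z -> R[i]) (s A B C t : R).

(* [H^s] is an algebra of absolutely summable sequences. *)
Definition algebra_const s K := [/\ 0 < K,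
  forall a A, bd s a A -> l1 a (K * A) &
  forall a b A B, bd s a A -> bd s b B -> bd s (fconv a b) (K * (A * B))].

Lemma algebra_const_le s K K' : K <= K' -> algebra_const s K -> algebra_const s K'.
Proof.
move=> KK [K0 h1 h2]; split; first exact: lt_le_trans KK.
- move=> a A aA F uF; rewrite (le_trans (h1 _ _ aA F uF))// ler_wpM2r//.
  exact: bd_ge0 aA.
- move=> a b A B aA bB; apply: bd_le (h2 _ _ _ _ aA bB).
  by rewrite ler_wpM2r// mulr_ge0 ?(bd_ge0 aA) ?(bd_ge0 bB).
Qed.

(* The coefficients of [e^(i t Delta) u]. *)
Definition S t a : Z -> R[i] := fun k => ei (- (t * freq_sqnorm k)) * a k.

Definition N3 a b c := fconv (fconv a b) c.

Definition Theta t a b c := S (- t) (N3 (S t a) (S t b) (S t c)).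

Lemma bd_S s t a A : bd s a A -> bd s (S t a) A.
Proof. by apply: bd_dom => k; rewrite ncM nc_ei mul1r. Qed.

Lemma SD t t' a : S t (S t' a) = S (t + t') a.
Proof. by apply/funext => k; rewrite /S mulrA -eiD; congr (ei _ * _); ring. Qed.

Lemma S0 a : S 0 a = a.
Proof. by apply/funext => k; rewrite /S mul0r oppr0 ei0 mul1r. Qed.

Lemma bd_SB s t a A : bd (s + 2) a A -> bd s (fun k => S t a k - a k) (`|t| * A).
Proof.
move=> aA; have := bdM2 (normr_ge0 t) _ aA.
move=> /(_ (fun k => ei (- (t * freq_sqnorm k)) - 1)) H.
apply: bd_eq (H _) => k; first by rewrite mulrBl mul1r.
rewrite (le_trans (nc_eiB1 _))// normrN normrM ler_wpM2l//.
by rewrite ger0_norm ?freq_sqnorm_ge0// lerDr.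
Qed.

(** Majorants for convolutions, here and in [wab]: moduli of the coefficients, without and with the
    weight, which is the symbol of [1 - Delta]. *)
Definition ab a : Z -> R[i] := fun k => `|a k|.
Definition wab a : Z -> R[i] := fun k => (weight k)%:C * `|a k|.

Lemma nc_abs (z : R[i]) : nc `|z| = nc z.
Proof. by rewrite -nc_norm nc_real ger0_norm ?nc_ge0. Qed.

Lemma bd_ab s a A : bd s a A -> bd s (ab a) A.
Proof. by apply: bd_dom => k; rewrite nc_abs. Qed.

Lemma bd_wab s a A : bd (s + 2) a A -> bd s (wab a) A.
Proof.
move=> /bd_ab aA; rewrite -[A]mul1r; apply: (bdM2 ler01 _ aA) => k.
by rewrite nc_real mul1r ger0_norm// ltW// weight_gt0.
Qed.

Lemma le_nc (z w : R[i]) : `|z| <= w -> nc z <= nc w.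
Proof.
move=> zw; have w0 : 0 <= w by apply: le_trans zw.
by rewrite -lecR !nc_norm (ger0_norm w0).
Qed.

Lemma ReB (z w : R[i]) : complex.Re (z - w) = complex.Re z - complex.Re w.
Proof. by case: z; case: w. Qed.

(** In the order of [R[i]] the hypothesis forces [b] to be real and nonnegative. The conclusion has
    the same shape as the hypothesis, so the lemma can be iterated through nested sums. *)
Lemma csum_ler a b B : l1 b B -> (forall k, `|a k| <= b k) ->
  `|csum_freq a| <= csum_freq b.
Proof.
move=> bB hab.
have b0 k : 0 <= b k by apply: le_trans (hab k).
have bR k : complex.Im (b k) = 0 by exact: ger0_Im.
have aB : l1 a B by apply: (l1_le _ bB) => k; exact: le_nc.
have -> : csum_freq b = (complex.Re (csum_freq b))%:C.
  apply: complex_eq => //=.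
  rewrite /rsum_freq (_ : _ \o _ = fun=> 0%E); last first.
    by apply/funext => k /=; rewrite bR.
  rewrite (_ : (fun=> 0%E)^\+ = fun=> 0%E)%E; last by apply/funext => k; rewrite funeposE maxxx.
  rewrite (_ : (fun=> 0%E)^\- = fun=> 0%E)%E; last by apply/funext => k; rewrite funenegE oppe0 maxxx.
  by rewrite esum1// sube0.
rewrite -nc_norm lecR; apply/ler_addgt0Pl => e e0.
have e2 : 0 < e / 2 by rewrite divr_gt0.
have [s0 h0] := csum_approx aB e2; have [s1 h1] := csum_approx bB e2.
pose s := undup (s0 ++ s1).
have us : uniq s by exact: undup_uniq.
have /(h0 _ us) k0 : {subset s0 <= s} by move=> k ks; rewrite mem_undup mem_cat ks.
have /(h1 _ us) k1 : {subset s1 <= s} by move=> k ks; rewrite mem_undup mem_cat ks orbT.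
have k2 : nc (\sum_(k <- s) a k) <= complex.Re (\sum_(k <- s) b k).
  rewrite (le_trans (nc_sum _ _))// Re_sum ler_sum// => k _.
  by have := hab k; rewrite -nc_norm lecE/= => /andP[_].
have k3 : complex.Re (\sum_(k <- s) b k) - complex.Re (csum_freq b) <= e / 2.
  rewrite (le_trans (ler_norm _))// (le_trans _ k1)// (le_trans _ (nc_Re _))//.
  by rewrite ReB.
have k4 := nc_distl (csum_freq a) (\sum_(k <- s) a k).
move: k0; rewrite -ncN opprB => k0.
have := le_trans k4 k0; rewrite ler_norml => /andP[_ k5].
lra.
Qed.

(** The three input frequencies are [p], [q - p] and [k - q]. A kernel that also depends on the
    output frequency is inserted with that frequency fixed. *)
Definition tri (kap : Z -> Z -> R[i]) a b c : Z -> R[i] := fun k =>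
  csum_freq (fun q => csum_freq (fun p => kap q p * (a p * b (q - p))) * c (k - q)).

Section fixed_order.
Variables (s K : R).
Hypothesis alg : algebra_const s K.

Let K0 : 0 < K. Proof. by case: alg. Qed.
Let h1 a A : bd s a A -> l1 a (K * A).
Proof. by have [_ h _] := alg; exact: h. Qed.
Let h2 a b A B : bd s a A -> bd s b B -> bd s (fconv a b) (K * (A * B)).
Proof. by have [_ _ h] := alg; exact: h. Qed.

Lemma bd_N3 a b c A B C : bd s a A -> bd s b B -> bd s c C ->
  bd s (N3 a b c) (K ^+ 2 * (A * B * C)).
Proof.
move=> aA bB cC; have := h2 (h2 aA bB) cC.
by apply: bd_le; apply: le_of_eq; ring.
Qed.

Lemma fconvBl a a' b A A' B : bd s a A -> bd s a' A' -> bd s b B ->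
  fconv (fun k => a k - a' k) b = fun k => fconv a b k - fconv a' b k.
Proof.
move=> /h1 aA /h1 aA' /h1 bB.
under [X in fconv X _]eq_fun do rewrite -mulN1r.
rewrite (fconvDl aA (l1M (-1) aA') bB) (fconvZl (-1) aA' bB).
by apply/funext => k; rewrite mulN1r.
Qed.

Lemma fconvBr a b b' A B B' : bd s a A -> bd s b B -> bd s b' B' ->
  fconv a (fun k => b k - b' k) = fun k => fconv a b k - fconv a b' k.
Proof.
move=> /h1 aA /h1 bB /h1 bB'.
under [X in fconv _ X]eq_fun do rewrite -mulN1r.
rewrite (fconvDr aA bB (l1M (-1) bB')) (fconvZr (-1) aA bB').
by apply/funext => k; rewrite mulN1r.
Qed.

(** The factors are exchanged one at a time from left to right, which decides where bounds of the
    old and of the new factors appear. *)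
Lemma bd_N3B a b c a' b' c' A' B C B' ea eb ec :
  bd s (fun k => a k - a' k) ea -> bd s (fun k => b k - b' k) eb ->
  bd s (fun k => c k - c' k) ec ->
  bd s b B -> bd s c C -> bd s a' A' -> bd s b' B' ->
  bd s (fun k => N3 a b c k - N3 a' b' c' k)
    (K ^+ 2 * (ea * B * C + A' * eb * C + A' * B' * ec)).
Proof.
move=> da db dc bB cC aA' bB'.
have ext x (f g : Z -> R[i]) : bd s (fun k => f k - g k) x ->
    forall y, bd s g y -> bd s f (x + y).
  by move=> df y gy; apply: bd_eq (bdD df gy) => k; rewrite subrK.
have aA := ext _ _ _ da _ aA'.
have cC' : bd s c' (ec + C).
  apply: bd_eq (bdD (bdN dc) cC) => k; ring.
have E1 := fconvBl aA aA' bB; have E2 := fconvBr aA' bB bB'.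
have E3 := fconvBl (h2 aA bB) (h2 aA' bB) cC.
have E4 := fconvBl (h2 aA' bB) (h2 aA' bB') cC.
have E5 := fconvBr (h2 aA' bB') cC cC'.
have n1 := bd_N3 da bB cC; have n2 := bd_N3 aA' db cC; have n3 := bd_N3 aA' bB' dc.
rewrite 2!mulrDr; apply: bd_eq (bdD (bdD n1 n2) n3) => k.
rewrite /N3 E1 E2 E3 E4 E5; ring.
Qed.

Section kernels.
Variables (a b c : Z -> R[i]) (A B C : R).
Hypotheses (aA : bd s a A) (bB : bd s b B) (cC : bd s c C).

Lemma l1_inner kap M q : (forall q p, nc (kap q p) <= M) ->
  l1 (fun p => kap q p * (a p * b (q - p))) (M * (K * A * (K * B))).
Proof.
move=> kM F uF; have M0 : 0 <= M by apply: le_trans (kM q q); exact: nc_ge0.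
rewrite (le_trans _ (ler_wpM2l M0 (l1_fconv q (h1 aA) (h1 bB) uF)))//.
rewrite mulr_sumr ler_sum// => p _; rewrite [leLHS]ncM ler_wpM2r ?nc_ge0//.
Qed.

Lemma inner_le kap M q : (forall q p, nc (kap q p) <= M) ->
  nc (csum_freq (fun p => kap q p * (a p * b (q - p)))) <=
  nc (M%:C * fconv (ab a) (ab b) q).
Proof.
move=> kM; have l := l1_fconv q (h1 (bd_ab aA)) (h1 (bd_ab bB)).
rewrite /fconv -(csumZ _ l); apply: le_nc; apply: (csum_ler (l1M _ l)) => p.
rewrite !normrM ler_wpM2r ?mulr_ge0//.
by rewrite -nc_norm lecR.
Qed.

Lemma l1_outer kap M k : (forall q p, nc (kap q p) <= M) ->
  exists L, l1 (fun q => csum_freq (fun p => kap q p * (a p * b (q - p))) * c (k - q)) L.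
Proof.
move=> kM; have l := l1_fconv k (h1 (h2 (bd_ab aA) (bd_ab bB))) (h1 cC).
eexists; apply: (l1_le _ (l1M M%:C l)) => q.
rewrite ncM mulrA (ncM _ (c _)) ler_wpM2r ?nc_ge0//.
exact: inner_le.
Qed.

Lemma triD kap kap' M M' : (forall q p, nc (kap q p) <= M) ->
  (forall q p, nc (kap' q p) <= M') ->
  tri (fun q p => kap q p + kap' q p) a b c = fun k => tri kap a b c k + tri kap' a b c k.
Proof.
move=> kM kM'; apply/funext => k; rewrite /tri.
have [L l] := l1_outer k kM; have [L' l'] := l1_outer k kM'.
rewrite -(csumD l l'); congr csum_freq; apply/funext => q; rewrite -mulrDl; congr (_ * _).
rewrite -(csumD (l1_inner q kM) (l1_inner q kM')); congr csum_freq; apply/funext => p.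
by rewrite mulrDl.
Qed.

Lemma triZ kap M z : (forall q p, nc (kap q p) <= M) ->
  tri (fun q p => z * kap q p) a b c = fun k => z * tri kap a b c k.
Proof.
move=> kM; apply/funext => k; rewrite /tri.
have [L l] := l1_outer k kM.
rewrite -(csumZ z l); congr csum_freq; apply/funext => q; rewrite mulrA; congr (_ * _).
rewrite -(csumZ z (l1_inner q kM)); congr csum_freq; apply/funext => p.
by rewrite -mulrA.
Qed.

Lemma N3_tri : N3 a b c = tri (fun _ _ => 1) a b c.
Proof.
apply/funext => k; congr csum_freq; apply/funext => q; congr (_ * _).
by congr csum_freq; apply/funext => p; rewrite mul1r.
Qed.

Definition resonance (k q p : Z) : R :=
  freq_sqnorm k - freq_sqnorm p - freq_sqnorm (q - p) - freq_sqnorm (k - q).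

(** The four unimodular phases, one for the output and three for the inputs, combine into [t] times
    the resonance function. *)
Lemma Theta_tri t k :
  Theta t a b c k = tri (fun q p => ei (t * resonance k q p)) a b c k.
Proof.
have k1 q p : nc (ei (t * resonance k q p)) <= 1 by rewrite nc_ei.
rewrite /Theta /N3 /tri {1}/S {1}/fconv.
have l := l1_fconv k (h1 (h2 (bd_S t aA) (bd_S t bB))) (h1 (bd_S t cC)).
rewrite -(csumZ _ l); congr csum_freq; apply/funext => q.
have l' := l1_fconv q (h1 (bd_S t aA)) (h1 (bd_S t bB)).
rewrite [S t c _]/S mulrA mulrCA mulrA mulrA; congr (_ * _).
rewrite -eiD /fconv -(csumZ _ l'); congr csum_freq; apply/funext => p.
set E := ei _; rewrite /S mulrACA -[X in E * (X * _)]eiD mulrA -eiD; congr (ei _ * _).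
by rewrite /resonance; ring.
Qed.

Definition dot (k l : Z) : R := \sum_(i < d) (k ord0 i)%:~R * (l ord0 i)%:~R.

Lemma dot_sqr_le k l : dot k l ^+ 2 <= weight k * weight l.
Proof.
rewrite (le_trans (cauchy_schwarz_seq _ _ _))// ler_pM ?sumr_ge0//.
- by move=> i _; rewrite sqr_ge0.
- by move=> i _; rewrite sqr_ge0.
- by rewrite lerDr.
- by rewrite lerDr.
Qed.

Lemma resonanceE k q p :
  resonance k q p = 2 * (dot p (q - p) + dot p (k - q) + dot (q - p) (k - q)).
Proof.
rewrite /resonance /dot /freq_sqnorm -!sumrB -!big_split mulr_sumr/=.
by apply: eq_bigr => i _; rewrite !mxE !rmorphB/=; ring.
Qed.

(** [12 = 2^2 * 3]: the factor 2 of [resonanceE], squared, and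
    [(x + y + z)^2 <= 3 (x^2 + y^2 + z^2)]. Each squared dot product costs one weight on each of two
    different factors. *)
Lemma resonance_sqr_le k q p : resonance k q p ^+ 2 <=
  12 * (weight p * weight (q - p) + weight p * weight (k - q) +
        weight (q - p) * weight (k - q)).
Proof.
rewrite resonanceE exprMn.
have := dot_sqr_le p (q - p); have := dot_sqr_le p (k - q).
have := dot_sqr_le (q - p) (k - q).
move: (dot _ _) (dot _ _) (dot _ _) => x y z.
have := sqr_ge0 (x - y); have := sqr_ge0 (x - z); have := sqr_ge0 (y - z).
nra.
Qed.

End kernels.

(* A kernel of size [O(w(k1) w(k2) + w(k1) w(k3) + w(k2) w(k3))] costs two
   derivatives on each of two factors, never four on one. *)
Lemma bd_tri kap M a b c A B C k0 :
  bd (s + 2) a A -> bd (s + 2) b B -> bd (s + 2) c C -> 0 <= M ->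
  (forall q p, nc (kap q p) <= M * (weight p * weight (q - p) +
     weight p * weight (k0 - q) + weight (q - p) * weight (k0 - q))) ->
  nc (tri kap a b c k0) <= nc (M%:C * (N3 (wab a) (wab b) (ab c) k0 +
    N3 (wab a) (ab b) (wab c) k0 + N3 (ab a) (wab b) (wab c) k0)).
Proof.
move=> aA bB cC M0 kM.
have wa := bd_wab aA; have wb := bd_wab bB; have wc := bd_wab cC.
have a1 := bd_ab (bd_weaken aA); have b1 := bd_ab (bd_weaken bB).
have c1 := bd_ab (bd_weaken cC).
have i1 := l1_fconv _ (h1 wa) (h1 wb); have i2 := l1_fconv _ (h1 wa) (h1 b1).
have i3 := l1_fconv _ (h1 a1) (h1 wb).
have o1 := l1_fconv k0 (h1 (h2 wa wb)) (h1 c1).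
have o2 := l1_fconv k0 (h1 (h2 wa b1)) (h1 wc).
have o3 := l1_fconv k0 (h1 (h2 a1 wb)) (h1 wc).
have o12 := l1D o1 o2; have o123 := l1D o12 o3.
apply: le_nc.
rewrite /N3 {1}/fconv {2}/fconv -(csumD o1 o2).
rewrite [X in _ + X]/fconv -(csumD o12 o3) -(csumZ _ o123).
apply: (csum_ler (l1M _ o123)) => q.
rewrite normrM.
pose w : R := weight (k0 - q).
have w0 : 0 <= w by rewrite ltW// weight_gt0.
have wC x : 0 <= (weight x : R)%:C by rewrite ler0c ltW// weight_gt0.
have l2 := l1M w%:C (i2 q); have l3 := l1M w%:C (i3 q).
have l23 := l1D l2 l3; have l123 := l1D (i1 q) l23.
rewrite (_ : _ * (_ + _) = M%:C * (fconv (wab a) (wab b) q +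
   (w%:C * fconv (wab a) (ab b) q + w%:C * fconv (ab a) (wab b) q)) * `|c (k0 - q)|); last first.
  rewrite /ab /wab -/w; ring.
rewrite ler_wpM2r//.
rewrite -(csumZ w%:C (i2 q)) -(csumZ w%:C (i3 q)) -(csumD l2 l3) -(csumD (i1 q) l23).
rewrite -(csumZ _ l123); apply: (csum_ler (l1M _ l123)) => p.
rewrite !normrM.
rewrite [leRHS](_ : _ = (M%:C * ((weight p)%:C * (weight (q - p))%:C +
   (weight p)%:C * w%:C + (weight (q - p))%:C * w%:C)) * (`|a p| * `|b (q - p)|)); last first.
  by rewrite /ab /wab; ring.
rewrite ler_wpM2r ?mulr_ge0//.
by rewrite -nc_norm -!rmorphM -!rmorphD -rmorphM lecR.
Qed.

(** [144 = 4 * 12 * 3]: the interpolation error of [ei], the bound on the squared resonance, and the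
    three choices of two weighted factors. [tau] carries no sign condition, so the backward half of
    a step is covered. *)
Lemma bd_Theta_interp a b c A B C th tau :
  bd (s + 2) a A -> bd (s + 2) b B -> bd (s + 2) c C -> 0 <= th <= 1 ->
  bd s (fun k => Theta (th * tau) a b c k - (1 - th)%:C * N3 a b c k
                 - th%:C * Theta tau a b c k)
     (144 * K ^+ 2 * (A * B * C) * tau ^+ 2).
Proof.
move=> aA bB cC th01.
have a1 := bd_weaken aA; have b1 := bd_weaken bB; have c1 := bd_weaken cC.
pose M := 48 * tau ^+ 2.
have M0 : 0 <= M by rewrite mulr_ge0// sqr_ge0.
pose Y k := N3 (wab a) (wab b) (ab c) k + N3 (wab a) (ab b) (wab c) k
  + N3 (ab a) (wab b) (wab c) k.
have bY : bd s Y (K ^+ 2 * (A * B * C) + K ^+ 2 * (A * B * C) + K ^+ 2 * (A * B * C)).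
  by apply: bdD; [apply: bdD|]; apply: bd_N3; (apply: bd_wab || apply: bd_ab).
have MC : forall k : Z, nc (M%:C : R[i]) <= M by move=> k; rewrite nc_real ger0_norm.
have := bdM M0 MC bY.
rewrite (_ : M * _ = 144 * K ^+ 2 * (A * B * C) * tau ^+ 2); last by rewrite /M; ring.
apply: bd_dom => k.
pose kap q p := ei (th * tau * resonance k q p) + (- (1 - th)%:C) * 1 +
  (- th%:C) * ei (tau * resonance k q p).
have e1 r q p : nc (ei (r * resonance k q p)) <= 1 by rewrite nc_ei.
have e2 (q p : Z) : nc (1 : R[i]) <= 1 by rewrite nc1.
have e3 z (q p : Z) : nc (- z * 1) <= nc (- z : R[i]) by rewrite mulr1.
have e4 z q p : nc (- z * ei (tau * resonance k q p)) <= nc (- z) by rewrite ncM nc_ei mulr1.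
have -> : Theta (th * tau) a b c k - (1 - th)%:C * N3 a b c k
    - th%:C * Theta tau a b c k = tri kap a b c k.
  have e12 (q p : Z) : nc (ei (th * tau * resonance k q p) + - (1 - th)%:C * 1) <=
      1 + nc (- (1 - th)%:C : R[i]).
    by rewrite (le_trans (ncD _ _))// lerD ?e1 ?e3.
  rewrite (triD a1 b1 c1 e12 (e4 _)) (triD a1 b1 c1 (e1 _) (e3 _)).
  rewrite (triZ a1 b1 c1 (- (1 - th)%:C) e2) (triZ a1 b1 c1 (- th%:C) (e1 _)).
  by rewrite !(Theta_tri a1 b1 c1) N3_tri !mulNr.
apply: (bd_tri aA bB cC M0) => q p.
rewrite /kap mulr1 mulNr -mulrA.
rewrite (le_trans (nc_ei_interp _ th01))//.
rewrite exprMn /M.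
have := resonance_sqr_le k q p; have := sqr_ge0 tau.
set W := _ + _ + _; move: (resonance _ _ _ ^+ 2) => r t0 rW.
rewrite [leRHS](_ : _ = 4 * (tau ^+ 2 * (12 * W))); last by ring.
by rewrite ler_wpM2l// ler_wpM2l.
Qed.

End fixed_order.

End trilinear.

(** * Expansion of the exact flow *)

Section flow_expansion.
Context {R : realType} {d : nat}.
Local Notation Z := 'rV[int]_d.
Implicit Types (a b c : Z -> R[i]) (s A B C t sg : R).

(** The segment from 0 to [sg] is described by [|z| <= |sg|] and [0 <= z * sg], so that forward and
    backward times share one statement. *)
Lemma bd_mean_value0 s (D : R -> Prop) (E G : R -> Z -> R[i]) sg B :
  (forall z, `|z| <= `|sg| -> 0 <= z * sg -> D z) ->
  (forall k, cder D (fun x => E x k) (fun x => G x k)) ->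
  (forall z, `|z| <= `|sg| -> 0 <= z * sg -> bd s (G z) B) ->
  bd s (fun k => E sg k - E 0 k) (B * `|sg|).
Proof.
move=> hD dE GB; have [sg0|sg0] := lerP 0 sg.
  have I z : 0 <= z <= sg -> `|z| <= `|sg| /\ 0 <= z * sg.
    by move=> /andP[z0 zs]; rewrite !ger0_norm// mulr_ge0.
  rewrite (ger0_norm sg0) -[X in B * X]subr0; apply: (@bd_mean_value _ _ s E G _ _ _ sg0).
    move=> k; apply: cder_sub (dE k) => z /I[]; exact: hD.
  by move=> z /I[]; exact: GB.
have sg1 := ltW sg0.
have I z : sg <= z <= 0 -> `|z| <= `|sg| /\ 0 <= z * sg.
  by move=> /andP[z0 zs]; rewrite !ler0_norm ?lerN2// mulr_le0.
rewrite (ler0_norm sg1) -[X in B * X]add0r.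
apply: (bd_dom (b := fun k => E 0 k - E sg k)) => [k|]; first by rewrite -ncN opprB.
apply: (@bd_mean_value _ _ s E G _ _ _ sg1).
  move=> k; apply: cder_sub (dE k) => z /I[]; exact: hD.
by move=> z /I[]; exact: GB.
Qed.

Definition nonlin a := N3 a a (cjs a).

Lemma cjs_S t a : cjs (S t a) = S (- t) (cjs a).
Proof.
apply/funext => k; rewrite /cjs /S freq_sqnormN rmorphM.
by congr (_ * _); rewrite -[LHS]/(conjc (ei _)) eiJ mulNr.
Qed.

Lemma cjsB a b : cjs (fun k => a k - b k) = fun k => cjs a k - cjs b k.
Proof. by apply/funext => k; rewrite /cjs rmorphB. Qed.

Lemma SB t a b : S t (fun k => a k - b k) = fun k => S t a k - S t b k.
Proof. by apply/funext => k; rewrite /S mulrBr. Qed.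

Lemma bd_cst s z a A : bd s a A -> bd s (fun k => z * a k) (nc z * A).
Proof. by move=> aA; apply: bdM => //; exact: nc_ge0. Qed.

Variables (alpha K mu T M : R).
Hypothesis alg0 : @algebra_const R d alpha K.
Hypothesis alg2 : @algebra_const R d (alpha + 2) K.

(* The coefficients of an [H^(alpha+2)]-bounded solution. *)
Definition is_flow (U : R -> Z -> R[i]) :=
  (forall t, 0 <= t <= T -> bd (alpha + 2) (U t) M) /\
  (forall k, cder (fun t => 0 <= t <= T) (fun t => U t k)
    (fun t => - 'i%C * ((freq_sqnorm k)%:C * U t k + mu%:C * nonlin (U t) k))).

Definition cmu : R[i] := - 'i%C * mu%:C.

Lemma nc_cmu : nc cmu = `|mu|.
Proof. by rewrite /cmu mulNr ncN ncM nci mul1r nc_real. Qed.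

(* The curve [sg |-> e^(-i sg Delta) u(t + sg)] loses no derivative when
   differentiated, unlike [u] itself. *)
Definition twisted (U : R -> Z -> R[i]) t sg := S (- sg) (U (t + sg)).
Definition force (U : R -> Z -> R[i]) t sg := S (- sg) (nonlin (U (t + sg))).

Variable U : R -> Z -> R[i].
Hypothesis flow : is_flow U.

Let UM t : 0 <= t <= T -> bd (alpha + 2) (U t) M.
Proof. by have [h _] := flow; exact: h. Qed.

Let UM0 t : 0 <= t <= T -> bd alpha (U t) M.
Proof. by move=> /UM /bd_weaken. Qed.

(** Product rule: differentiating the phase produces exactly the term that cancels the Laplacian of
    the equation. *)
Lemma cder_twisted t k : cder (fun sg => 0 <= t + sg <= T)
  (fun sg => twisted U t sg k) (fun sg => cmu * force U t sg k).
Proof.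
have [_ h] := flow.
have h1 := cder_comp (c := t) (normr1 R) (h k).
have h2 := cderM (@cder_ei R (fun sg => 0 <= t + 1 * sg <= T) (freq_sqnorm k)) h1.
apply: (cder_sub (D := fun sg => 0 <= t + 1 * sg <= T)).
  by move=> x; rewrite mul1r.
apply: (cder_ext _ _ h2) => sg.
  by rewrite /twisted /S mulNr opprK mul1r.
move=> _; rewrite /force /S [- sg * _]mulNr opprK !mul1r /cmu -complexiE; ring.
Qed.

Definition B_n := `|mu| * (K ^+ 2 * (M * M * M)).

Lemma bd_nonlin s a A : @algebra_const R d s K -> bd s a A ->
  bd s (nonlin a) (K ^+ 2 * (A * A * A)).
Proof. by move=> alg aA; apply: (bd_N3 alg) => //; exact: bd_cjs. Qed.

Lemma bd_cmu_force t sg : 0 <= t + sg <= T ->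
  bd (alpha + 2) (fun k => cmu * force U t sg k) B_n.
Proof.
by move=> tT; rewrite /B_n -nc_cmu; apply: bd_cst; apply: bd_S; apply: bd_nonlin => //; exact: UM.
Qed.

Section at_time.
Variables (t : R).
Hypothesis tT : 0 <= t <= T.

Let a := U t.
Let aM2 : bd (alpha + 2) a M. Proof. exact: UM. Qed.
Let aM : bd alpha a M. Proof. exact: UM0. Qed.
Let caM : bd alpha (cjs a) M. Proof. exact: bd_cjs. Qed.
Let M0 : 0 <= M. Proof. exact: bd_ge0 aM. Qed.
Let n k := cmu * nonlin a k.
Let nB2 : bd (alpha + 2) n B_n.
Proof. by rewrite /B_n -nc_cmu; apply: bd_cst; exact: bd_nonlin. Qed.
Let nB : bd alpha n B_n. Proof. exact: bd_weaken. Qed.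
Let Bn0 : 0 <= B_n. Proof. exact: bd_ge0 nB. Qed.

Let between sg z : 0 <= t + sg <= T -> `|z| <= `|sg| -> 0 <= z * sg -> 0 <= t + z <= T.
Proof.
move=> /andP[h1 h2] zs z0; case/andP: tT => t0 t1.
have zp : z <= `|z| by exact: ler_norm.
have zn : - z <= `|z| by rewrite -normrN ler_norm.
move: zs z0; have [s0|s0|s0] := ltrgtP sg 0.
- by rewrite (ltr0_norm s0) (nmulr_lge0 _ s0) => zs z0; apply/andP; split; lra.
- by rewrite (gtr0_norm s0) (pmulr_lge0 _ s0) => zs z0; apply/andP; split; lra.
- by rewrite s0 normr0 => zs _; apply/andP; split; lra.
Qed.

Lemma twisted0 : twisted U t 0 = a.
Proof. by rewrite /twisted addr0 oppr0 S0. Qed.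

Lemma twisted_S sg : S sg (twisted U t sg) = U (t + sg).
Proof. by rewrite /twisted SD subrr S0. Qed.

Lemma bd_twisted1 sg : 0 <= t + sg <= T ->
  bd alpha (fun k => twisted U t sg k - a k) (B_n * `|sg|).
Proof.
move=> sT; have := bd_mean_value0 (s := alpha) (B := B_n) (sg := sg) _ (fun k => @cder_twisted t k).
rewrite twisted0; apply=> z z1 z2; first exact: between z2.
by apply: bd_weaken; apply: bd_cmu_force; exact: between z2.
Qed.

Lemma bd_U1 sg : 0 <= t + sg <= T ->
  bd alpha (fun k => U (t + sg) k - S sg a k) (B_n * `|sg|).
Proof.
move=> sT; have := bd_S sg (bd_twisted1 sT).
by rewrite SB twisted_S.
Qed.

(** Speed of the solution in [H^alpha]: [B_n] from the nonlinearity, [M] from the free flow, which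
    costs two derivatives. *)
Definition C_2 := B_n + M.
Let C20 : 0 <= C_2. Proof. exact: addr_ge0. Qed.

Lemma bd_U2 sg : 0 <= t + sg <= T ->
  bd alpha (fun k => U (t + sg) k - a k) (C_2 * `|sg|).
Proof.
move=> sT; rewrite /C_2 mulrDl [M * _]mulrC.
by apply: bd_eq (bdD (bd_U1 sT) (bd_SB sg aM2)) => k; rewrite addrA subrK.
Qed.

Definition C_3 := K ^+ 2 * (3 * (M * M * C_2) + M * M * M).

Let C30 : 0 <= C_3.
Proof.
rewrite /C_3; apply: mulr_ge0; first exact: sqr_ge0.
by apply: addr_ge0; rewrite !mulr_ge0.
Qed.

(** Three factors move at speed [C_2]; undoing the outer free flow costs two derivatives of the
    cubic term, available since [H^(alpha+2)] is an algebra. *)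
Lemma bd_force1 sg : 0 <= t + sg <= T ->
  bd alpha (fun k => force U t sg k - nonlin a k) (C_3 * `|sg|).
Proof.
move=> sT; have x := UM0 sT; have xa := bd_U2 sT.
have cxa : bd alpha (fun k => cjs (U (t + sg)) k - cjs a k) (C_2 * `|sg|).
  by rewrite -cjsB; exact: bd_cjs.
have h1 := bd_S (- sg) (bd_N3B alg0 xa xa cxa x (bd_cjs x) aM aM).
have h2 := bd_SB (- sg) (bd_nonlin alg2 aM2).
apply: bd_le (bd_eq _ (bdD h1 h2)) => [|k].
  by rewrite normrN; apply: le_of_eq; rewrite /C_3; ring.
by rewrite SB addrA subrK.
Qed.

Definition C_4 := `|mu| * C_3.

(** Second order Taylor expansion: after subtracting the tangent [sg * n], the derivative is
    [O(|sg|)] by [bd_force1], and the mean value inequality gains one more power. *)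
Lemma bd_twisted2 sg : 0 <= t + sg <= T ->
  bd alpha (fun k => twisted U t sg k - a k - sg%:C * n k) (C_4 * `|sg| ^+ 2).
Proof.
move=> sT.
have dE k : cder (fun sg => 0 <= t + sg <= T)
    (fun sg => twisted U t sg k + (- n k) * sg%:C)
    (fun sg => cmu * force U t sg k + (- n k) * 1).
  by apply: cderD; [exact: cder_twisted|apply: cderZ; exact: cder_id].
have H := bd_mean_value0 (s := alpha) (B := C_4 * `|sg|) (sg := sg) _ dE.
rewrite expr2 mulrA; apply: bd_eq (H _ _) => [k|z z1 z2|z z1 z2].
- by rewrite rmorph0 mulr0 addr0 twisted0; ring.
- exact: between z2.
- have zT := between sT z1 z2.
  have := bd_cst cmu (bd_force1 zT); rewrite nc_cmu => h.
  apply: bd_le (bd_eq _ h) => [|k]; last by rewrite mulr1 mulrBr.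
  by rewrite /C_4 mulrA ler_wpM2l// mulr_ge0.
Qed.

Definition C_5 := C_4 + B_n.

Let remainder sg k := U (t + sg) k - S sg a k.

Lemma bd_remainder sg : 0 <= t + sg <= T ->
  bd alpha (fun k => remainder sg k - sg%:C * n k) (C_5 * `|sg| ^+ 2).
Proof.
move=> sT.
have h1 := bd_S sg (bd_twisted2 sT).
have h2 := bd_cst sg%:C (bd_SB sg nB2); rewrite nc_real in h2.
apply: bd_le (bd_eq _ (bdD h1 h2)) => [|k].
  by apply: le_of_eq; rewrite /C_5; ring.
by rewrite /remainder -(twisted_S sg) /S; ring.
Qed.

(** The derivative of [nonlin] at [a] in the direction [n]; this is the coefficient [D] of the
    expansion of the force. *)
Definition D_n k : R[i] := N3 n a (cjs a) k + N3 a n (cjs a) k + N3 a a (cjs n) k.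

Lemma bd_D_n s : bd s a M -> bd s n B_n -> @algebra_const R d s K ->
  bd s D_n (3 * K ^+ 2 * (B_n * M * M)).
Proof.
move=> ha hn alg.
have h1 := bd_N3 alg hn ha (bd_cjs ha); have h2 := bd_N3 alg ha hn (bd_cjs ha).
have h3 := bd_N3 alg ha ha (bd_cjs hn).
apply: bd_le (bdD (bdD h1 h2) h3).
by apply: le_of_eq; ring.
Qed.

Definition C_6 := 3 * K ^+ 2 * (C_5 * M * M + 2 * (B_n * C_2 * M)).

Lemma N3Z1 z b c e B C E : bd alpha b B -> bd alpha c C -> bd alpha e E ->
  N3 (fun k => z * b k) c e = fun k => z * N3 b c e k.
Proof.
have [K0 h1 h2] := alg0.
move=> hb hc he; rewrite /N3 (fconvZl z (h1 _ _ hb) (h1 _ _ hc)).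
by rewrite (fconvZl z (h1 _ _ (h2 _ _ _ _ hb hc)) (h1 _ _ he)).
Qed.

Lemma N3Z2 z b c e B C E : bd alpha b B -> bd alpha c C -> bd alpha e E ->
  N3 b (fun k => z * c k) e = fun k => z * N3 b c e k.
Proof.
have [K0 h1 h2] := alg0.
move=> hb hc he; rewrite /N3 (fconvZr z (h1 _ _ hb) (h1 _ _ hc)).
by rewrite (fconvZl z (h1 _ _ (h2 _ _ _ _ hb hc)) (h1 _ _ he)).
Qed.

Lemma N3Z3 z b c e B C E : bd alpha b B -> bd alpha c C -> bd alpha e E ->
  N3 b c (fun k => z * e k) = fun k => z * N3 b c e k.
Proof.
have [K0 h1 h2] := alg0.
move=> hb hc he.
by rewrite /N3 (fconvZr z (h1 _ _ (h2 _ _ _ _ hb hc)) (h1 _ _ he)).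
Qed.

Lemma nonlinB x y : bd alpha x M -> bd alpha y M ->
  nonlin x = fun k => nonlin y k + (N3 (fun k => x k - y k) x (cjs x) k +
     N3 y (fun k => x k - y k) (cjs x) k + N3 y y (cjs (fun k => x k - y k)) k).
Proof.
have [K0 h1 h2] := alg0.
move=> hx hy; have cx := bd_cjs hx; have cy := bd_cjs hy.
apply/funext => k; rewrite cjsB /nonlin /N3.
rewrite (fconvBl alg0 hx hy hx) (fconvBr alg0 hy hx hy).
rewrite (fconvBl alg0 (h2 _ _ _ _ hx hx) (h2 _ _ _ _ hy hx) cx).
rewrite (fconvBl alg0 (h2 _ _ _ _ hy hx) (h2 _ _ _ _ hy hy) cx).
rewrite (fconvBr alg0 (h2 _ _ _ _ hy hy) cx cy); ring.
Qed.

(** The difference [U (t + sg) - S sg a] occupies one of three slots and equals [sg * n] up to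
    [O(sg^2)]. Freezing the two other slots at [a] costs [O(sg)] each, on top of a factor already
    [O(sg)]: these are the terms [C_5 M M] and [2 B_n C_2 M] of [C_6]. *)
Lemma bd_nonlin2 sg : 0 <= t + sg <= T ->
  bd alpha (fun k => nonlin (U (t + sg)) k - nonlin (S sg a) k - sg%:C * D_n k)
    (C_6 * `|sg| ^+ 2).
Proof.
move=> sT.
have x := UM0 sT; have y : bd alpha (S sg a) M by apply: bd_S.
have xa := bd_U2 sT.
have ya : bd alpha (fun k => S sg a k - a k) (C_2 * `|sg|).
  apply: bd_le (bd_SB sg aM2); rewrite mulrC ler_wpM2r// lerDr.
  exact: Bn0.
have r := bd_remainder sT.
have cj (f : Z -> R[i]) e : bd alpha f e -> bd alpha (cjs f) e by exact: bd_cjs.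
have cxa := cj _ _ xa; rewrite cjsB in cxa.
have sn := bd_cst sg%:C nB; rewrite nc_real in sn.
have cr := cj _ _ r; rewrite cjsB in cr.
have csn := cj _ _ sn.
have r1 := bd_U1 sT.
have h1 := bd_N3B alg0 r xa cxa x (cj _ _ x) sn aM.
have h2 := bd_N3B alg0 ya r cxa r1 (cj _ _ x) aM sn.
have h3 := bd_N3B alg0 ya ya cr y (cj _ _ r1) aM aM.
rewrite (nonlinB x y).
have cjz : cjs (fun k => sg%:C * n k) = fun k => sg%:C * cjs n k.
  apply/funext => k; rewrite /cjs rmorphM; congr (_ * _).
  exact: conjc_real.
move: h1 h2 h3; rewrite cjz (N3Z1 _ nB aM caM) (N3Z2 _ aM nB caM) (N3Z3 _ aM aM (cj _ _ nB)).
move=> h1 h2 h3.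
apply: bd_le (bd_eq _ (bdD (bdD h1 h2) h3)) => [|k].
  by apply: le_of_eq; rewrite /C_6; ring.
by rewrite /D_n /remainder; ring.
Qed.

Definition C_7 := C_6 + 3 * K ^+ 2 * (B_n * M * M).

(** Twisting the previous expansion produces [S (- sg) D_n]. Replacing it by [D_n] costs two
    derivatives of [D_n], bounded in [H^(alpha+2)] by [bd_D_n]. *)
Lemma bd_force2 sg : 0 <= t + sg <= T ->
  bd alpha (fun k => force U t sg k - S (- sg) (nonlin (S sg a)) k - sg%:C * D_n k)
    (C_7 * `|sg| ^+ 2).
Proof.
move=> sT.
have h1 := bd_S (- sg) (bd_nonlin2 sT).
have h2 := bd_cst sg%:C (bd_SB (- sg) (bd_D_n aM2 nB2 alg2)).
rewrite nc_real normrN in h2.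
apply: bd_le (bd_eq _ (bdD h1 h2)) => [|k].
  by apply: le_of_eq; rewrite /C_7; ring.
by rewrite /force /S; ring.
Qed.

End at_time.
End flow_expansion.

(** * Local error *)

Section local_error.
Context {R : realType} {d : nat}.
Local Notation Z := 'rV[int]_d.
Implicit Types (a b c : Z -> R[i]) (s A B C t sg : R) (m g : R -> Z -> R[i]).
Variables (alpha K : R).
Hypothesis alg0 : @algebra_const R d alpha K.

Definition mlt (p : Z -> R[i]) a : Z -> R[i] := fun k => p k * a k.

Lemma S_mlt t p a : S t (mlt p a) = mlt p (S t a).
Proof. by apply/funext => k; rewrite /S /mlt mulrCA. Qed.

(* [g] is the derivative of the curve of multipliers [m], with a second order
   error that costs two derivatives. *)
Definition mder (D : R -> Prop) m g := exists2 L, 0 <= L &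
  forall x y, D x -> D y -> forall k,
    nc (m y k - m x k - (y - x)%:C * g x k) <= L * weight k * `|y - x| ^+ 2.

Definition mbounded (D : R -> Prop) m := forall x, D x -> exists2 C, 0 <= C &
  forall k, nc (m x k) <= C.

(** Only the multiplier on the third factor depends on [sg]. The remainder is estimated in [H^alpha]
    and then read off at a single frequency, whence the extra factor [K] in [Q]. *)
Lemma cder_N3 (D : R -> Prop) m g a b c A B C : bd alpha a A -> bd alpha b B ->
  bd (alpha + 2) c C -> mder D m g -> mbounded D m -> mbounded D g ->
  forall k, cder D (fun sg => N3 a b (mlt (m sg) c) k) (fun sg => N3 a b (mlt (g sg) c) k).
Proof.
move=> hA hB hC [L L0 mg] bm bg k x Dx e e0.
have [K0 h1 h2] := alg0.
have A0 := bd_ge0 hA; have B0 := bd_ge0 hB; have C0 := bd_ge0 hC.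
pose Q := K * (K ^+ 2 * (A * B * (L * C))).
have Q0 : 0 <= Q.
  by rewrite /Q mulr_ge0 ?(ltW K0)// mulr_ge0 ?sqr_ge0// !mulr_ge0.
exists (e / (Q + 1)); first by rewrite divr_gt0// ltr_wpDl.
move=> y Dy yx.
have [Cx Cx0 mx] := bm x Dx; have [Cy Cy0 my] := bm y Dy; have [Cg Cg0 gx] := bg x Dx.
have hC1 := bd_weaken hC.
have bx := bdM Cx0 mx hC1; have by_ := bdM Cy0 my hC1; have bgx := bdM Cg0 gx hC1.
have bz := bd_cst (y - x)%:C bgx.
have E : N3 a b (fun l => (m y l * c l - m x l * c l) - (y - x)%:C * (g x l * c l)) k =
    N3 a b (mlt (m y) c) k - N3 a b (mlt (m x) c) k - (y - x)%:C * N3 a b (mlt (g x) c) k.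
  rewrite /N3 (fconvBr alg0 (h2 _ _ _ _ hA hB) (bdB by_ bx) bz).
  rewrite (fconvBr alg0 (h2 _ _ _ _ hA hB) by_ bx).
  by rewrite (fconvZr (y - x)%:C (h1 _ _ (h2 _ _ _ _ hA hB)) (h1 _ _ bgx)).
rewrite -E.
have hd : bd alpha (fun l => (m y l * c l - m x l * c l) - (y - x)%:C * (g x l * c l))
    (L * `|y - x| ^+ 2 * C).
  have LL : 0 <= L * `|y - x| ^+ 2 by rewrite mulr_ge0// sqr_ge0.
  apply: bd_eq (bdM2 LL (m := fun l => m y l - m x l - (y - x)%:C * g x l) _ hC) => l.
    ring.
  by rewrite mulrAC; exact: mg.
rewrite (le_trans (l1_pt k (h1 _ _ (bd_N3 alg0 hA hB hd))))//.
have -> : K * (K ^+ 2 * (A * B * (L * `|y - x| ^+ 2 * C))) = Q * `|y - x| * `|y - x|.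
  by rewrite /Q; ring.
rewrite ler_wpM2r// (@le_trans _ _ ((Q + 1) * `|y - x|))//.
  by rewrite ler_wpM2r// lerDl.
by rewrite mulrC -ler_pdivlMr ?ltr_wpDl// ltW.
Qed.

Lemma cder_Theta (D : R -> Prop) t m g a b c A B C : bd alpha a A -> bd alpha b B ->
  bd (alpha + 2) c C -> mder D m g -> mbounded D m -> mbounded D g ->
  forall k, cder D (fun sg => Theta t a b (mlt (m sg) c) k)
    (fun sg => Theta t a b (mlt (g sg) c) k).
Proof.
move=> hA hB hC mg bm bg k.
have h := cderZ (ei (- (- t * freq_sqnorm k)))
  (cder_N3 (bd_S t hA) (bd_S t hB) (bd_S t hC) mg bm bg k).
by apply: (cder_ext _ _ h) => [sg|sg _]; rewrite /Theta S_mlt.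
Qed.

Lemma mderD D m g m' g' : mder D m g -> mder D m' g' ->
  mder D (fun sg k => m sg k + m' sg k) (fun sg k => g sg k + g' sg k).
Proof.
move=> [L L0 h] [L' L0' h']; exists (L + L'); first exact: addr_ge0.
move=> x y Dx Dy k.
rewrite (_ : _ - _ = (m y k - m x k - (y - x)%:C * g x k) +
  (m' y k - m' x k - (y - x)%:C * g' x k)); last by ring.
by rewrite !mulrDl (le_trans (ncD _ _))// lerD// ?h ?h'.
Qed.

Lemma mderZ D z m g : mder D m g ->
  mder D (fun sg k => z * m sg k) (fun sg k => z * g sg k).
Proof.
move=> [L L0 h]; exists (nc z * L); first by rewrite mulr_ge0 ?nc_ge0.
move=> x y Dx Dy k.
rewrite (_ : _ - _ = z * (m y k - m x k - (y - x)%:C * g x k)); last by ring.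
by rewrite ncM -!mulrA ler_wpM2l ?nc_ge0// mulrA h.
Qed.

Lemma mboundedD D m m' : mbounded D m -> mbounded D m' ->
  mbounded D (fun sg k => m sg k + m' sg k).
Proof.
move=> h h' x Dx; have [C C0 hC] := h x Dx; have [C' C0' hC'] := h' x Dx.
exists (C + C') => [|k]; first exact: addr_ge0.
by rewrite (le_trans (ncD _ _))// lerD.
Qed.

Lemma mboundedZ D z m : mbounded D m -> mbounded D (fun sg k => z * m sg k).
Proof.
move=> h x Dx; have [C C0 hC] := h x Dx.
exists (nc z * C) => [|k]; first by rewrite mulr_ge0 ?nc_ge0.
by rewrite ncM ler_wpM2l ?nc_ge0.
Qed.

Section oscillatory_multipliers.
Variables (tau e : R).
Hypotheses (tau0 : 0 < tau) (e1 : `|e| = 1).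
Let D sg := 0 <= sg <= tau.
Let lam (k : Z) : R := e * (2 * freq_sqnorm k).

Let abs_lam k : `|lam k| <= 2 * weight k.
Proof.
rewrite normrM e1 mul1r ger0_norm ?mulr_ge0 ?freq_sqnorm_ge0//.
by rewrite ler_wpM2l// lerDr.
Qed.

Lemma mder_osc0 : mder D (fun sg k => osc0 (lam k) sg) (fun sg k => ei (sg * lam k)).
Proof.
exists 2 => // x y Dx Dy k.
apply: (cder_taylor (@cder_osc0 R D (lam k)) Dx Dy); last first.
  by rewrite mulr_ge0// ltW// weight_gt0.
move=> s _; rewrite (le_trans (nc_eiB _ _))// -mulrBl normrM mulrC.
by rewrite ler_wpM2r.
Qed.

Lemma mder_osc1 : mder D (fun sg k => osc1 (lam k) sg) (fun sg k => sg%:C * ei (sg * lam k)).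
Proof.
have t0 : 0 <= tau by exact: ltW.
(* The 1 comes from the variation of the factor [sg], the [tau * 2] from that of the exponential, as
   [|lam k| <= 2 * weight k]. *)
exists (1 + tau * 2); first by rewrite addr_ge0// mulr_ge0.
move=> x y Dx Dy k.
have w0 : 0 <= weight k :> R by rewrite ltW// weight_gt0.
apply: (cder_taylor (@cder_osc1 R D (lam k)) Dx Dy); last first.
  by rewrite mulr_ge0// addr_ge0// mulr_ge0.
move=> s _; case/andP: Dx => x0 xt.
rewrite (_ : _ - _ = (s - x)%:C * ei (s * lam k) + x%:C * (ei (s * lam k) - ei (x * lam k))); last first.
  by rewrite rmorphB/=; ring.
rewrite (le_trans (ncD _ _))// !ncM nc_ei mulr1 !nc_real (ger0_norm x0).
rewrite mulrDl mul1r [(_ + _) * `|_|]mulrDl lerD//.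
  by rewrite ler_peMl// weight_ge1.
rewrite (@le_trans _ _ (tau * (`|lam k| * `|s - x|)))//.
  rewrite ler_pM// ?nc_ge0// (le_trans (nc_eiB _ _))// -mulrBl normrM mulrC.
  by [].
by rewrite -!mulrA ler_wpM2l// mulrA ler_wpM2r.
Qed.

Lemma mbounded_ei : mbounded D (fun sg k => ei (sg * lam k)).
Proof. by move=> x Dx; exists 1 => // k; rewrite nc_ei. Qed.

Lemma mbounded_sei : mbounded D (fun sg k => sg%:C * ei (sg * lam k)).
Proof. by move=> x Dx; exists `|x| => // k; rewrite ncM nc_ei mulr1 nc_real. Qed.

Lemma mbounded_osc0 : mbounded D (fun sg k => osc0 (lam k) sg).
Proof.
by move=> x Dx; exists `|x| => // k; rewrite ncM nc_real ler_piMr// nc_phi1_le.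
Qed.

Lemma mbounded_osc1 : mbounded D (fun sg k => osc1 (lam k) sg).
Proof.
move=> x Dx; exists (`|x| ^+ 2); first by rewrite sqr_ge0.
by move=> k; rewrite ncM expr2 ncM nc_real -expr2 ler_piMr ?sqr_ge0// nc_phi2_le.
Qed.

End oscillatory_multipliers.

End local_error.

(** * The two-step recursion and its local error *)

Section two_step.
Context {R : realType} {d : nat}.
Local Notation Z := 'rV[int]_d.
Implicit Types (a b c : Z -> R[i]) (t sg : R).

(** The conjugate factor evolves under [S (- r)]. Writing this as [S r] after the multiplier
    [e^(2 i r |k|^2)] puts all three factors under the same group, as [Theta] requires. *)
Lemma nonlin_Theta r a :
  S (- r) (nonlin (S r a)) = Theta r a a (mlt (fun k => ei (r * (2 * freq_sqnorm k))) (cjs a)).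
Proof.
rewrite /nonlin cjs_S /Theta; congr (S _ (N3 _ _ _)).
by apply/funext => k; rewrite /S /mlt mulrA -eiD; congr (ei _ * _); ring.
Qed.

(** [e = 1] belongs to the forward half of the symmetric step and [e = -1] to the backward half. *)
Definition lambda (e : R) (k : Z) : R := e * (2 * freq_sqnorm k).
Definition wave e sg (k : Z) : R[i] := ei (sg * lambda e k).

(* The multipliers of the scheme on [\bar u], for the step [sg] inside the
   interpolation step [tau]; [sLRI2] uses [sg = tau]. *)
Definition m_mid tau sg (k : Z) : R[i] :=
  (osc0 (lambda 1 k) sg + osc0 (lambda (-1) k) sg) +
  (- tau^-1%:C) * (osc1 (lambda 1 k) sg + osc1 (lambda (-1) k) sg).
Definition m_end e tau sg (k : Z) : R[i] := tau^-1%:C * osc1 (lambda e k) sg.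

(** The weights of linear interpolation, [1 - sg / tau] at the middle and [sg / tau] at the ends;
    [m_mid] and [m_end] are the primitives in [sg] vanishing at 0. *)
Definition g_mid tau sg (k : Z) : R[i] :=
  (wave 1 sg k + wave (-1) sg k) +
  (- tau^-1%:C) * (sg%:C * wave 1 sg k + sg%:C * wave (-1) sg k).
Definition g_end e tau sg (k : Z) : R[i] := tau^-1%:C * (sg%:C * wave e sg k).

(** [Phi] is the interpolated force, forward plus backward, and [Psi] its primitive in [sg]; at
    [sg = tau] it gives the nonlinear part of the scheme. *)
Definition Psi tau sg a k : R[i] :=
  N3 a a (mlt (m_mid tau sg) (cjs a)) k +
  Theta tau a a (mlt (m_end 1 tau sg) (cjs a)) k +
  Theta (- tau) a a (mlt (m_end (-1) tau sg) (cjs a)) k.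

Definition Phi tau sg a k : R[i] :=
  N3 a a (mlt (g_mid tau sg) (cjs a)) k +
  Theta tau a a (mlt (g_end 1 tau sg) (cjs a)) k +
  Theta (- tau) a a (mlt (g_end (-1) tau sg) (cjs a)) k.

Variables (alpha K mu T M : R).
Hypothesis alg0 : @algebra_const R d alpha K.
Hypothesis alg2 : @algebra_const R d (alpha + 2) K.

Lemma cder_Psi tau a k : 0 < tau -> bd (alpha + 2) a M ->
  cder (fun sg => 0 <= sg <= tau) (fun sg => Psi tau sg a k) (fun sg => Phi tau sg a k).
Proof.
move=> t0 aM2; have aM := bd_weaken aM2; have caM := bd_cjs aM2.
have n1 : `|1 : R| = 1 by rewrite normr1.
have nN1 : `|-1 : R| = 1 by rewrite normrN1.
have q0 e : `|e| = 1 -> mder (fun sg => 0 <= sg <= tau)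
    (fun sg (k : Z) => osc0 (lambda e k) sg) (wave e) by exact: mder_osc0.
have q1 e : `|e| = 1 -> mder (fun sg => 0 <= sg <= tau)
    (fun sg (k : Z) => osc1 (lambda e k) sg) (fun sg k => sg%:C * wave e sg k).
  exact: mder_osc1.
have b0 e : mbounded (fun sg => 0 <= sg <= tau) (fun sg (k : Z) => osc0 (lambda e k) sg).
  exact: mbounded_osc0.
have b1 e : mbounded (fun sg => 0 <= sg <= tau) (fun sg (k : Z) => osc1 (lambda e k) sg).
  exact: mbounded_osc1.
have w0 e : mbounded (fun sg => 0 <= sg <= tau) (@wave e) by exact: mbounded_ei.
have w1 e : mbounded (fun sg => 0 <= sg <= tau) (fun sg k => sg%:C * wave e sg k).
  exact: mbounded_sei.
apply: cderD; first apply: cderD.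
- apply: (cder_N3 alg0 aM aM caM).
  + by apply: mderD; [apply: mderD; exact: q0|apply: mderZ; apply: mderD; exact: q1].
  + by apply: mboundedD; [apply: mboundedD|apply: mboundedZ; apply: mboundedD].
  + by apply: mboundedD; [apply: mboundedD|apply: mboundedZ; apply: mboundedD].
- by apply: (cder_Theta alg0 _ aM aM caM); [apply: mderZ; exact: q1|apply: mboundedZ|apply: mboundedZ].
- by apply: (cder_Theta alg0 _ aM aM caM); [apply: mderZ; exact: q1|apply: mboundedZ|apply: mboundedZ].
Qed.

Lemma Psi0 tau a k : Psi tau 0 a k = 0.
Proof.
have z1 : mlt (m_mid tau 0) (cjs a) = fun=> 0.
  by apply/funext => l; rewrite /mlt /m_mid !osc0_0 !osc1_0 !addr0 mulr0 addr0 mul0r.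
have z2 e : mlt (m_end e tau 0) (cjs a) = fun=> 0.
  by apply/funext => l; rewrite /mlt /m_end osc1_0 mulr0 mul0r.
have zS t : S t (fun=> 0) = (fun=> 0 : R[i]) :> (Z -> R[i]).
  by apply/funext => l; rewrite /S mulr0.
have zf b : fconv b (fun=> 0) = (fun=> 0 : R[i]) :> (Z -> R[i]).
  apply/funext => l; rewrite /fconv.
  have l0 : l1 (fun p : Z => b p * 0) 0.
    by move=> F _; rewrite big1// => p _; rewrite mulr0 nc0.
  by apply: nc_eq0; exact: csum_le l0.
by rewrite /Psi z1 !z2 /Theta !zS /N3 !zf !zS !addr0.
Qed.

Lemma bd_wave e sg c C : bd (alpha + 2) c C -> bd (alpha + 2) (mlt (wave e sg) c) C.
Proof. by apply: bd_dom => k; rewrite ncM nc_ei mul1r. Qed.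

Lemma N3_lin3 z z' a b c e A B C E : bd alpha a A -> bd alpha b B -> bd alpha c C ->
  bd alpha e E ->
  N3 a b (fun k => z * c k + z' * e k) = fun k => z * N3 a b c k + z' * N3 a b e k.
Proof.
have [K0 h1 h2] := alg0.
move=> ha hb hc he; have l := h1 _ _ (h2 _ _ _ _ ha hb).
rewrite /N3 (fconvDr l (h1 _ _ (bd_cst z hc)) (h1 _ _ (bd_cst z' he))).
by rewrite (fconvZr z l (h1 _ _ hc)) (fconvZr z' l (h1 _ _ he)).
Qed.

Variable U : R -> Z -> R[i].
Hypothesis flow : is_flow alpha mu T M U.

Lemma regroup_force (f f' X X' N N' Q Q' s D h h' : R[i]) :
  f + f' - (h * N + h * N' + h' * Q + h' * Q') =
  f - X - s * D + (f' - X' - - s * D) + (X - h * N - h' * Q + (X' - h * N' - h' * Q')).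
Proof. by ring. Qed.

(** Two expansions of the force, and two interpolation errors with constant 144 each. *)
Definition C_E := 2 * C_7 K mu M + 288 * K ^+ 2 * (M * M * M).

(* The first order terms [sg D_n] cancel between the forces at [t + sg] and
   [t - sg]: this is where the symmetric two-step scheme gains an order. *)
Lemma bd_force_Phi t tau sg : 0 < tau -> 0 <= t - tau -> t + tau <= T -> 0 <= sg <= tau ->
  bd alpha (fun k => force U t sg k + force U t (- sg) k - Phi tau sg (U t) k)
    (C_E * tau ^+ 2).
Proof.
move=> t0 tm tp /andP[s0 st].
have tT : 0 <= t <= T by apply/andP; split; lra.
have sT : 0 <= t + sg <= T by apply/andP; split; lra.
have smT : 0 <= t + - sg <= T by apply/andP; split; lra.
set a := U t.
have aM2 : bd (alpha + 2) a M by have [h _] := flow; exact: h.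
have M0 := bd_ge0 aM2.
have aM := bd_weaken aM2; have caM := bd_cjs aM2.
have f1 := bd_force2 alg0 alg2 flow tT sT.
have f2 := bd_force2 alg0 alg2 flow tT smT.
have w1 := bd_wave 1 sg caM; have w2 := bd_wave (-1) sg caM.
have w1' := bd_weaken w1; have w2' := bd_weaken w2.
pose th := sg / tau.
have th01 : 0 <= th <= 1.
  by rewrite divr_ge0 ?(ltW t0)//= ler_pdivrMr// mul1r.
have i1 := bd_Theta_interp alg0 tau aM2 aM2 w1 th01.
have i2 := bd_Theta_interp alg0 (- tau) aM2 aM2 w2 th01.
have tht : th * tau = sg by rewrite /th divfK// gt_eqF.
have thtN : th * - tau = - sg by rewrite mulrN tht.
have E1 : S (- sg) (nonlin (S sg a)) = Theta (th * tau) a a (mlt (wave 1 sg) (cjs a)).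
  have <- : (fun k => ei (sg * (2 * freq_sqnorm k))) = wave 1 sg.
    by apply/funext => k; rewrite /wave /lambda mul1r.
  by rewrite tht; exact: nonlin_Theta.
have E2 : S (- - sg) (nonlin (S (- sg) a)) = Theta (th * - tau) a a (mlt (wave (-1) sg) (cjs a)).
  have <- : (fun k => ei (- sg * (2 * freq_sqnorm k))) = wave (-1) sg.
    by apply/funext => k; rewrite /wave /lambda mulN1r mulrN mulNr.
  by rewrite thtN; exact: nonlin_Theta.
have G1 : N3 a a (mlt (g_mid tau sg) (cjs a)) = fun k =>
    (1 - th)%:C * N3 a a (mlt (wave 1 sg) (cjs a)) k +
    (1 - th)%:C * N3 a a (mlt (wave (-1) sg) (cjs a)) k.
  rewrite -(N3_lin3 _ _ aM aM w1' w2').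
  suff -> : mlt (g_mid tau sg) (cjs a) = fun k =>
      (1 - th)%:C * mlt (wave 1 sg) (cjs a) k + (1 - th)%:C * mlt (wave (-1) sg) (cjs a) k by [].
  apply/funext => k.
  by rewrite /mlt /g_mid /th rmorphB rmorphM/=; ring.
have G2 e t' : Theta t' a a (mlt (g_end e tau sg) (cjs a)) =
    fun k => th%:C * Theta t' a a (mlt (wave e sg) (cjs a)) k.
  have we := bd_weaken (bd_wave e sg caM).
  have E0 : S t' (mlt (g_end e tau sg) (cjs a)) =
      fun k => th%:C * S t' (mlt (wave e sg) (cjs a)) k + 0 * S t' (mlt (wave e sg) (cjs a)) k.
    apply/funext => k; rewrite mul0r addr0 /S /mlt /g_end /th rmorphM/=; ring.
  rewrite /Theta E0 (N3_lin3 _ _ (bd_S t' aM) (bd_S t' aM) (bd_S t' we) (bd_S t' we)).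
  by apply/funext => k; rewrite /S; ring.
have H := bdD (bdD f1 f2) (bdD i1 i2).
apply: bd_le (bd_eq _ H) => [|k].
  rewrite normrN (ger0_norm s0) sqrrN.
  (* The sign of [C_7] is read off from the bounds themselves: from [f1] if [sg] is nonzero, and
     from the expansion at [tau] if [sg = 0]. *)
  have C70 : C_7 K mu M * sg ^+ 2 <= C_7 K mu M * tau ^+ 2.
    have f0 := bd_ge0 f1; rewrite (ger0_norm s0) in f0.
    have [sz|sn0] := eqVneq sg 0.
      have := bd_force2 alg0 alg2 flow (sg := tau) tT.
      have tauT : 0 <= t + tau <= T by apply/andP; split; lra.
      move=> /(_ tauT)/bd_ge0; rewrite (ger0_norm (ltW t0)) => h.
      by rewrite sz expr0n mulr0.
    have s2 : 0 < sg ^+ 2 by rewrite exprn_gt0// lt_def sn0.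
    rewrite pmulr_lge0// in f0.
    by rewrite ler_wpM2l// lerXn2r ?nnegrE ?(ltW t0).
  rewrite -subr_ge0 (_ : _ - _ = 2 * (C_7 K mu M * tau ^+ 2 - C_7 K mu M * sg ^+ 2)).
    by rewrite mulr_ge0// subr_ge0.
  by rewrite /C_E; ring.
rewrite E1 E2 /Phi G1 !G2 [(- sg)%:C]rmorphN; exact: regroup_force.
Qed.

Definition C_8 := `|mu| * C_E.

(** Mean value inequality on [[0, tau]] for the curve with [sg] in place of [tau] in the twisted
    terms and in the upper limit of [Psi]. It vanishes at 0, and its derivative is [cmu] times the
    quantity of [bd_force_Phi]; the length of the interval supplies the third power. *)
Lemma bd_local_error t tau : 0 < tau -> 0 <= t - tau -> t + tau <= T ->
  bd alpha (fun k => twisted U t tau k - twisted U t (- tau) k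
                     - cmu mu * Psi tau tau (U t) k) (C_8 * tau ^+ 3).
Proof.
move=> t0 tm tp.
have tT : 0 <= t <= T by apply/andP; split; lra.
have aM2 : bd (alpha + 2) (U t) M by have [h _] := flow; exact: h.
pose D sg := 0 <= sg <= tau.
have n1 : `|-1 : R| = 1 by rewrite normrN1.
have dt k := @cder_twisted _ _ _ _ _ _ _ flow t k.
have dE k : cder D
    (fun sg => twisted U t sg k + (-1) * twisted U t (0 + -1 * sg) k + (- cmu mu) * Psi tau sg (U t) k)
    (fun sg => cmu mu * force U t sg k + (-1) * ((-1)%:C * (cmu mu * force U t (0 + -1 * sg) k))
       + (- cmu mu) * Phi tau sg (U t) k).
  apply: cderD; first apply: cderD.
  - apply: cder_sub (dt k) => sg /andP[s0 st].
    by apply/andP; split; lra.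
  - apply: cderZ.
    have h := cder_comp (c := 0) n1 (dt k).
    apply: cder_sub h => sg /andP[s0 st].
    by rewrite add0r mulN1r; apply/andP; split; lra.
  - by apply: cderZ; exact: cder_Psi.
have H := @bd_mean_value _ _ alpha (fun sg k => twisted U t sg k +
    (-1) * twisted U t (0 + -1 * sg) k + (- cmu mu) * Psi tau sg (U t) k) _ 0 tau
    (C_8 * tau ^+ 2) (ltW t0) dE.
have -> : C_8 * tau ^+ 3 = C_8 * tau ^+ 2 * (tau - 0) by ring.
apply: bd_eq (H _) => [k|sg sD].
  rewrite Psi0 !add0r !mulr0 !mulN1r addr0 !mulNr.
  move: (twisted _ _ _ _) (twisted _ _ _ _) (twisted _ _ _ _) (cmu mu * _) => x y z w; ring.
have h := bd_cst (cmu mu) (bd_force_Phi t0 tm tp sD).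
rewrite nc_cmu mulrA -/C_8 in h; apply: bd_eq h => k.
rewrite add0r !mulN1r rmorphN rmorph1 mulN1r.
move: (force _ _ _ _) (force _ _ _ _) (Phi _ _ _ _) (cmu mu) => x y z w; ring.
Qed.

End two_step.

(** * The scheme on Fourier coefficients *)

Section scheme_sequences.
Context {R : realType} {d : nat}.
Local Notation Z := 'rV[int]_d.
Implicit Types (a b c v : Z -> R[i]) (t tau : R).

(** The symbol of [g (i r Delta)], in the form in which [ilaplacian_fun] produces it. *)
Definition isym (g : R[i] -> R[i]) (r : R) (k : Z) : R[i] :=
  g ('i * (r * - freq_sqnorm k)%:C).

Definition quintic a : Z -> R[i] :=
  fconv (fconv (fconv a (cjs a)) (fconv a (cjs a))) a.

Definition start_seq (mu tau : R) a : Z -> R[i] := fun k =>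
  S tau a k
  - 'i * (mu * tau)%:C *
      S tau (N3 a a (mlt (isym (fun z => phi1 z - phi2 z) (- 2 * tau)) (cjs a))) k
  - 'i * (mu * tau)%:C *
      N3 (S tau a) (S tau a) (S tau (mlt (isym phi2 (- 2 * tau)) (cjs a))) k
  - (mu ^+ 2 * (tau ^+ 2 / 2))%:C * S tau (quintic a) k.

Definition step_seq (mu tau : R) v a : Z -> R[i] := fun k =>
  S (2 * tau) v k
  - 2 * 'i * (mu * tau)%:C *
      S tau (N3 a a (mlt (isym (fun z =>
        (complex.Re (phi1 z) - complex.Re (phi2 z))%:C) (- 2 * tau)) (cjs a))) k
  - 'i * (mu * tau)%:C *
      N3 (S tau a) (S tau a) (S tau (mlt (isym phi2 (- 2 * tau)) (cjs a))) k
  - 'i * (mu * tau)%:C *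
      S (2 * tau) (N3 (S (- tau) a) (S (- tau) a)
        (S (- tau) (mlt (isym phi2 (2 * tau)) (cjs a)))) k.

Fixpoint scheme_seq (mu tau : R) a (n : nat) : Z -> R[i] :=
  match n with
  | 0 => a
  | m.+1 => match m with
            | 0 => start_seq mu tau a
            | p.+1 => step_seq mu tau (scheme_seq mu tau a p) (scheme_seq mu tau a m)
            end
  end.

Lemma cexpJ (z : R[i]) : cexp (conjc z) = conjc (cexp z).
Proof.
case: z => x y; rewrite /cexp /= cosN sinN.
by apply: complex_eq; rewrite /=; ring.
Qed.

Lemma phi1J (z : R[i]) : phi1 (conjc z) = conjc (phi1 z).
Proof.
rewrite /phi1 conjc_eq0; case: eqP => _; first by rewrite conjc1.
by rewrite rmorphM rmorphB rmorph1 cexpJ fmorphV.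
Qed.

Lemma phi2J (z : R[i]) : phi2 (conjc z) = conjc (phi2 z).
Proof.
rewrite /phi2 conjc_eq0; case: eqP => _.
  by rewrite fmorphV rmorph_nat.
by rewrite rmorphM rmorphB cexpJ phi1J fmorphV.
Qed.

Lemma conjc_i (y : R) : conjc ('i * y%:C) = 'i * (- y)%:C.
Proof. by rewrite -complexiE; apply: complex_eq; rewrite /=; ring. Qed.

Lemma addJ (z : R[i]) : z + conjc z = 2 * (complex.Re z)%:C.
Proof. by case: z => x y; apply: complex_eq; rewrite /=; ring. Qed.

(** The forward and backward multipliers are complex conjugates of each other, so their sum is twice
    a real part: this is the origin of [Re phi_j] in the scheme. *)
Lemma isym_mid tau k : 0 < tau -> m_mid tau tau k =
  2 * tau%:C * isym (fun z => (complex.Re (phi1 z) - complex.Re (phi2 z))%:C) (- 2 * tau) k.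
Proof.
move=> t0; rewrite /m_mid /isym /osc0 /osc1 /lambda.
set m := freq_sqnorm k.
have -> : tau * (1 * (2 * m)) = - 2 * tau * - m by ring.
have -> : tau * (-1 * (2 * m)) = - (- 2 * tau * - m) by ring.
rewrite -conjc_i phi1J phi2J; set z := 'i * _.
have tC : tau%:C != 0 :> R[i] by rewrite realC_neq0 ?gt_eqF.
rewrite -!mulrDr !addJ rmorphB/=.
have -> : tau^-1%:C = (tau%:C)^-1 :> R[i] by rewrite fmorphV.
by field.
Qed.

Lemma isym_end (e tau : R) k : 0 < tau -> m_end e tau tau k =
  tau%:C * isym phi2 (- 2 * (e * tau)) k.
Proof.
move=> t0; rewrite /m_end /isym /osc1 /lambda; set m := freq_sqnorm k.
have -> : tau * (e * (2 * m)) = - 2 * (e * tau) * - m by ring.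
have tC : tau%:C != 0 :> R[i] by rewrite realC_neq0 ?gt_eqF.
have -> : tau^-1%:C = (tau%:C)^-1 :> R[i] by rewrite fmorphV.
by field.
Qed.

Lemma S_Theta t a b c : S t (Theta t a b c) = N3 (S t a) (S t b) (S t c).
Proof. by rewrite /Theta SD subrr S0. Qed.

Lemma S_ThetaN t a b c : S t (Theta (- t) a b c) =
  S (2 * t) (N3 (S (- t) a) (S (- t) b) (S (- t) c)).
Proof. by rewrite /Theta SD opprK; congr S; ring. Qed.

Lemma S_Z t z a : S t (fun k => z * a k) = fun k => z * S t a k.
Proof. by apply/funext => k; rewrite /S mulrCA. Qed.

Lemma nc_isym_phi2 r k : nc (isym phi2 r k) <= 1.
Proof. exact: nc_phi2_le. Qed.

Lemma nc_isym_phi12 r k : nc (isym (fun z => phi1 z - phi2 z) r k) <= 2.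
Proof.
rewrite (le_trans (ncB _ _))// -[leRHS]/(1 + 1) lerD//.
  exact: nc_phi1_le.
exact: nc_phi2_le.
Qed.

Lemma nc_isym_re r k :
  nc (isym (fun z => (complex.Re (phi1 z) - complex.Re (phi2 z))%:C) r k) <= 2.
Proof.
rewrite /isym nc_real (le_trans (ler_normB _ _))// -[leRHS]/(1 + 1) lerD//.
  by rewrite (le_trans (nc_Re _))// nc_phi1_le.
by rewrite (le_trans (nc_Re _))// nc_phi2_le.
Qed.

Variables (alpha K mu T M : R).
Hypothesis alg0 : @algebra_const R d alpha K.
Hypothesis alg2 : @algebra_const R d (alpha + 2) K.

Lemma bd_mlt s (p : Z -> R[i]) a A C : 0 <= C -> (forall k, nc (p k) <= C) ->
  bd s a A -> bd s (mlt p a) (C * A).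
Proof. exact: bdM. Qed.

(** Applying [S tau] cancels the outer group of the forward term [Theta tau] and leaves
    [S (2 * tau)] in front of the backward term, which are the two last terms of the scheme. *)
Lemma step_seqE tau v a A k : 0 < tau -> bd alpha a A ->
  step_seq mu tau v a k = S (2 * tau) v k + cmu mu * S tau (Psi tau tau a) k.
Proof.
move=> t0 aA; have caA := bd_cjs aA.
rewrite /step_seq -!addrA; congr (_ + _).
have r := bd_mlt (ler0n _ 2) (nc_isym_re (- 2 * tau)) caA.
have p e := bd_mlt ler01 (nc_isym_phi2 (- 2 * (e * tau))) caA.
have E1 : N3 a a (mlt (m_mid tau tau) (cjs a)) = fun l => 2 * tau%:C * N3 a a (mlt (isym
   (fun z => (complex.Re (phi1 z) - complex.Re (phi2 z))%:C) (- 2 * tau)) (cjs a)) l.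
  rewrite -(N3Z3 alg0 _ aA aA r); congr (N3 _ _ _); apply/funext => l.
  by rewrite /mlt isym_mid// mulrA.
have E2 e t : Theta t a a (mlt (m_end e tau tau) (cjs a)) =
    fun l => tau%:C * Theta t a a (mlt (isym phi2 (- 2 * (e * tau))) (cjs a)) l.
  have -> : mlt (m_end e tau tau) (cjs a) =
      fun l => tau%:C * mlt (isym phi2 (- 2 * (e * tau))) (cjs a) l.
    by apply/funext => l; rewrite /mlt isym_end// mulrA.
  by rewrite /Theta S_Z (N3Z3 alg0 _ (bd_S t aA) (bd_S t aA) (bd_S t (p e))) S_Z.
have -> : S tau (Psi tau tau a) k =
   2 * tau%:C * S tau (N3 a a (mlt (isym
     (fun z => (complex.Re (phi1 z) - complex.Re (phi2 z))%:C) (- 2 * tau)) (cjs a))) k +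
   tau%:C * S tau (Theta tau a a (mlt (isym phi2 (- 2 * (1 * tau))) (cjs a))) k +
   tau%:C * S tau (Theta (- tau) a a (mlt (isym phi2 (- 2 * (-1 * tau))) (cjs a))) k.
  rewrite /S /Psi E1 !E2; move: (ei _) (N3 _ _ _ _) (Theta _ _ _ _ _) (Theta _ _ _ _ _).
  by move=> w x y z; ring.
rewrite S_Theta S_ThetaN mul1r.
have -> : - 2 * (-1 * tau) = 2 * tau by ring.
rewrite /cmu -complexiE !rmorphM.
move: (S _ _ _) (N3 _ _ _ _) (S _ _ _) => x y z; ring.
Qed.

Lemma nc_m_mid tau (k : Z) : 0 < tau -> nc (m_mid tau tau k) <= 4 * tau.
Proof.
move=> t0; rewrite isym_mid// -mulrA !ncM nc_real (gtr0_norm t0).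
have -> : nc (2 : R[i]) = 2 by rewrite -(rmorph_nat (real_complex R)) nc_real normr_nat.
have := nc_isym_re (- 2 * tau) k; move: (nc _) => x hx.
by rewrite (_ : 4 * tau = 2 * (tau * 2)) ?ler_wpM2l ?(ltW t0)//; ring.
Qed.

Lemma nc_m_end e tau (k : Z) : 0 < tau -> nc (m_end e tau tau k) <= tau.
Proof.
by move=> t0; rewrite isym_end// ncM nc_real (gtr0_norm t0) ler_piMr ?(ltW t0)// nc_isym_phi2.
Qed.

Lemma bd_N3_mlt_lip m C a b c c' A e : 0 <= C -> (forall k, nc (m k) <= C) ->
  bd alpha a A -> bd alpha b A -> bd alpha c A ->
  bd alpha (fun k => a k - b k) e -> bd alpha (fun k => c k - c' k) e ->
  bd alpha (fun k => N3 a a (mlt m c) k - N3 b b (mlt m c') k)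
    (3 * K ^+ 2 * C * A ^+ 2 * e).
Proof.
move=> C0 mC aA bA cA ab cc.
have dm : bd alpha (fun k => mlt m c k - mlt m c' k) (C * e).
  by apply: bd_eq (bd_mlt C0 mC cc) => k; rewrite /mlt mulrBr.
apply: bd_le (bd_N3B alg0 ab ab dm aA (bd_mlt C0 mC cA) bA bA).
by apply: le_of_eq; ring.
Qed.

(** [18 = 3 * (4 + 1 + 1)]: three factors to exchange in each of three terms, with multipliers of
    size [4 * tau], [tau] and [tau]. *)
Lemma bd_Psi_lip tau a b A e : 0 < tau -> bd alpha a A -> bd alpha b A ->
  bd alpha (fun k => a k - b k) e ->
  bd alpha (fun k => Psi tau tau a k - Psi tau tau b k) (18 * K ^+ 2 * A ^+ 2 * tau * e).
Proof.
move=> t0 aA bA abe.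
have caA := bd_cjs aA; have cabe := bd_cjs abe; rewrite cjsB in cabe.
have t4 : 0 <= 4 * tau by rewrite mulr_ge0// ltW.
have h1 := bd_N3_mlt_lip t4 (fun k => nc_m_mid k t0) aA bA caA abe cabe.
have hT x t : bd alpha (fun k => Theta t a a (mlt (m_end x tau tau) (cjs a)) k -
    Theta t b b (mlt (m_end x tau tau) (cjs b)) k) (3 * K ^+ 2 * tau * A ^+ 2 * e).
  have Sabe := bd_S t abe; have Scabe := bd_S t cabe; rewrite !SB in Sabe Scabe.
  rewrite /Theta !S_mlt -SB; apply: bd_S.
  exact: (bd_N3_mlt_lip (ltW t0) (fun k => nc_m_end x k t0) (bd_S t aA) (bd_S t bA)
    (bd_S t caA) Sabe Scabe).
apply: bd_le (bd_eq _ (bdD (bdD h1 (hT 1 tau)) (hT (-1) (- tau)))) => [|k].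
  by apply: le_of_eq; ring.
rewrite /Psi; move: (N3 _ _ _ _) (N3 _ _ _ _) (Theta tau _ _ _ _) (Theta tau _ _ _ _).
by move: (Theta _ _ _ _ _) (Theta _ _ _ _ _) => x1 x2 x3 x4 x5 x6; ring.
Qed.

Lemma bd_quintic a A : bd alpha a A -> bd alpha (quintic a) (K ^+ 4 * A ^+ 5).
Proof.
have [_ _ h] := alg0; move=> aA.
have aca := h _ _ _ _ aA (bd_cjs aA).
apply: bd_le (h _ _ _ _ (h _ _ _ _ aca aca) aA).
by apply: le_of_eq; ring.
Qed.

(** Removing four free flows, three inside and one outside, each at the cost of [|t|] and two
    derivatives. *)
Lemma bd_N3_Theta t a b c A B C : bd (alpha + 2) a A -> bd (alpha + 2) b B ->
  bd (alpha + 2) c C ->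
  bd alpha (fun k => N3 a b c k - Theta t a b c k) (4 * K ^+ 2 * (A * B * C) * `|t|).
Proof.
move=> aA bB cC.
have dS (x : Z -> R[i]) X : bd (alpha + 2) x X -> bd alpha (fun k => x k - S t x k) (`|t| * X).
  by move=> xX; apply: bd_eq (bdN (bd_SB t xX)) => k; rewrite opprB.
have h1 := bd_N3B alg0 (dS _ _ aA) (dS _ _ bB) (dS _ _ cC) (bd_weaken bB) (bd_weaken cC)
  (bd_S t (bd_weaken aA)) (bd_S t (bd_weaken bB)).
have h2 := bdN (bd_SB (- t) (bd_N3 alg2 (bd_S t aA) (bd_S t bB) (bd_S t cC))).
apply: bd_le (bd_eq _ (bdD h1 h2)) => [|k].
  by rewrite normrN; apply: le_of_eq; ring.
by rewrite opprB addrA subrK.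
Qed.

Lemma phi_lin r k : isym (fun z => phi1 z - phi2 z) r k + isym phi2 r k = isym phi1 r k.
Proof. exact: subrK. Qed.

Lemma bd_phi1_defect tau a A : bd (alpha + 2) a A -> 0 <= tau ->
  bd alpha (fun k => a k - mlt (isym phi1 (- 2 * tau)) a k) (2 * tau * A).
Proof.
move=> aA t0; have C0 : 0 <= 2 * tau by rewrite mulr_ge0.
apply: bd_eq (bdN (bdM2 C0 (m := fun k => isym phi1 (- 2 * tau) k - 1) _ aA)) => k.
  by rewrite /mlt mulrBl mul1r opprB.
rewrite (le_trans (nc_phi1B1 _))// !normrM !normrN (ger0_norm t0).
by rewrite ger0_norm// (ger0_norm (freq_sqnorm_ge0 k)) ler_wpM2l// lerDr.
Qed.

Variable U : R -> Z -> R[i].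
Hypothesis flow : is_flow alpha mu T M U.

Definition C_9 := C_4 K mu M + `|mu| * (6 * K ^+ 2 * M ^+ 3) +
  mu ^+ 2 / 2 * (K ^+ 4 * M ^+ 5).

(** The tangent expansion [bd_twisted2] is compared with the step: undoing the flows in the [phi2]
    term costs the constant 4, and replacing [phi1], the sum of the two multipliers, by 1 costs 2,
    hence the 6 in [C_9]. The quintic term is estimated by its size [tau^2]. *)
Lemma bd_start_error tau : 0 < tau <= T ->
  bd alpha (fun k => U tau k - start_seq mu tau (U 0) k) (C_9 * tau ^+ 2).
Proof.
move=> /andP[t0 tT].
have T0 : (0 : R) <= 0 <= T by apply/andP; split; lra.
have tT' : 0 <= 0 + tau <= T by apply/andP; split; lra.
set a := U 0.
have aM2 : bd (alpha + 2) a M by have [h _] := flow; exact: h.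
have aM := bd_weaken aM2; have caM2 := bd_cjs aM2; have caM := bd_cjs aM.
have h1 := bd_twisted2 alg0 alg2 flow T0 tT'.
have p12 := bd_mlt (ler0n _ 2) (nc_isym_phi12 (- 2 * tau)) caM.
have p1 : forall k : Z, nc (isym phi1 (- 2 * tau) k) <= 1 by move=> k; exact: nc_phi1_le.
have pp1 := bd_mlt ler01 p1 caM.
have p2 := bd_mlt ler01 (nc_isym_phi2 (- 2 * tau)) caM.
have p2' := bd_mlt ler01 (nc_isym_phi2 (- 2 * tau)) caM2.
rewrite !mul1r in p2 p2'.
have [K0 l h] := alg0.
have h2 := bd_N3 alg0 aM aM (bd_phi1_defect caM2 (ltW t0)).
have h3 := bd_N3_Theta tau aM2 aM2 p2'.
rewrite (gtr0_norm t0) in h1 h3.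
have h4 := bd_cst (mu ^+ 2 * (tau ^+ 2 / 2))%:C (bd_quintic aM).
have h5 := bd_cst (cmu mu * tau%:C) (bdD h2 h3).
have hS := bd_S tau (bdD h1 (bdD h5 h4)).
apply: bd_le (bd_eq _ hS) => [|k].
  rewrite nc_real ncM nc_cmu nc_real (gtr0_norm t0) (ger0_norm (x := mu ^+ 2 * _)); last first.
    by rewrite mulr_ge0 ?sqr_ge0// divr_ge0// sqr_ge0.
  by apply: le_of_eq; rewrite /C_9; field.
have E : N3 a a (fun k => cjs a k - mlt (isym phi1 (- 2 * tau)) (cjs a) k) = fun k =>
   N3 a a (cjs a) k - N3 a a (mlt (isym (fun z => phi1 z - phi2 z) (- 2 * tau)) (cjs a)) k
   - N3 a a (mlt (isym phi2 (- 2 * tau)) (cjs a)) k.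
  rewrite /N3 (fconvBr alg0 (h _ _ _ _ aM aM) caM pp1).
  have -> : mlt (isym phi1 (- 2 * tau)) (cjs a) = fun k =>
      mlt (isym (fun z => phi1 z - phi2 z) (- 2 * tau)) (cjs a) k +
      mlt (isym phi2 (- 2 * tau)) (cjs a) k.
    by apply/funext => k'; rewrite /mlt -mulrDl phi_lin.
  rewrite (fconvDr (l _ _ (h _ _ _ _ aM aM)) (l _ _ p12) (l _ _ p2)).
  by apply/funext => k'; rewrite opprD addrA.
rewrite E.
have ES : S tau (Theta tau a a (mlt (isym phi2 (- 2 * tau)) (cjs a))) =
    N3 (S tau a) (S tau a) (S tau (mlt (isym phi2 (- 2 * tau)) (cjs a))).
  exact: S_Theta.
have EU : U tau = S tau (twisted U 0 tau) by rewrite /twisted SD subrr S0 add0r.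
rewrite /start_seq -ES {1}EU /S.
move: (ei _) => w.
have -> : 'i * (mu * tau)%:C = - (cmu mu * tau%:C) :> R[i].
  by rewrite /cmu -complexiE rmorphM/=; ring.
rewrite /nonlin -/a.
move: (twisted _ _ _ _) (cmu mu) (a k) (N3 _ _ _ _) (N3 _ _ _ _) (N3 _ _ _ _)
  (Theta _ _ _ _ _) ((_ * (_ / 2))%:C) (quintic _ _) => W m z n1 n2 n3 th q Q.
ring.
Qed.

End scheme_sequences.

(** * Stability and convergence *)

Section stability.
Context {R : realType} {d : nat}.
Local Notation Z := 'rV[int]_d.
Variables (alpha K mu T M : R).
Hypothesis alg0 : @algebra_const R d alpha K.
Hypothesis alg2 : @algebra_const R d (alpha + 2) K.
Hypothesis T0 : 0 < T.
Variable U : R -> Z -> R[i].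
Hypothesis flow : is_flow alpha mu T M U.

(** The Lipschitz constant of the nonlinear part per unit of time on the ball of radius [M + 1],
    which contains every iterate within distance 1 of the solution. *)
Definition lip_const := `|mu| * (18 * K ^+ 2 * (M + 1) ^+ 2).
(** A discrete Gronwall bound. Absolute values make [C_8] and [C_9] nonnegative; the final 1 makes
    the constant at least 1, so that its inverse is an admissible step size at most 1. *)
Definition error_const :=
  expR (lip_const * T) * (`|C_9 K mu M| + T * `|C_8 K mu M|) + 1.

Lemma lip_const_ge0 : 0 <= lip_const.
Proof. by rewrite /lip_const mulr_ge0// mulr_ge0 ?sqr_ge0// mulr_ge0 ?sqr_ge0. Qed.

Lemma error_const_gt0 : 0 < error_const.
Proof.
rewrite /error_const ltr_wpDl//.
by rewrite mulr_ge0 ?expR_ge0// addr_ge0// mulr_ge0// ltW.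
Qed.

(** An explicit majorant of the error recursion: the starting error plus [n] local errors, all
    amplified [n] times. *)
Definition eta tau (n : nat) :=
  (1 + lip_const * tau) ^+ n * (`|C_9 K mu M| * tau ^+ 2 + n%:R * (`|C_8 K mu M| * tau ^+ 3)).

Lemma eta_ge0 tau n : 0 < tau -> 0 <= eta tau n.
Proof.
move=> t0; have t1 := ltW t0; have L0 := lip_const_ge0.
have q0 : 0 <= 1 + lip_const * tau by rewrite addr_ge0// mulr_ge0.
have p0 m : 0 <= tau ^+ m by rewrite exprn_ge0.
apply: mulr_ge0; first exact: exprn_ge0.
by apply: addr_ge0; [exact: mulr_ge0|apply: mulr_ge0 => //; exact: mulr_ge0].
Qed.

Lemma eta_step tau n : 0 < tau ->
  (1 + lip_const * tau) * eta tau n + `|C_8 K mu M| * tau ^+ 3 <= eta tau n.+1.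
Proof.
move=> t0; have L0 := lip_const_ge0.
have q1 : 1 <= 1 + lip_const * tau by rewrite lerDl mulr_ge0// ltW.
rewrite /eta -natr1.
set x := `|_| * tau ^+ 3; set y := `|_| * tau ^+ 2; set q := 1 + _ in q1 *.
have x0 : 0 <= x by rewrite mulr_ge0// exprn_ge0// ltW.
have q2 : 1 <= q * q ^+ n by rewrite -exprS exprn_ege1.
have h : x <= q * q ^+ n * x by rewrite ler_peMl.
rewrite -subr_ge0 (_ : _ - _ = q * q ^+ n * x - x) ?subr_ge0//.
by rewrite (exprS q); move: (q ^+ n) => z; ring.
Qed.

(** Monotonicity replaces the error two steps back by the last one, which turns the two-step
    recursion into a one-step Gronwall inequality. *)
Lemma eta_mono tau n : 0 < tau -> eta tau n <= eta tau n.+1.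
Proof.
move=> t0; rewrite (le_trans _ (eta_step n t0))// ler_wpDr//.
  by rewrite mulr_ge0// exprn_ge0// ltW.
by rewrite ler_peMl ?eta_ge0// lerDl mulr_ge0 ?lip_const_ge0// ltW.
Qed.

Lemma eta_le tau n : 0 < tau -> n%:R * tau <= T -> eta tau n <= (error_const - 1) * tau ^+ 2.
Proof.
move=> t0 nT; have t1 := ltW t0.
have L0 := lip_const_ge0.
have p0 m : 0 <= tau ^+ m by rewrite exprn_ge0.
rewrite /error_const addrK -mulrA /eta ler_pM//.
- by apply: exprn_ge0; rewrite addr_ge0// mulr_ge0.
- by apply: addr_ge0; [exact: mulr_ge0|apply: mulr_ge0 => //; exact: mulr_ge0].
- apply: (@le_trans _ _ (expR (lip_const * tau) ^+ n)).
    rewrite lerXn2r ?nnegrE ?expR_ge0 ?expR_ge1Dx//.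
    by rewrite addr_ge0// mulr_ge0.
  by rewrite -expRM_natl ler_expR mulrCA ler_wpM2l.
- rewrite mulrDl lerD2l (_ : n%:R * _ = n%:R * tau * (`|C_8 K mu M| * tau ^+ 2)); last by ring.
  by rewrite -[leRHS]mulrA ler_wpM2r// mulr_ge0.
Qed.

Section fixed_step.
Variable tau : R.
Hypothesis tau0 : 0 < tau.
Hypothesis small : error_const * tau ^+ 2 <= 1.
Local Notation A := (scheme_seq mu tau (U 0)).

Let eta_le1 n : n%:R * tau <= T -> eta tau n <= 1.
Proof.
move=> /(eta_le tau0)/le_trans; apply; rewrite (le_trans _ small)//.
by rewrite ler_wpM2r ?sqr_ge0// lerBlDr lerDl.
Qed.

Let bd_initial_error : bd alpha (fun k => U (0%:R * tau) k - A 0 k) (eta tau 0).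
Proof.
have T00 : (0 : R) <= 0 <= T by rewrite lexx ltW.
have [h _] := flow.
apply: bd_le (bd_eq _ (bd_cst 0 (bd_weaken (h _ T00)))) => [|k].
  by rewrite nc0 mul0r eta_ge0.
by rewrite /= !mul0r subrr.
Qed.

(** Two consecutive errors are carried because each step uses two iterates. [eta <= 1] places the
    current iterate in the ball of radius [M + 1], where the Lipschitz bound is valid. *)
Lemma bd_two_errors n : n.+1%:R * tau <= T ->
  bd alpha (fun k => U (n%:R * tau) k - A n k) (eta tau n) /\
  bd alpha (fun k => U (n.+1%:R * tau) k - A n.+1 k) (eta tau n.+1).
Proof.
have t1 := ltW tau0.
have UM t : 0 <= t <= T -> bd alpha (U t) M.
  by move=> tT; have [h _] := flow; exact: bd_weaken (h _ tT).
elim: n => [tT|n IH nT].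
  rewrite mul1r in tT; split.
    exact: bd_initial_error.
  rewrite mul1r; have tT' : 0 < tau <= T by rewrite tau0.
  apply: bd_le (bd_start_error alg0 alg2 flow tT').
  rewrite (@le_trans _ _ (eta tau 0))//; last exact: eta_mono.
  by rewrite /eta expr0 mul1r mul0r addr0 ler_wpM2r ?sqr_ge0// ler_norm.
have nT' : n.+1%:R * tau <= T.
  by rewrite (le_trans _ nT)// ler_wpM2r// ler_nat.
have [e0 e1] := IH nT'; split=> //.
set t := n.+1%:R * tau in e1 nT'.
have tE : n.+2%:R * tau = t + tau by rewrite /t -natr1 mulrDl mul1r.
have tE' : n%:R * tau = t + - tau by rewrite /t -natr1; ring.
rewrite tE in nT *; rewrite tE' in e0.
have tm : 0 <= t - tau by rewrite -tE' mulr_ge0.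
have tT : 0 <= t <= T by rewrite nT' /t mulr_ge0.
have aM := UM _ tT.
have aM1 : bd alpha (U t) (M + 1) by apply: bd_le aM; rewrite lerDl.
have AM1 : bd alpha (A n.+1) (M + 1).
  apply: bd_le (bd_eq _ (bdB aM e1)) => [|k]; last by rewrite opprB addrC subrK.
  by rewrite lerD2l eta_le1.
have loc := bd_local_error alg0 alg2 flow tau0 tm nT.
have lip := bd_cst (cmu mu) (bd_Psi_lip alg0 tau0 aM1 AM1 e1).
rewrite nc_cmu in lip.
(* The new error consists of the local error, the error two steps back moved by the unitary
   [S (2 * tau)], and the Lipschitz term of the last error. *)
have H := bdD (bdD (bd_S tau loc) (bd_S (2 * tau) e0)) (bd_S tau lip).
apply: bd_le (bd_eq _ H) => [|k].
  rewrite (le_trans _ (eta_step n.+1 tau0))// [(1 + lip_const * _) * _]mulrDl mul1r.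
  have := eta_mono n tau0.
  have : C_8 K mu M * tau ^+ 3 <= `|C_8 K mu M| * tau ^+ 3.
    by rewrite ler_wpM2r ?exprn_ge0// ler_norm.
  have -> : `|mu| * (18 * K ^+ 2 * (M + 1) ^+ 2 * tau * eta tau n.+1) =
      lip_const * tau * eta tau n.+1 by rewrite /lip_const; ring.
  by lra.
rewrite -[A n.+2 k]/(step_seq mu tau (A n) (A n.+1) k) (step_seqE mu alg0 _ k tau0 AM1).
have E1 : U (t + tau) = S tau (twisted U t tau) by rewrite twisted_S.
have E2 : S (2 * tau) (U (t + - tau)) = S tau (twisted U t (- tau)).
  by rewrite /twisted SD; congr S; ring.
have E2k : ei (- (2 * tau * freq_sqnorm k)) * U (t + - tau) k =
  ei (- (tau * freq_sqnorm k)) * twisted U t (- tau) k by exact: (congr1 (fun f => f k) E2).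
rewrite E1 /S !mulrBr E2k.
move: (ei _) (ei _) (twisted _ _ _ _) (twisted _ _ _ _) (Psi _ _ _ _) (Psi _ _ _ _) (cmu mu).
move: (scheme_seq _ _ _ _ _) => v w w' x x' y y' m; ring.
Qed.

Lemma bd_scheme_error n : n%:R * tau <= T ->
  bd alpha (fun k => U (n%:R * tau) k - A n k) (error_const * tau ^+ 2).
Proof.
move=> nT.
have h : eta tau n <= error_const * tau ^+ 2.
  rewrite (le_trans (eta_le tau0 nT))// ler_wpM2r ?sqr_ge0//.
  by rewrite lerBlDr lerDl.
apply: bd_le h _; case: n nT => [|n] nT; last by have [] := bd_two_errors nT.
exact: bd_initial_error.
Qed.

End fixed_step.
End stability.

(** * From coefficients back to functions and solutions *)

Section functions.
Context {R : realType} {d : nat}.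
Local Notation Z := 'rV[int]_d.
Variables (alpha K mu T : R).
Hypothesis alg0 : @algebra_const R d alpha K.
Implicit Types (u v : d.-tuple R -> R[i]) (a b : Z -> R[i]).

Let bdl1 a A : bd alpha a A -> l1 a (K * A).
Proof. by have [_ h _] := alg0; exact: h. Qed.
Let bdfconv a b A B : bd alpha a A -> bd alpha b B -> bd alpha (fconv a b) (K * (A * B)).
Proof. by have [_ _ h] := alg0; exact: h. Qed.
Let repM u v a b : rep alpha u a -> rep alpha v b ->
  rep alpha (fun x => u x * v x) (fconv a b).
Proof. exact: (repM bdl1 bdfconv). Qed.

Lemma rep_ilaplacian g r C u a : (forall k : Z, nc (isym g r k) <= C) -> rep alpha u a ->
  rep alpha (ilaplacian_fun g r u) (mlt (isym g r) a).
Proof. exact: (rep_laplacian bdl1). Qed.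

Lemma rep_schroedinger t u a : rep alpha u a -> rep alpha (schroedinger_group t u) (S t a).
Proof.
have E : isym cexp t = fun k : Z => ei (- (t * freq_sqnorm k)).
  by apply/funext => k; rewrite /isym cexp_i mulrN.
have -> : S t a = mlt (isym cexp t) a by rewrite E.
by apply: (rep_ilaplacian (C := 1)) => k; rewrite E nc_ei.
Qed.

Lemma rep_sqrM u v a b : rep alpha u a -> rep alpha v b ->
  rep alpha (fun x => u x ^+ 2 * v x) (N3 a a b).
Proof. by move=> ua vb; under eq_fun do rewrite expr2; apply: repM => //; exact: repM. Qed.

Lemma rep_cubic u a : rep alpha u a -> rep alpha (fun x => `|u x| ^+ 2 * u x) (nonlin a).
Proof.
move=> ua; have := rep_sqrM ua (rep_conj ua).
rewrite (_ : (fun x => u x ^+ 2 * cconj u x) = (fun x => `|u x| ^+ 2 * u x))//.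
by apply/funext => x; rewrite normCK /cconj expr2 mulrAC.
Qed.

Lemma rep_quintic u a : rep alpha u a -> rep alpha (fun x => `|u x| ^+ 4 * u x) (quintic a).
Proof.
move=> ua; have uu := repM ua (rep_conj ua); have := repM (repM uu uu) ua.
rewrite (_ : (fun x => u x * cconj u x * (u x * cconj u x) * u x) =
  (fun x => `|u x| ^+ 4 * u x))//.
by apply/funext => x; rewrite (exprM _ 2 2) normCK expr2.
Qed.

Lemma rep_start tau u a : rep alpha u a ->
  rep alpha (sLRI2_start mu tau u) (start_seq mu tau a).
Proof.
move=> ua; have cua := rep_conj ua.
have p12 := rep_ilaplacian (nc_isym_phi12 (- 2 * tau)) cua.
have p2 := rep_ilaplacian (nc_isym_phi2 (- 2 * tau)) cua.
have S1 v b t := @rep_schroedinger t v b.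
apply: repB; first apply: repB; first apply: repB.
- exact: rep_schroedinger.
- by apply: repZ; apply: rep_schroedinger; exact: rep_sqrM.
- by apply: repZ; apply: rep_sqrM; exact: rep_schroedinger.
- by apply: repZ; apply: rep_schroedinger; exact: rep_quintic.
Qed.

Lemma rep_step tau v u b a : rep alpha v b -> rep alpha u a ->
  rep alpha (sLRI2_step mu tau v u) (step_seq mu tau b a).
Proof.
move=> vb ua; have cua := rep_conj ua.
have p12 := rep_ilaplacian (nc_isym_re (- 2 * tau)) cua.
have p2 r := rep_ilaplacian (nc_isym_phi2 r) cua.
apply: repB; first apply: repB; first apply: repB.
- exact: rep_schroedinger.
- by apply: repZ; apply: rep_schroedinger; exact: rep_sqrM.
- by apply: repZ; apply: rep_sqrM; exact: rep_schroedinger.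
- by apply: repZ; apply: rep_schroedinger; apply: rep_sqrM; exact: rep_schroedinger.
Qed.

Lemma rep_scheme tau u a n : rep alpha u a ->
  rep alpha (sLRI2 mu tau u n) (scheme_seq mu tau a n).
Proof.
move=> ua; suff [] : rep alpha (sLRI2 mu tau u n) (scheme_seq mu tau a n) /\
  rep alpha (sLRI2 mu tau u n.+1) (scheme_seq mu tau a n.+1) by [].
elim: n => [|n [h0 h1]]; first by split => //; exact: rep_start.
by split => //; exact: rep_step.
Qed.

Section solution.
Variables (u0 : d.-tuple R -> R[i]) (u : R -> d.-tuple R -> R[i]).
Hypothesis T0 : 0 < T.
Hypothesis sol : nls_solution alpha mu T u0 u.
Hypothesis supu : (sobolev_sup (alpha + 2) T u < +oo)%E.
Let M := fine (sobolev_sup (alpha + 2) T u).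

Lemma sobolev_norm_ge0 s v : (0 <= sobolev_norm s v)%E.
Proof. exact: sqrte_ge0. Qed.

Lemma sobolev_norm_le_sup t : 0 <= t <= T ->
  (sobolev_norm (alpha + 2) (u t) <= sobolev_sup (alpha + 2) T u)%E.
Proof. by move=> tT; apply: ereal_sup_ubound; exists t => //=; rewrite in_itv. Qed.

Lemma sobolev_supE : sobolev_sup (alpha + 2) T u = M%:E.
Proof.
have T00 : (0 : R) <= 0 <= T by rewrite lexx ltW.
have h := le_trans (sobolev_norm_ge0 _ _) (sobolev_norm_le_sup T00).
by rewrite /M fineK// ge0_fin_numE.
Qed.

Lemma sup_ge0 : 0 <= M.
Proof.
have T00 : (0 : R) <= 0 <= T by rewrite lexx ltW.
have := le_trans (sobolev_norm_ge0 _ _) (sobolev_norm_le_sup T00).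
by rewrite sobolev_supE lee_fin.
Qed.

Lemma bd_solution t : 0 <= t <= T -> bd (alpha + 2) (fourier_coef (u t)) M.
Proof.
move=> tT; apply/(sobolev_norm_coef_le _ _ sup_ge0).
by rewrite -sobolev_supE; exact: sobolev_norm_le_sup.
Qed.

Lemma rep_solution t : 0 <= t <= T -> rep alpha (u t) (fourier_coef (u t)).
Proof.
move=> tT; have [_ h _ _] := sol; have [uL2 _] := h t tT.
by split=> //; exists M; exact: bd_weaken (bd_solution tT).
Qed.

Lemma difference_quotient_eq (j h p q r : R[i]) : j * j = -1 -> h != 0 ->
  p - q - h * (- j * r) = - j * h * (j * h^-1 * (p - q) - r).
Proof.
move=> j2 h0; rewrite [RHS](_ : _ = - (j * j) * (h / h) * (p - q) + j * h * r); last by ring.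
by rewrite j2 opprK mul1r divff// mul1r; ring.
Qed.

(** The remainder of the difference quotient at frequency [k] is [- i h] times the residual, and the
    [H^(alpha-2)] norm controls each single coefficient of the residual. *)
Lemma is_flow_solution : is_flow alpha mu T M (fun t => fourier_coef (u t)).
Proof.
split=> [t|k t tT e e0]; first exact: bd_solution.
have [_ _ _ /(_ t tT) hres] := sol.
have w0 : 0 < weight k `^ (alpha - 2) :> R by exact: weight_powR_gt0.
(* [e'] absorbs the weight of the frequency [k], so that a norm below [e'] leaves a coefficient of
   modulus at most [e]. *)
pose e' := Num.sqrt (weight k `^ (alpha - 2)) * e.
have e'0 : 0 < e' by rewrite mulr_gt0// sqrtr_gt0.
have : \forall h \near within [set h | 0 <= t + h <= T] (0 : R)^',
    (sobolev_norm_coef (alpha - 2) (nls_residual mu u t h) < e'%:E)%E.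
  apply: (hres [set x | (x < e'%:E)%E]); apply: open_nbhs_nbhs; split => /=.
    exact: open_ereal_lt_ereal.
  by rewrite lte_fin.
move=> /nbhs_ballP[dl /= dl0 hdl]; exists dl => // y yT yt.
(* The limit is taken along a punctured neighbourhood; at [y = t] the inequality reads [0 <= 0]. *)
have [->|yNt] := eqVneq y t; first by rewrite !subrr normr0 mulr0 mul0r subrr nc0.
have h0 : y - t != 0 by rewrite subr_eq0.
have ty : t + (y - t) = y by rewrite addrC subrK.
have := hdl (y - t); rewrite /ball/= sub0r normrN ty => /(_ yt h0 yT)/ltW.
move=> /(sobolev_norm_coef_le _ _ (ltW e'0))/(bd_pt k) hk.
have key (x : R) : 0 <= x -> weight k `^ (alpha - 2) * x ^+ 2 <= e' ^+ 2 -> x <= e.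
  move=> x0; rewrite /e' exprMn sqr_sqrtr ?(ltW w0)// ler_pM2l//.
  by rewrite ler_pXn2r// nnegrE ltW.
have {}hk := key _ (nc_ge0 _) hk.
have [_ cE _] := rep_cubic (rep_solution tT).
have hC := realC_neq0 h0.
rewrite [X in nc X](_ : _ = - 'i%C * (y - t)%:C * nls_residual mu u t (y - t) k).
  by rewrite !ncM ncN nci mul1r nc_real mulrC ler_wpM2r.
rewrite /nls_residual ty cE -complexiE fmorphV.
have i2 : 'i%C * 'i%C = -1 :> R[i] by rewrite -expr2 sqr_i.
exact: difference_quotient_eq.
Qed.

End solution.
End functions.

Theorem corollary3p13 (R : realType) (d : nat) (alpha mu T : R) :
  (1 <= d <= 3)%N -> d%:R / 2 < alpha -> mu != 0 -> 0 < T ->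
  exists C tau0 : R -> R,
    (forall M : R, 0 < C M /\ 0 < tau0 M) /\
    forall (u0 : d.-tuple R -> R[i]) (u : R -> d.-tuple R -> R[i]),
      nls_solution alpha mu T u0 u ->
      (sobolev_sup (alpha + 2) T u < +oo)%E ->
      let M := fine (sobolev_sup (alpha + 2) T u) in
      forall tau : R, 0 < tau <= tau0 M ->
      forall n : nat, n%:R <= T / tau ->
        let err := fun x => u (n%:R * tau) x - sLRI2 mu tau u0 n x in
        sobolev alpha err /\
        (sobolev_norm alpha err <= (C M * tau ^+ 2)%:E)%E.
Proof.
move=> /andP[d0 _] dalpha _ T0.
have [K1 [K10 h1 h1']] := @bd_algebra R d alpha d0 dalpha.
have dalpha2 : d%:R / 2 < alpha + 2 by rewrite (lt_trans dalpha)// ltrDl.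
have [K2 [K20 h2 h2']] := @bd_algebra R d (alpha + 2) d0 dalpha2.
(* [algebra_const] is monotone in the constant, so one [K] serves both [H^alpha] and
   [H^(alpha+2)]. *)
pose K := K1 + K2.
have alg0 : @algebra_const R d alpha K.
  by apply: (algebra_const_le (K := K1)); [rewrite lerDl ltW|split].
have alg2 : @algebra_const R d (alpha + 2) K.
  by apply: (algebra_const_le (K := K2)); [rewrite lerDr ltW|split].
(* As [C >= 1], the threshold [tau <= 1 / C] gives both [tau <= 1] and [C tau <= 1], hence the
   smallness [C tau^2 <= 1] that the induction needs. *)
exists (error_const K mu T), (fun M => (error_const K mu T M)^-1); split=> [M|u0 u sol supu].
  by rewrite invr_gt0 error_const_gt0.
set M := fine _ => /= tau /andP[t0 tC] n; rewrite ler_pdivlMr// => nT.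
have C0 : 0 < error_const K mu T M by exact: error_const_gt0.
have small : error_const K mu T M * tau ^+ 2 <= 1.
  have Ct : error_const K mu T M * tau <= 1 by rewrite mulrC -ler_pdivlMr// div1r.
  have t1 : tau <= 1.
    rewrite (le_trans tC)// invf_le1// /error_const lerDr.
    by rewrite mulr_ge0 ?expR_ge0// addr_ge0// mulr_ge0// ltW.
  rewrite expr2 mulrA (le_trans _ t1)// -[leRHS]mul1r ler_wpM2r// ltW//.
have flow := is_flow_solution alg0 T0 sol supu.
have nT' : 0 <= n%:R * tau <= T by rewrite nT mulr_ge0// ltW.
have T00 : (0 : R) <= 0 <= T by rewrite lexx ltW.
have [u00 _ _ _] := sol.
have ru := rep_solution T0 sol supu nT'.
have rs := rep_scheme mu alg0 tau n (rep_solution T0 sol supu T00).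
rewrite u00 in rs.
have H := bd_scheme_error alg0 alg2 T0 flow t0 small nT.
have [L2 cE _] := repB ru rs.
have D0 : 0 <= error_const K mu T M * tau ^+ 2 by rewrite mulr_ge0 ?sqr_ge0// ltW.
have N : (sobolev_norm alpha (fun x => (u (n%:R * tau) x - sLRI2 mu tau u0 n x)%R) <=
    (error_const K mu T M * tau ^+ 2)%:E)%E.
  by rewrite /sobolev_norm cE; apply/(sobolev_norm_coef_le _ _ D0); rewrite -u00.
by split=> //; split=> //; apply: le_lt_trans N _; rewrite ltry.
Qed.
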